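(* Let $\mathcal{C}$ be a symmetric tensor category over a field of characteristic zero, let $V\in\mathcal{C}$, let $A=T(V)$, and let $k\ge 2$. There exist a finite collection $\Lambda_k$ of Young diagrams (repetitions allowed) and a surjection $$\bigoplus_{\lambda\in\Lambda_k}\mathcal{G}_{\lambda}(V) \to B_k(A).$$
   Context: A symmetric tensor category is a $k$-linear abelian symmetric monoidal category with exact bilinear tensor product, over a field of characteristic zero; infinite direct sums such as $T(V)=\bigoplus_i V^{\otimes i}$ are taken in $\mathcal{C}$ (or its ind-completion). ''Surjection'' means epimorphism. With symmetry $\sigma$ and multiplication $m$, the commutator on $A$ is $[\cdot,\cdot]=m\circ(\mathrm{id}-\sigma_{A,A})$; $L_1=A$, $L_{i+1}=[A,L_i]$ (image of $A\otimes L_i$ under the commutator), $B_i(A)=L_i/L_{i+1}$. For a Young diagram $\lambda$ of size $j$ with irreducible representation $W_\lambda$ of the symmetric group $S_j$, $\mathbb{S}_\lambda(V)=(W_\lambda\otimes V^{\otimes j})^{S_j}$ is the Schur functor. $S(V)$ and $\Lambda(V)$ are the symmetric and exterior algebras of $V$ in $\mathcal{C}$, $\Omega(V)=S(V)\otimes\Lambda(V)$ is graded by degree in $\Lambda(V)$, and $\Omega^{ev}(V)$ is its even-degree part. $\mathcal{G}_\lambda(V):=\mathbb{S}_\lambda(V)\otimes\Omega^{ev}(V)$. *)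

(* Defs.v *)
From HB Require Import structures.
From mathcomp Require Import all_boot all_order all_algebra all_fingroup all_character.
From mathcomp Require Import boolp.

Set Implicit Arguments.
Unset Strict Implicit.
Unset Printing Implicit Defensive.

Import GRing.Theory.
Local Open Scope ring_scope.

(** * Linear categories and universal properties *)

Record linear_category (k : fieldType) := LinearCategory {
  obj :> Type;
  Mor : obj -> obj -> lmodType k;
  idmor : forall X, Mor X X;
  compm : forall X Y Z, Mor Y Z -> Mor X Y -> Mor X Z;
  comp_idl : forall X Y (f : Mor X Y), compm (idmor Y) f = f;
  comp_idr : forall X Y (f : Mor X Y), compm f (idmor X) = f;
  compA : forall X Y Z W (h : Mor Z W) (g : Mor Y Z) (f : Mor X Y),
    compm h (compm g f) = compm (compm h g) f;
  comp_linear_l : forall X Y Z (f : Mor X Y) (a : k) (g g' : Mor Y Z),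
    compm (a *: g + g') f = a *: compm g f + compm g' f;
  comp_linear_r : forall X Y Z (g : Mor Y Z) (a : k) (f f' : Mor X Y),
    compm g (a *: f + f') = a *: compm g f + compm g f' }.

Arguments Mor {k l} X Y.
Arguments idmor {k l} X.
Arguments compm {k l X Y Z} g f.

Declare Scope cat_scope.
Delimit Scope cat_scope with cat.
Notation "g \c f" := (compm g f) (at level 40, left associativity) : cat_scope.
Local Open Scope cat_scope.

Section UniversalProperties.
Context {k : fieldType} {C : linear_category k}.

Definition mono {X Y : C} (f : Mor X Y) : Prop :=
  forall T (g h : Mor T X), f \c g = f \c h -> g = h.

Definition epi {X Y : C} (f : Mor X Y) : Prop :=
  forall T (g h : Mor Y T), g \c f = h \c f -> g = h.

Definition inverse_of {X Y : C} (f : Mor X Y) (g : Mor Y X) : Prop :=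
  g \c f = idmor X /\ f \c g = idmor Y.

Definition is_iso {X Y : C} (f : Mor X Y) : Prop := exists g, inverse_of f g.

Definition is_kernel {K X Y : C} (i : Mor K X) (f : Mor X Y) : Prop :=
  f \c i = 0 /\
  forall T (g : Mor T X), f \c g = 0 -> exists! h : Mor T K, i \c h = g.

Definition is_cokernel {X Y Q : C} (p : Mor Y Q) (f : Mor X Y) : Prop :=
  p \c f = 0 /\
  forall T (g : Mor Y T), g \c f = 0 -> exists! h : Mor Q T, h \c p = g.

Definition short_exact {X Y Z : C} (f : Mor X Y) (g : Mor Y Z) : Prop :=
  is_kernel f g /\ is_cokernel g f.

Definition is_coproduct {X : nat -> C} {S : C} (inj : forall n, Mor (X n) S) : Prop :=
  forall Y (f : forall n, Mor (X n) Y),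
    exists! u : Mor S Y, forall n, u \c inj n = f n.

Definition copair {X : nat -> C} {S : C} {inj : forall n, Mor (X n) S}
    (H : is_coproduct inj) {Y : C} (f : forall n, Mor (X n) Y) : Mor S Y :=
  projT1 (cid (H Y f)).

End UniversalProperties.

Record kernel {k : fieldType} {C : linear_category k} {X Y : C} (f : Mor X Y) := Kernel {
  ker_obj : C;
  ker_arr : Mor ker_obj X;
  ker_arrP : is_kernel ker_arr f }.

Record cokernel {k : fieldType} {C : linear_category k} {X Y : C} (f : Mor X Y) := Cokernel {
  coker_obj : C;
  coker_arr : Mor Y coker_obj;
  coker_arrP : is_cokernel coker_arr f }.

Record biproduct {k : fieldType} {C : linear_category k} {I : finType} (X : I -> C) :=
  Biproduct {
  bip_obj : C;
  bip_inj : forall i, Mor (X i) bip_obj;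
  bip_proj : forall i, Mor bip_obj (X i);
  bip_projK : forall i, bip_proj i \c bip_inj i = idmor (X i);
  bip_proj0 : forall i j, i != j -> bip_proj j \c bip_inj i = 0;
  bip_sum : \sum_i bip_inj i \c bip_proj i = idmor bip_obj }.

Record coproduct {k : fieldType} {C : linear_category k} (X : nat -> C) := Coproduct {
  cop_obj : C;
  cop_inj : forall n, Mor (X n) cop_obj;
  cop_injP : is_coproduct cop_inj }.

(** * Symmetric tensor categories *)

(* Biproducts over the empty type give a zero object. *)
Record abelian_structure {k : fieldType} (C : linear_category k) := AbelianStructure {
  bip_of : forall (I : finType) (X : I -> C), biproduct X;
  ker_of : forall (X Y : C) (f : Mor X Y), kernel f;
  coker_of : forall (X Y : C) (f : Mor X Y), cokernel f;
  mono_normal : forall (X Y : C) (f : Mor X Y),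
    mono f -> is_kernel f (coker_arr (coker_of f));
  epi_normal : forall (X Y : C) (f : Mor X Y),
    epi f -> is_cokernel f (ker_arr (ker_of f)) }.

Record symmetric_monoidal_structure {k : fieldType} (C : linear_category k) :=
  SymmetricMonoidalStructure {
  tens0 : C -> C -> C;
  tensm0 : forall X X' Y Y' : C,
    Mor X X' -> Mor Y Y' -> Mor (tens0 X Y) (tens0 X' Y');
  tunit0 : C;
  assoc0 : forall X Y Z : C, Mor (tens0 (tens0 X Y) Z) (tens0 X (tens0 Y Z));
  lunit0 : forall X : C, Mor (tens0 tunit0 X) X;
  runit0 : forall X : C, Mor (tens0 X tunit0) X;
  symm0 : forall X Y : C, Mor (tens0 X Y) (tens0 Y X);
  tensm0_id : forall X Y, tensm0 (idmor X) (idmor Y) = idmor (tens0 X Y);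
  tensm0_comp : forall X X' X'' Y Y' Y'' (f' : Mor X' X'') (f : Mor X X')
    (g' : Mor Y' Y'') (g : Mor Y Y'),
    tensm0 (f' \c f) (g' \c g) = tensm0 f' g' \c tensm0 f g;
  tensm0_linear_l : forall X X' Y Y' (g : Mor Y Y') (a : k) (f f' : Mor X X'),
    tensm0 (a *: f + f') g = a *: tensm0 f g + tensm0 f' g;
  tensm0_linear_r : forall X X' Y Y' (f : Mor X X') (a : k) (g g' : Mor Y Y'),
    tensm0 f (a *: g + g') = a *: tensm0 f g + tensm0 f g';
  assoc0_iso : forall X Y Z, is_iso (assoc0 X Y Z);
  lunit0_iso : forall X, is_iso (lunit0 X);
  runit0_iso : forall X, is_iso (runit0 X);
  assoc0_nat : forall X X' Y Y' Z Z' (f : Mor X X') (g : Mor Y Y') (h : Mor Z Z'),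
    assoc0 X' Y' Z' \c tensm0 (tensm0 f g) h = tensm0 f (tensm0 g h) \c assoc0 X Y Z;
  lunit0_nat : forall X X' (f : Mor X X'),
    lunit0 X' \c tensm0 (idmor tunit0) f = f \c lunit0 X;
  runit0_nat : forall X X' (f : Mor X X'),
    runit0 X' \c tensm0 f (idmor tunit0) = f \c runit0 X;
  symm0_nat : forall X X' Y Y' (f : Mor X X') (g : Mor Y Y'),
    symm0 X' Y' \c tensm0 f g = tensm0 g f \c symm0 X Y;
  pentagon0 : forall W X Y Z,
    tensm0 (idmor W) (assoc0 X Y Z) \c assoc0 W (tens0 X Y) Z
      \c tensm0 (assoc0 W X Y) (idmor Z)
    = assoc0 W X (tens0 Y Z) \c assoc0 (tens0 W X) Y Z;
  triangle0 : forall X Y,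
    tensm0 (idmor X) (lunit0 Y) \c assoc0 X tunit0 Y = tensm0 (runit0 X) (idmor Y);
  hexagon0 : forall X Y Z,
    assoc0 Y Z X \c symm0 X (tens0 Y Z) \c assoc0 X Y Z
    = tensm0 (idmor Y) (symm0 X Z) \c assoc0 Y X Z \c tensm0 (symm0 X Y) (idmor Z);
  symm0K : forall X Y, symm0 Y X \c symm0 X Y = idmor (tens0 X Y) }.

Record symTensorCategory (k : fieldType) := SymTensorCategory {
  stc_cat :> linear_category k;
  stc_ab : abelian_structure stc_cat;
  stc_mon : symmetric_monoidal_structure stc_cat;
  tens_exact_l : forall (W X Y Z : stc_cat) (f : Mor X Y) (g : Mor Y Z),
    short_exact f g ->
    short_exact (tensm0 stc_mon (idmor W) f) (tensm0 stc_mon (idmor W) g);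
  tens_exact_r : forall (W X Y Z : stc_cat) (f : Mor X Y) (g : Mor Y Z),
    short_exact f g ->
    short_exact (tensm0 stc_mon f (idmor W)) (tensm0 stc_mon g (idmor W)) }.

Section TensorNotation.
Context {k : fieldType} {C : symTensorCategory k}.

Definition tens (X Y : C) : C := tens0 (stc_mon C) X Y.
Definition tensm {X X' Y Y' : C} (f : Mor X X') (g : Mor Y Y') :
  Mor (tens X Y) (tens X' Y') := tensm0 (stc_mon C) f g.
Definition tunit : C := tunit0 (stc_mon C).
Definition assoc (X Y Z : C) : Mor (tens (tens X Y) Z) (tens X (tens Y Z)) :=
  assoc0 (stc_mon C) X Y Z.
Definition lunit (X : C) : Mor (tens tunit X) X := lunit0 (stc_mon C) X.
Definition runit (X : C) : Mor (tens X tunit) X := runit0 (stc_mon C) X.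
Definition symm (X Y : C) : Mor (tens X Y) (tens Y X) := symm0 (stc_mon C) X Y.

Definition assoc_inv (X Y Z : C) : Mor (tens X (tens Y Z)) (tens (tens X Y) Z) :=
  projT1 (cid (assoc0_iso (stc_mon C) X Y Z)).

End TensorNotation.

Notation "X \ox Y" := (tens X Y) (at level 39, left associativity) : cat_scope.
Notation "f \oxm g" := (tensm f g) (at level 39, left associativity) : cat_scope.

Section AbelianOperations.
Context {k : fieldType} {C : symTensorCategory k}.

Definition kern {X Y : C} (f : Mor X Y) : C := ker_obj (ker_of (stc_ab C) f).
Definition ker_inc {X Y : C} (f : Mor X Y) : Mor (kern f) X := ker_arr (ker_of (stc_ab C) f).
Definition cokern {X Y : C} (f : Mor X Y) : C := coker_obj (coker_of (stc_ab C) f).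
Definition coker_pr {X Y : C} (f : Mor X Y) : Mor Y (cokern f) :=
  coker_arr (coker_of (stc_ab C) f).

Lemma ker_incP {X Y : C} (f : Mor X Y) : is_kernel (ker_inc f) f.
Proof. exact: ker_arrP. Qed.

Lemma coker_prP {X Y : C} (f : Mor X Y) : is_cokernel (coker_pr f) f.
Proof. exact: coker_arrP. Qed.

Definition im {X Y : C} (f : Mor X Y) : C := kern (coker_pr f).
Definition im_inc {X Y : C} (f : Mor X Y) : Mor (im f) Y := ker_inc (coker_pr f).

Definition fsum {I : finType} (X : I -> C) : C := bip_obj (bip_of (stc_ab C) X).
Definition finj {I : finType} (X : I -> C) (i : I) : Mor (X i) (fsum X) :=
  bip_inj (bip_of (stc_ab C) X) i.
Definition fproj {I : finType} (X : I -> C) (i : I) : Mor (fsum X) (X i) :=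
  bip_proj (bip_of (stc_ab C) X) i.

Definition joint_ker {I : finType} {X Y : C} (f : I -> Mor X Y) : C :=
  kern (\sum_i finj (fun=> Y) i \c f i).
Definition joint_coker {I : finType} {X Y : C} (f : I -> Mor X Y) : C :=
  cokern (\sum_i f i \c fproj (fun=> X) i).

End AbelianOperations.

(** * Tensor powers and the action of the symmetric group *)

Section TensorPowers.
Context {k : fieldType} {C : symTensorCategory k}.

Fixpoint tpow (V : C) (n : nat) : C :=
  if n is m.+1 then V \ox tpow V m else tunit.

Fixpoint concat (V : C) (a b : nat) : Mor (tpow V a \ox tpow V b) (tpow V (a + b)%N) :=
  match a return Mor (tpow V a \ox tpow V b) (tpow V (a + b)%N) with
  | 0 => lunit (tpow V b)
  | a'.+1 => (idmor V \oxm concat V a' b) \c assoc V (tpow V a') (tpow V b)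
  end.

(* The symmetry of the factors in positions i and i.+1, counted from 0;
   the identity if i.+1 >= n. *)
Fixpoint braid (V : C) (n i : nat) : Mor (tpow V n) (tpow V n) :=
  match n return Mor (tpow V n) (tpow V n) with
  | 0 => idmor _
  | m.+1 =>
    match i with
    | 0 =>
      match m return Mor (tpow V m.+1) (tpow V m.+1) with
      | 0 => idmor _
      | p.+1 => assoc V V (tpow V p) \c (symm V V \oxm idmor (tpow V p))
                  \c assoc_inv V V (tpow V p)
      end
    | j.+1 => idmor V \oxm braid V m j
    end
  end.

End TensorPowers.

Definition adj_tperm (n : nat) : 'I_n.-1 -> 'S_n :=
  match n return 'I_n.-1 -> 'S_n with
  | 0 => fun=> 1%g
  | m.+1 => fun i => tperm (widen_ord (leqnSn m) i) (lift ord0 i)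
  end.

Lemma adj_tperm_gen (n : nat) (s : 'S_n) :
  exists w : seq 'I_n.-1, s = (\prod_(i <- w) adj_tperm i)%g.
Proof.
case: n s => [|n] s.
  by exists [::]; apply/permP => -[].
pose E : {set 'S_n.+1} := [set s | `[< exists w : seq 'I_n,
  s = (\prod_(i <- w) @adj_tperm n.+1 i)%g >]].
suff: s \in E by rewrite inE => /asboolP.
have E1 : 1%g \in E by rewrite inE; apply/asboolP; exists [::]; rewrite big_nil.
have EM : {in E &, forall x y, (x * y)%g \in E}.
  move=> x y; rewrite !inE => /asboolP[u ->] /asboolP[v ->].
  by apply/asboolP; exists (u ++ v); rewrite big_cat.
have gE : group_set E by apply/group_setP.
have tE m : (m < n.+1)%N -> tperm ord0 (inord m) \in E.
  elim: m => [|m IH] ltm.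
    rewrite (_ : inord 0 = ord0) ?tperm1 //.
    by apply/val_inj; rewrite /= inordK.
  have aE : tperm (inord m) (inord m.+1) \in E.
    rewrite inE; apply/asboolP; exists [:: Ordinal (ltm : (m < n)%N)].
    rewrite big_seq1 /adj_tperm; congr tperm; apply/val_inj; rewrite /= inordK //.
    exact: ltnW.
  case: m IH ltm aE => [|m] IH ltm aE.
    suff e : inord 0 = ord0 :> 'I_n.+1 by rewrite e in aE.
    by apply/val_inj; rewrite /= inordK.
  have lt' := ltnW ltm.
  suff -> : tperm ord0 (inord m.+2) =
    (tperm (inord m.+1) (inord m.+2) *
    (tperm ord0 (inord m.+1) * tperm (inord m.+1) (inord m.+2)))%g :> 'S_n.+1.
    by rewrite !EM ?IH.
  rewrite -{1}[tperm (inord m.+1) _]tpermV -/(conjg _ _) tpermJ.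
  congr tperm; last by rewrite tpermL.
  rewrite tpermD //; apply/eqP => /(congr1 val) /=; rewrite inordK //.
have : <<[set tperm ord0 y | y in 'I_n.+1]>>%g \subset E.
  rewrite -[E]/(gval (Group gE)) gen_subG; apply/subsetP => _ /imsetP[y _ ->].
  by rewrite -[y]inord_val; apply: tE.
by rewrite gen_tperm => /subsetP; apply; rewrite inE.
Qed.

(* Permutation of the factors of a tensor power, along some decomposition of s
   into adjacent transpositions (by the coherence axioms all of them give the
   same morphism).  MathComp's product s * t applies s first, so that
   tensor_perm V (s * t) = tensor_perm V t \c tensor_perm V s. *)
Definition tensor_perm {k : fieldType} {C : symTensorCategory k} (V : C) {n : nat}
    (s : 'S_n) : Mor (tpow V n) (tpow V n) :=
  foldl (fun f (i : 'I_n.-1) => braid V n i \c f) (idmor _)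
    (projT1 (cid (adj_tperm_gen s))).

(** * Young diagrams, Specht modules, Schur functors *)

Record young_diagram := YoungDiagram {
  yd_rows :> seq nat;
  yd_rowsP : sorted geq yd_rows && (0%N \notin yd_rows) }.

Definition yd_size (lam : young_diagram) : nat := sumn lam.

(* The irreducible representation of a Young diagram: the module generated by the
   Young symmetrizer in the group algebra.  The tableau used numbers the cells row
   after row; reshape_index and reshape_offset are the row and the column of a
   cell.  MathComp's representations act on the right of row vectors; with its
   product of permutations these are the left modules over the symmetric group
   with the composition product. *)
Section Specht.
Variables (k : fieldType) (lam : young_diagram).
Local Notation n := (yd_size lam).
Local Notation aG := (regular_repr k [set: 'S_n]).

Definition row_stab : {set 'S_n} :=
  [set s : 'S_n | [forall i, reshape_index lam (s i) == reshape_index lam i]].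
Definition col_stab : {set 'S_n} :=
  [set s : 'S_n | [forall i, reshape_offset lam (s i) == reshape_offset lam i]].

Definition young_symmetrizer : 'rV[k]_#|[set: 'S_n]| :=
  gring_row (\sum_(p in row_stab) \sum_(q in col_stab) (-1) ^+ q *: aG (q * p)%g).

Definition specht_dim : nat := \rank (cyclic_mx aG young_symmetrizer).
Definition specht : mx_representation k [set: 'S_n] specht_dim :=
  submod_repr (cyclic_mx_module aG young_symmetrizer).

End Specht.

Section SchurFunctors.
Context {k : fieldType} {C : symTensorCategory k}.

(* W (x) X for W = k^d is the direct sum of d copies of X.  The element s acts by
   e_a (x) x |-> \sum_b (W s)_{a,b} e_b (x) (x s). *)
Definition diag_act (lam : young_diagram) (V : C) (s : 'S_(yd_size lam)) :
    Mor (fsum (fun=> tpow V (yd_size lam) : C)) (fsum (fun=> tpow V (yd_size lam))) :=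
  \sum_(a < specht_dim k lam) \sum_(b < specht_dim k lam)
    specht k lam s a b *: (finj _ b \c tensor_perm V s \c fproj _ a).

Definition schur (lam : young_diagram) (V : C) : C :=
  joint_ker (fun s : 'S_(yd_size lam) => diag_act V s - idmor _).

(* The degree n parts of the quotients of the tensor algebra by the ideals
   generated by the images of id - symm and id + symm in degree 2. *)
Definition sym_pow (V : C) (n : nat) : C :=
  joint_coker (fun i : 'I_n.-1 => idmor (tpow V n) - braid V n i).
Definition ext_pow (V : C) (n : nat) : C :=
  joint_coker (fun i : 'I_n.-1 => idmor (tpow V n) + braid V n i).

End SchurFunctors.

(** * Infinite direct sums *)

(* Symmetric tensor categories with countable direct sums, over which the tensor
   product distributes. *)
Record sumTensorCategory (k : fieldType) := SumTensorCategory {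
  sum_cat :> symTensorCategory k;
  csum_of : forall X : nat -> sum_cat, coproduct X;
  tens_sum_l : forall (W : sum_cat) (X : nat -> sum_cat),
    is_coproduct (fun n => idmor W \oxm cop_inj (csum_of X) n);
  tens_sum_r : forall (W : sum_cat) (X : nat -> sum_cat),
    is_coproduct (fun n => cop_inj (csum_of X) n \oxm idmor W) }.

Arguments tens_sum_l {k} s W X : rename.
Arguments tens_sum_r {k} s W X : rename.

(* Fully faithful exact strong symmetric monoidal linear functors. *)
Record tensor_embedding {k : fieldType} (C D : symTensorCategory k) := TensorEmbedding {
  fobj :> C -> D;
  fhom : forall X Y : C, Mor X Y -> Mor (fobj X) (fobj Y);
  fhom_id : forall X, fhom (idmor X) = idmor (fobj X);
  fhom_comp : forall X Y Z (g : Mor Y Z) (f : Mor X Y), fhom (g \c f) = fhom g \c fhom f;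
  fhom_linear : forall X Y (a : k) (f g : Mor X Y), fhom (a *: f + g) = a *: fhom f + fhom g;
  fhom_full_faithful : forall X Y, bijective (@fhom X Y);
  fhom_exact : forall X Y Z (f : Mor X Y) (g : Mor Y Z),
    short_exact f g -> short_exact (fhom f) (fhom g);
  ftens : forall X Y, Mor (fobj X \ox fobj Y) (fobj (X \ox Y));
  funit : Mor tunit (fobj tunit);
  ftens_iso : forall X Y, is_iso (ftens X Y);
  funit_iso : is_iso funit;
  ftens_nat : forall X X' Y Y' (f : Mor X X') (g : Mor Y Y'),
    ftens X' Y' \c (fhom f \oxm fhom g) = fhom (f \oxm g) \c ftens X Y;
  ftens_assoc : forall X Y Z,
    fhom (assoc X Y Z) \c ftens (X \ox Y) Z \c (ftens X Y \oxm idmor (fobj Z))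
    = ftens X (Y \ox Z) \c (idmor (fobj X) \oxm ftens Y Z)
        \c assoc (fobj X) (fobj Y) (fobj Z);
  ftens_lunit : forall X,
    fhom (lunit X) \c ftens tunit X \c (funit \oxm idmor (fobj X)) = lunit (fobj X);
  ftens_runit : forall X,
    fhom (runit X) \c ftens X tunit \c (idmor (fobj X) \oxm funit) = runit (fobj X);
  ftens_symm : forall X Y,
    fhom (symm X Y) \c ftens X Y = ftens Y X \c symm (fobj X) (fobj Y) }.

(* Where infinite direct sums of objects of C are taken: in C itself, if it has
   them (the embedding being the identity), or in its ind-completion. *)
Record sum_extension {k : fieldType} (C : symTensorCategory k) := SumExtension {
  ext_cat :> sumTensorCategory k;
  ext_emb : tensor_embedding C ext_cat }.

(** * The tensor algebra and its lower central series *)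

Section TensorAlgebra.
Context {k : fieldType} {D : sumTensorCategory k}.

Definition csum (X : nat -> D) : D := cop_obj (csum_of X).
Definition cinj (X : nat -> D) (n : nat) : Mor (X n) (csum X) := cop_inj (csum_of X) n.

Definition sym_alg (V : D) : D := csum (sym_pow V).
Definition ext_even (V : D) : D := csum (fun n => ext_pow V n.*2).
Definition omega_even (V : D) : D := sym_alg V \ox ext_even V.
Definition schur_omega (lam : young_diagram) (V : D) : D := schur lam V \ox omega_even V.

Definition tens_alg (V : D) : D := csum (tpow V).

Definition tens_alg_mul (V : D) : Mor (tens_alg V \ox tens_alg V) (tens_alg V) :=
  copair (tens_sum_l D (tens_alg V) (tpow V)) (fun b =>
    copair (tens_sum_r D (tpow V b) (tpow V)) (fun a =>
      cinj (tpow V) (a + b)%N \c concat V a b)).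

End TensorAlgebra.

Section LowerCentralSeries.
Context {k : fieldType} {C : symTensorCategory k}.

Lemma comp0l {X Y Z : C} (f : Mor X Y) : (0 : Mor Y Z) \c f = 0.
Proof.
have := comp_linear_l f 1 (0 : Mor Y Z) 0.
by rewrite !scale1r addr0 => /(congr1 (+%R^~ (- ((0 : Mor Y Z) \c f)))); rewrite addrK subrr.
Qed.

Lemma comp0r {X Y Z : C} (g : Mor Y Z) : g \c (0 : Mor X Y) = 0.
Proof.
have := comp_linear_r g 1 (0 : Mor X Y) 0.
by rewrite !scale1r addr0 => /(congr1 (+%R^~ (- (g \c (0 : Mor X Y))))); rewrite addrK subrr.
Qed.

Lemma im_inc_factor {X X' Y : C} (f : Mor X Y) (h : Mor X' X) :
  exists u : Mor (im (f \c h)) (im f), im_inc f \c u = im_inc (f \c h).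
Proof.
have [pf0 _] := coker_prP f.
have [_ /(_ _ (coker_pr f))] := coker_prP (f \c h).
rewrite compA pf0 comp0l => /(_ erefl) [u [upf _]].
have [q0 _] := ker_incP (coker_pr (f \c h)).
have [_ /(_ _ (im_inc (f \c h)))] := ker_incP (coker_pr f).
rewrite -[in coker_pr f \c _]upf -compA q0 comp0r => /(_ erefl) [v [vE _]].
by exists v.
Qed.

Record subobject (A : C) := Subobject {
  so_obj :> C;
  so_inc : Mor so_obj A }.

Variables (A : C) (m : Mor (A \ox A) A).

Definition commutator : Mor (A \ox A) A := m \c (idmor _ - symm A A).

Definition bracket (L : subobject A) : subobject A :=
  Subobject (im_inc (commutator \c (idmor A \oxm so_inc L))).

(* lcs n is L_{n+1}. *)
Fixpoint lcs (n : nat) : subobject A :=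
  if n is p.+1 then bracket (lcs p) else Subobject (idmor A).

Lemma lcs_decr (n : nat) :
  exists u : Mor (lcs n.+1) (lcs n), so_inc (lcs n) \c u = so_inc (lcs n.+1).
Proof.
elim: n => [|n [u uE]]; first by exists (so_inc (lcs 1)); rewrite comp_idl.
have e : commutator \c (idmor A \oxm so_inc (lcs n.+1)) =
    commutator \c (idmor A \oxm so_inc (lcs n)) \c (idmor A \oxm u).
  by rewrite -compA -[_ \c (_ \oxm u)]tensm0_comp comp_idl uE.
have := im_inc_factor (commutator \c (idmor A \oxm so_inc (lcs n))) (idmor A \oxm u).
by rewrite -e.
Qed.

Definition lcs_inc (n : nat) : Mor (lcs n.+1) (lcs n) := projT1 (cid (lcs_decr n)).

(* B_i = L_i / L_{i+1}, for i >= 1. *)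
Definition lcs_quot (i : nat) : C := cokern (lcs_inc i.-1).

End LowerCentralSeries.

(* Main.v *)
(* Work first in an associative algebra over a field of characteristic zero, and
   let M be the ideal generated by the triple commutators [a,[b,c]].  Then
   [M, L_j] lies in L_{j+2}, so that a bracket [a_1,[a_2,...,a_k]] modulo L_{k+1}
   depends on its arguments modulo M only.  Modulo M the symmetrized product is
   associative, the words are spanned by symmetrized products of letters and of
   commutators of letters, and such a product is symmetric in the letters and
   alternating in the entries of the commutators: it is an even form.  As
   [ab,c] = [a,bc] + [b,ac] for the symmetrized product, the bracket is killed by
   sufficiently many differences of multiplications in two of its arguments; hence
   all but boundedly many factors can be moved to the last argument.  So B_k is
   spanned by the brackets [u_1,...,u_{k-1},w] with words u_i of bounded length and
   an even form w.

   Applied to the universal words of the free algebra and transported along the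
   action of the symmetric groups on the tensor powers of V, this is a finite sum of
   morphisms V^{(x)n} (x) Omega^ev(V) -> B_k that is jointly epic.  Finally V^{(x)n} is
   covered by Schur functors: the Young symmetrizers have orthogonal characters
   (dominance order), and there are as many diagrams as conjugacy classes. *)
From HB Require Import structures.
From mathcomp Require Import all_boot all_order all_algebra all_fingroup all_character.
From mathcomp Require Import finmap ring zify boolp.
From mathcomp.multinomials Require Import monalg.
Require Import Defs.

Set Implicit Arguments.
Unset Strict Implicit.
Unset Printing Implicit Defensive.

Import GRing.Theory.
Local Open Scope ring_scope.

(** Objects of a category have no elements, so the identities are proved once in the free algebra on
    letters 0, 1, 2, ... and read off from its multilinear part: a word that is a permutation of 0,
    ..., n - 1 stands for the morphism from the n-th tensor power of V to A that rearranges the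
    factors, and every other word for 0. Membership in the lower central series survives because a
    bracket of words becomes a bracket of homogeneous components. For this the symmetry of two
    tensor powers has to be recognised as a permutation of letters, and the decomposition chosen in
    [tensor_perm] as immaterial.

    Only a spanning family is sought, so relations between generators are needed modulo L_{k+1} and
    independence never arises. The obstacle is finiteness: the number of factors left in the first k
    - 1 arguments must be bounded in terms of k alone. The number N_k of differences that always
    kill a bracket satisfies N_2 = 2 and N_{k+1} = 3 N_k + 2; the step applies the Jacobi identity
    to the first two arguments. Characteristic zero supplies 1/2 for the symmetrized product, 1/3
    for [M, L_j] in L_{j+2}, and an invertible Gram matrix for the Young characters. *)

Section LinearExpressions.
Variables (k : fieldType) (M : lmodType k).

Inductive lexp :=
  | LVar of nat
  | LZero
  | LAdd of lexp & lexp
  | LOpp of lexp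
  | LScale of k & lexp.

Fixpoint leval (env : seq M) (e : lexp) : M :=
  match e with
  | LVar i => nth 0 env i
  | LZero => 0
  | LAdd e1 e2 => leval env e1 + leval env e2
  | LOpp e1 => - leval env e1
  | LScale c e1 => c *: leval env e1
  end.

Fixpoint lcoef (e : lexp) (j : nat) : k :=
  match e with
  | LVar i => if eqn i j then 1 else 0
  | LZero => 0
  | LAdd e1 e2 => lcoef e1 j + lcoef e2 j
  | LOpp e1 => - lcoef e1 j
  | LScale c e1 => c * lcoef e1 j
  end.

Fixpoint lbound (n : nat) (e : lexp) : bool :=
  match e with
  | LVar i => (i < n)%N
  | LZero => true
  | LAdd e1 e2 => lbound n e1 && lbound n e2
  | LOpp e1 => lbound n e1
  | LScale _ e1 => lbound n e1
  end.

Lemma eqn_refl i : eqn i i. Proof. by elim: i. Qed.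

Lemma levalE n env e : lbound n e ->
  leval env e = \sum_(i < n) lcoef e i *: nth 0 env i.
Proof.
elim: e => [i|||e1 IH1|c e1 IH1] /=.
- move=> lt_in; rewrite (bigD1 (Ordinal lt_in)) //= eqn_refl scale1r.
  rewrite big1 ?addr0 // => j; rewrite -val_eqE /= eq_sym -eqnE => /negbTE ->.
  exact: scale0r.
- by move=> _; rewrite big1 // => i _; rewrite scale0r.
- move=> e1 IH1 e2 IH2 /andP[/IH1 -> /IH2 ->]; rewrite -big_split /=.
  by apply: eq_bigr => i _; rewrite scalerDl.
- by move=> /IH1 ->; rewrite -sumrN; apply: eq_bigr => i _; rewrite scaleNr.
- by move=> /IH1 ->; rewrite scaler_sumr; apply: eq_bigr => i _; rewrite scalerA.
Qed.

Fixpoint lsame (n : nat) (e1 e2 : lexp) : Prop :=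
  if n is m.+1 then lcoef e1 m = lcoef e2 m /\ lsame m e1 e2 else True.

(** Reflection: a module identity reduces to one scalar identity for each atom, and [lsame] unfolds
    to their conjunction. *)
Lemma leval_same n env e1 e2 :
  lbound n e1 && lbound n e2 -> lsame n e1 e2 -> leval env e1 = leval env e2.
Proof.
move=> /andP[b1 b2] same; rewrite (levalE env b1) (levalE env b2).
apply: eq_bigr => i _; congr (_ *: _).
elim: n same i {b1 b2} => [|n IH] /= => [_ [] //|[e /IH{}IH] i].
by have := ltn_ord i; rewrite ltnS leq_eqVlt => /predU1P[->//|lt]; rewrite (IH (Ordinal lt)).
Qed.

End LinearExpressions.

(* [lmod_eq] proves identities between linear combinations in a module, up to
   the identities between their coefficients that [tac] proves. *)
Ltac lmod_index x env :=
  match env with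
  | ?y :: _ => let _ := match goal with _ => unify x y end in constr:(0%N)
  | _ :: ?env' => let i := lmod_index x env' in constr:(i.+1)
  end.
Ltac lmod_mem x env :=
  match env with
  | ?y :: _ => let _ := match goal with _ => unify x y end in constr:(true)
  | _ :: ?env' => lmod_mem x env'
  | nil => constr:(false)
  end.
Ltac lmod_env env t :=
  lazymatch t with
  | ?a + ?b => let env1 := lmod_env env a in lmod_env env1 b
  | - ?a => lmod_env env a
  | _ *: ?a => lmod_env env a
  | 0 => env
  | _ => lazymatch lmod_mem t env with
         | true => env
         | false => constr:(t :: env)
         end
  end.
Ltac lmod_reify k env t :=
  lazymatch t with
  | ?a + ?b => let ea := lmod_reify k env a in let eb := lmod_reify k env b in
               constr:(LAdd ea eb)
  | - ?a => let ea := lmod_reify k env a in constr:(LOpp ea)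
  | ?c *: ?a => let ea := lmod_reify k env a in constr:(LScale c ea)
  | 0 => constr:(LZero k)
  | _ => let i := lmod_index t env in constr:(LVar k i)
  end.
Ltac lmod_eq_with k tac :=
  lazymatch goal with
  | |- @eq ?T ?x ?y =>
    let env0 := constr:(@nil T) in
    let env1 := lmod_env env0 x in
    let env := lmod_env env1 y in
    let ex := lmod_reify k env x in
    let ey := lmod_reify k env y in
    let n := constr:(size env) in
    let n' := eval compute in n in
    refine (@leval_same k _ n' env ex ey isT _);
    cbv [lsame lcoef eqn]; repeat (split; [tac|]); try exact: I
  end.

Ltac nc_expand :=
  do 3!rewrite ?(mulrDl, mulrDr, mulrBl, mulrBr, mulrN, mulNr, mulrA, scalerDr, scalerN)
    -?(scalerAl, scalerAr).

(** * The lower central series of an algebra *)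

Section Span.
Variables (k : fieldType).

(** Inductive, so that a linear condition is checked on generators by induction; explicit finite
    sums return only in [spanP_sum]. *)
Inductive span (M : lmodType k) (P : M -> Prop) : M -> Prop :=
  | span0 : span P 0
  | span_in x : P x -> span P x
  | spanD x y : span P x -> span P y -> span P (x + y)
  | spanZ c x : span P x -> span P (c *: x).

Variables (M : lmodType k) (P : M -> Prop).

Lemma spanN x : span P x -> span P (- x).
Proof. by rewrite -scaleN1r; apply: spanZ. Qed.

Lemma spanB x y : span P x -> span P y -> span P (x - y).
Proof. by move=> Px Py; apply: spanD => //; apply: spanN. Qed.

Lemma span_lin (N : lmodType k) (Q : N -> Prop) (f : M -> N) :
  (forall c x y, f (c *: x + y) = c *: f x + f y) ->
  (forall x, P x -> span Q (f x)) -> forall x, span P x -> span Q (f x).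
Proof.
move=> fL PQ; have f0 : f 0 = 0.
  by have := fL (-1) 0 0; rewrite scaleN1r addNr scaleN1r addNr.
move=> x; elim=> {x} [|x /PQ//|x y _ Qx _ Qy|c x _ Qx]; first by rewrite f0; apply: span0.
  by have := fL 1 x y; rewrite !scale1r => ->; apply: spanD.
by have := fL c x 0; rewrite !addr0 f0 addr0 => ->; apply: spanZ.
Qed.

Lemma span_sub (Q : M -> Prop) :
  (forall x, P x -> span Q x) -> forall x, span P x -> span Q x.
Proof. by move=> PQ; apply: (@span_lin M Q id). Qed.

Lemma span_sum (I : Type) (r : seq I) (F : I -> M) :
  (forall i, span P (F i)) -> span P (\sum_(i <- r) F i).
Proof.
by move=> PF; elim/big_rec: _ => [|i x _ Px]; [exact: span0|exact: spanD].
Qed.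

Lemma spanP_sum x : span P x ->
  exists r : seq (k * M), (forall p, p \in r -> P p.2) /\ x = \sum_(p <- r) p.1 *: p.2.
Proof.
elim=> {x} [|x Px|x y _ [r [Pr ->]] _ [r' [Pr' ->]]|c x _ [r [Pr ->]]].
- by exists [::]; rewrite big_nil.
- by exists [:: (1, x)]; split=> [p|]; rewrite ?inE ?big_seq1 ?scale1r // => /eqP->.
- exists (r ++ r'); split; last by rewrite big_cat.
  by move=> p; rewrite mem_cat => /orP[/Pr|/Pr'].
- exists [seq (c * p.1, p.2) | p <- r]; split; last first.
    by rewrite big_map scaler_sumr; apply: eq_bigr => p _; rewrite scalerA.
  by move=> p /mapP[q /Pr ? ->].
Qed.

End Span.

Section LowerCentral.
Variables (k : fieldType) (A : algType k).
Hypothesis char0 : [pchar k] =i pred0.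
Implicit Types (a b c l x y z : A).

Definition com a b := a * b - b * a.

Lemma comDl a b c : com (a + b) c = com a c + com b c.
Proof. by rewrite /com; nc_expand; lmod_eq_with k ltac:(ring). Qed.
Lemma comDr a b c : com a (b + c) = com a b + com a c.
Proof. by rewrite /com; nc_expand; lmod_eq_with k ltac:(ring). Qed.
Lemma comZl (s : k) a b : com (s *: a) b = s *: com a b.
Proof. by rewrite /com; nc_expand; lmod_eq_with k ltac:(ring). Qed.
Lemma comZr (s : k) a b : com a (s *: b) = s *: com a b.
Proof. by rewrite /com; nc_expand; lmod_eq_with k ltac:(ring). Qed.
Lemma comC a b : com a b = - com b a.
Proof. by rewrite /com; nc_expand; lmod_eq_with k ltac:(ring). Qed.
Lemma comNl a b : com (- a) b = - com a b.
Proof. by rewrite -scaleN1r comZl scaleN1r. Qed.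
Lemma comNr a b : com a (- b) = - com a b.
Proof. by rewrite -scaleN1r comZr scaleN1r. Qed.
Lemma comBl a b c : com (a - b) c = com a c - com b c.
Proof. by rewrite comDl comNl. Qed.
Lemma comBr a b c : com a (b - c) = com a b - com a c.
Proof. by rewrite comDr comNr. Qed.
Lemma com_linl b (s : k) x y : com (s *: x + y) b = s *: com x b + com y b.
Proof. by rewrite comDl comZl. Qed.
Lemma com_linr b (s : k) x y : com b (s *: x + y) = s *: com b x + com b y.
Proof. by rewrite comDr comZr. Qed.

(* [L j] is the term of index [j + 1] of the lower central series. *)
Fixpoint L (j : nat) : A -> Prop :=
  if j is j'.+1 then span (fun x => exists a l, L j' l /\ x = com a l) else fun=> True.

Lemma L0 j : L j 0.
Proof. by case: j => // j; apply: span0. Qed.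
Lemma LD j x y : L j x -> L j y -> L j (x + y).
Proof. by case: j => // j; apply: spanD. Qed.
Lemma LZ j (s : k) x : L j x -> L j (s *: x).
Proof. by case: j => // j; apply: spanZ. Qed.
Lemma LN j x : L j x -> L j (- x).
Proof. by case: j => // j; apply: spanN. Qed.
Lemma LB j x y : L j x -> L j y -> L j (x - y).
Proof. by case: j => // j; apply: spanB. Qed.
Lemma L_com j a l : L j l -> L j.+1 (com a l).
Proof. by move=> Ll; apply: span_in; exists a, l. Qed.

Lemma L_lin j (P : A -> Prop) (f : A -> A) :
  (forall s x y, f (s *: x + y) = s *: f x + f y) ->
  (forall x, P x -> L j (f x)) -> forall x, span P x -> L j (f x).
Proof.
by case: j => // j fL Pf; apply: span_lin.
Qed.

Lemma L_decr1 j x : L j.+1 x -> L j x.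
Proof.
elim: j x => // j IH x; apply: (@L_lin _ _ id) => // {}x [a [l [Ll ->]]].
exact/L_com/IH.
Qed.

Lemma jacobi a b c : com (com a b) c = com a (com b c) - com b (com a c).
Proof. by rewrite /com; nc_expand; lmod_eq_with k ltac:(ring). Qed.

(** By Jacobi [[a, l], y] = [a, [l, y]] - [l, [a, y]]: the first term keeps its outer bracket, and
    the second hands one bracket over from x to y. *)
Lemma L_comL i j x y : L i x -> L j y -> L (i + j).+1 (com x y).
Proof.
elim: i j x y => [|i IH] j x y Lx Ly; first exact: L_com.
move: x Lx; apply: (@L_lin _ _ (fun z => com z y)) => [s u v|_ [a [l [Ll ->]]]].
  exact: com_linl.
rewrite jacobi; apply: LB; first by rewrite addSn; apply/L_com/IH.
by rewrite addSnnS; apply: IH => //; apply: L_com.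
Qed.

Lemma char0_neq0 n : n.+1%:R != 0 :> k.
Proof. by move/pcharf0P: char0 => ->. Qed.

(** The bracket to be placed in L_3. The lemmas below exchange its arguments up to sign modulo
    [L 2], the term of index 3. *)
Let g a w z x c := com a (w * com z (com x c)).
Let eqL2 x y := L 2 (x - y).

Let eqL2_trans x y z : eqL2 x y -> eqL2 y z -> eqL2 x z.
Proof. by move=> xy yz; rewrite /eqL2 -(subrK y x) -addrA; apply: LD. Qed.
Let eqL2N x y : eqL2 x y -> eqL2 (- x) (- y).
Proof. by move=> xy; rewrite /eqL2 -opprD; apply: LN. Qed.

Let g12 a w z x c : eqL2 (g a w z x c) (- g w a z x c).
Proof.
rewrite /eqL2 /g opprK; set l := com z _.
have Ll : L 2 l by do 2!apply: L_com.
have -> : com a (w * l) + com w (a * l) = com w (com a l) + com (a * w) l.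
  by rewrite /com; nc_expand; lmod_eq_with k ltac:(ring).
by apply: LD; [do 2!apply: L_com|apply: L_com; apply: L_decr1].
Qed.

Let g23 a w z x c : eqL2 (g a w z x c) (- g a z w x c).
Proof.
rewrite /eqL2 /g opprK -comDr; set l := com x c.
have -> : w * com z l + z * com w l = com z (w * l) + com w (z * l).
  by rewrite /com; nc_expand; lmod_eq_with k ltac:(ring).
by rewrite comDr; apply: LD; do 2!apply: L_com.
Qed.

Let g2534 a w z x c : eqL2 (g a w z x c) (g a c x z w).
Proof.
rewrite /eqL2 /g -comBr.
have -> : w * com z (com x c) - c * com x (com z w) =
    com z (w * com x c) - com x (c * com z w) + com (com x c) (com z w).
  by rewrite /com; nc_expand; lmod_eq_with k ltac:(ring).
by rewrite comDr comBr; apply: LD; [apply: LB|]; do 2!apply: L_com.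
Qed.

Let g45 a w z x c : g a w z x c = - g a w z c x.
Proof. by rewrite /g (comC x) comNr mulrN comNr. Qed.

Let g15 a w z x c : eqL2 (g a w z x c) (- g c w z x a).
Proof.
apply: eqL2_trans (g2534 _ _ _ _ _) _; apply: eqL2_trans (g12 _ _ _ _ _) _.
exact/eqL2N/g2534.
Qed.

Let g25 a w z x c : eqL2 (g a w z x c) (- g a c z x w).
Proof.
apply: eqL2_trans (g12 _ _ _ _ _) _; apply: eqL2N.
apply: eqL2_trans (g15 _ _ _ _ _) _; rewrite -[X in eqL2 _ X]opprK; apply: eqL2N.
exact: g12.
Qed.

(** The cycle is the transposition of the last two arguments followed by that of the third and the
    fifth, and the latter is [g25] conjugated by [g23]. *)
Let g345 a w z x c : eqL2 (g a w z x c) (g a w x c z).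
Proof.
rewrite g45 -[X in eqL2 _ X]opprK; apply: eqL2N.
apply: eqL2_trans (g23 _ _ _ _ _) _; apply: eqL2N.
apply: eqL2_trans (g25 _ _ _ _ _) _; rewrite -[X in eqL2 _ X]opprK; apply: eqL2N.
exact: g23.
Qed.

(* Modulo triple commutators [g] is totally antisymmetric, so that the Jacobi
   identity in its last three arguments reads [3 g = 0]. *)
Lemma com_mul_triple a w z x c : L 2 (com a (w * com z (com x c))).
Proof.
rewrite -/(g a w z x c); set t := g a w z x c.
have e1 : eqL2 t (g a w x c z) by apply: g345.
have e2 : eqL2 t (g a w c z x) by apply: eqL2_trans e1 (g345 _ _ _ _ _).
have jac : t + g a w x c z + g a w c z x = 0.
  rewrite /t /g -!comDr -!mulrDr.
  have -> : com z (com x c) + com x (com c z) + com c (com z x) = 0.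
    by rewrite /com; nc_expand; lmod_eq_with k ltac:(ring).
  by rewrite mulr0 /com mulr0 mul0r subrr.
have -> : t = 3%:R^-1 *: ((t - g a w x c z) + (t - g a w c z x)).
  have -> : (t - g a w x c z) + (t - g a w c z x) = 3%:R *: t - (t + g a w x c z + g a w c z x).
    by lmod_eq_with k ltac:(ring).
  by rewrite jac subr0 scalerA mulVf ?scale1r ?char0_neq0.
exact/LZ/LD.
Qed.

(* The quotient by [M3] is the algebra of even forms, with a deformed product. *)
Definition M3 : A -> Prop := span (fun x => exists a l, L 2 l /\ x = a * l).

Lemma M3_mull a x : M3 x -> M3 (a * x).
Proof.
apply: (span_lin (f := fun x => a * x)) => [s u v|_ [b [l [Ll ->]]]].
  by rewrite mulrDr scalerAr.
by apply: span_in; exists (a * b), l; rewrite mulrA.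
Qed.

Lemma M3_L2 x : L 2 x -> M3 x.
Proof. by move=> Lx; apply: span_in; exists 1, x; rewrite mul1r. Qed.

(** [M3] is defined as a left ideal. It is two-sided since l a = a l - [a, l], where [a, l] again
    lies in L_3. *)
Lemma M3_mulr a x : M3 x -> M3 (x * a).
Proof.
apply: (span_lin (f := fun x => x * a)) => [s u v|_ [b [l [Ll ->]]]].
  by rewrite mulrDl scalerAl.
have -> : b * l * a = b * (a * l - com a l).
  by rewrite /com; nc_expand; lmod_eq_with k ltac:(ring).
apply: M3_mull; apply: spanB; first exact/M3_mull/M3_L2.
exact/M3_L2/L_decr1/L_com.
Qed.

(** For j = 0 this is [com_mul_triple], extended linearly. Beyond, [x, [a, l]] = [[x, a], l] + [a,
    [x, l]], where [x, a] already lies in L_3, so that [L_comL] bounds the first term. *)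
Lemma com_M3 j x y : M3 x -> L j y -> L j.+2 (com x y).
Proof.
elim: j x y => [|j IH] x y Mx.
  move=> _; move: x Mx; apply: (@L_lin 2 _ (fun x => com x y)) => [s u v|_ [a [l [Ll ->]]]].
    exact: com_linl.
  rewrite comC; apply: LN.
  move: l Ll; apply: (@L_lin 2 _ (fun l => com y (a * l))) => [s u v|_ [z [l [Ll ->]]]].
    by rewrite mulrDr -scalerAr com_linr.
  move: l Ll; apply: (@L_lin 2 _ (fun l => com y (a * com z l))) => [s u v|_ [b [c [_ ->]]]].
    by rewrite com_linr mulrDr -scalerAr com_linr.
  exact: com_mul_triple.
move: y; apply: (@L_lin j.+3) => [s u v|_ [a [l [Ll ->]]]]; first exact: com_linr.
have -> : com x (com a l) = com (com x a) l + com a (com x l).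
  by rewrite jacobi; lmod_eq_with k ltac:(ring).
apply: LD; last exact/L_com/IH.
have : L 2 (com x a).
  move: (x) Mx; apply: (@L_lin 2 _ (fun x => com x a)) => [s u v|_ [b [l' [Ll' ->]]]].
    exact: com_linl.
  rewrite comC; apply: LN.
  move: l' Ll'; apply: (@L_lin 2 _ (fun l => com a (b * l))) => [s u v|_ [z [l' [Ll' ->]]]].
    by rewrite mulrDr -scalerAr com_linr.
  move: l' Ll'; apply: (@L_lin 2 _ (fun l => com a (b * com z l))) => [s u v|_ [c [d [_ ->]]]].
    by rewrite com_linr mulrDr -scalerAr com_linr.
  exact: com_mul_triple.
by move=> /L_comL /(_ Ll).
Qed.

Definition jor a b := 2%:R^-1 *: (a * b + b * a).

Lemma half_half : 2%:R^-1 + 2%:R^-1 = 1 :> k.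
Proof. by rewrite -mulr2n -[RHS](@mulfV _ 2%:R) ?char0_neq0 // mulr_natl. Qed.

Lemma jorC a b : jor a b = jor b a.
Proof. by rewrite /jor addrC. Qed.

(** To be read as a difference: multiplying the first argument of [b, c] by a, minus multiplying the
    second, leaves a bracketed with the symmetrized product of b and c. *)
Lemma com_jor a b c : com (jor a b) c = com a (jor b c) + com b (jor a c).
Proof. by rewrite /jor /com; nc_expand; lmod_eq_with k ltac:(ring). Qed.

Lemma jorA a b c :
  jor (jor a b) c - jor a (jor b c) = (2%:R^-1 * 2%:R^-1) *: com b (com a c).
Proof. by rewrite /jor /com; nc_expand; lmod_eq_with k ltac:(ring). Qed.

Lemma mul_jor a b : a * b = jor a b + 2%:R^-1 *: com a b.
Proof.
rewrite /jor /com; nc_expand.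
by lmod_eq_with k ltac:(ring: half_half).
Qed.

Lemma jor_linr a (s : k) x y : jor a (s *: x + y) = s *: jor a x + jor a y.
Proof. by rewrite /jor; nc_expand; lmod_eq_with k ltac:(ring). Qed.

Lemma com_jorr x a b : com x (jor a b) = jor (com x a) b + jor a (com x b).
Proof. by rewrite /jor /com; nc_expand; lmod_eq_with k ltac:(ring). Qed.

Lemma M3_jorl a x : M3 x -> M3 (jor a x).
Proof. by move=> Mx; apply/spanZ/spanD; [exact: M3_mull|exact: M3_mulr]. Qed.

Lemma jorA_M3 a b c : M3 (jor (jor a b) c - jor a (jor b c)).
Proof. by rewrite jorA; apply/M3_L2/LZ; do 2!apply: L_com. Qed.

Lemma jorCA_M3 a b c : M3 (jor a (jor b c) - jor b (jor a c)).
Proof.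
have := spanB (jorA_M3 b a c) (jorA_M3 a b c); rewrite (jorC b a).
by congr M3; lmod_eq_with k ltac:(ring).
Qed.

End LowerCentral.

Arguments L : simpl never.

(** * Difference operators on iterated brackets *)

Section Bracket.
Variables (k : fieldType) (A : algType k).
Hypothesis char0 : [pchar k] =i pred0.
Implicit Types (a b c x y z : A) (s l : seq A).
Local Notation L := (@L k A).
Local Notation M3 := (@M3 k A).

Fixpoint brk s : A :=
  match s with
  | [::] => 0
  | a :: s' => if s' is [::] then a else com a (brk s')
  end.

Lemma brk_cons a s : s != [::] -> brk (a :: s) = com a (brk s).
Proof. by case: s. Qed.

Lemma brk_L n s : size s = n.+1 -> L n (brk s).
Proof.
elim: n s => [|n IH] [|a s] //= [sz].
by case: s sz => // b s sz; apply/L_com/IH.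
Qed.

Fixpoint eqM s s' : Prop :=
  match s, s' with
  | [::], [::] => True
  | x :: s1, x' :: s1' => M3 (x - x') /\ eqM s1 s1'
  | _, _ => False
  end.

Lemma eqM_refl s : eqM s s.
Proof. by elim: s => //= x s IH; rewrite subrr; split=> //; apply: span0. Qed.

(** An argument that changes within [M3] is bracketed with an element of the series, and [com_M3]
    gains one step more than the bracket itself; the last argument is brought to the left by
    antisymmetry. *)
Lemma brk_eqM s s' : eqM s s' -> (1 < size s)%N -> L (size s) (brk s - brk s').
Proof.
elim: s s' => [|a s IH] [|a' s'] // [Ma Ms] lt1.
case: s s' Ms lt1 IH => [|b s] [|b' s'] // Ms _ IH.
have -> : brk (a :: b :: s) - brk (a' :: b' :: s') =
    com (a - a') (brk (b :: s)) + com a' (brk (b :: s) - brk (b' :: s')).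
  by rewrite (brk_cons a) // (brk_cons a') // comBl comBr; lmod_eq_with k ltac:(ring).
apply: LD; first by apply: com_M3 => //; apply: brk_L.
case: s s' Ms IH => [|c s] [|c' s'] /= [Mb Ms] IH //; last exact/L_com/(IH (b' :: c' :: s')).
by rewrite comC; apply/LN/(@com_M3 _ _ char0 0%N).
Qed.

Fixpoint mulat (i : nat) a s : seq A :=
  match s, i with
  | [::], _ => [::]
  | x :: s', 0 => jor a x :: s'
  | x :: s', i'.+1 => x :: mulat i' a s'
  end.

Lemma size_mulat i a s : size (mulat i a s) = size s.
Proof. by elim: s i => [|x s IH] [|i] //=; rewrite IH. Qed.

Lemma mulat_eqM i a s s' : eqM s s' -> eqM (mulat i a s) (mulat i a s').
Proof.
elim: s s' i => [|x s IH] [|x' s'] [|i] //= [Mx Ms]; split=> //; last exact: IH.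
have -> : jor a x - jor a x' = jor a (x - x').
  by rewrite /jor; nc_expand; lmod_eq_with k ltac:(ring).
exact: M3_jorl.
Qed.

Lemma mulatC i j a b s : eqM (mulat i a (mulat j b s)) (mulat j b (mulat i a s)).
Proof.
elim: s i j => [|x s IH] [|i] [|j] //=; try by split; [rewrite subrr; exact: span0|exact: eqM_refl].
  by split; [exact: jorCA_M3|exact: eqM_refl].
by split=> //; rewrite subrr; exact: span0.
Qed.

(* [Dif ds phi] is the image of [phi] under the product of the difference
   operators [(i, j, a)]: multiply the i-th argument by [a], minus multiply the
   j-th argument by [a]. *)
Fixpoint Dif (ds : seq (nat * nat * A)) (phi : seq A -> A) s : A :=
  if ds is d :: ds' then Dif ds' phi (mulat d.1.1 d.2 s) - Dif ds' phi (mulat d.1.2 d.2 s)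
  else phi s.

Lemma Dif_ext ds phi psi s : (forall s', size s' = size s -> phi s' = psi s') ->
  Dif ds phi s = Dif ds psi s.
Proof.
elim: ds s => [|d ds IH] s e /=; first exact: e.
by congr (_ - _); apply: IH => s' sz; apply: e; rewrite sz size_mulat.
Qed.

Lemma DifD ds phi psi s : Dif ds (fun s => phi s + psi s) s = Dif ds phi s + Dif ds psi s.
Proof.
elim: ds s => //= d ds IH s; rewrite !IH.
by lmod_eq_with k ltac:(ring).
Qed.

Lemma Dif_cat ds ds' phi s : Dif (ds ++ ds') phi s = Dif ds (Dif ds' phi) s.
Proof. by elim: ds s => //= d ds IH s; rewrite !IH. Qed.

Lemma Dif_L j ds phi s : (forall s', size s' = size s -> L j (phi s')) -> L j (Dif ds phi s).
Proof.
elim: ds s => [|d ds IH] s Lp /=; first exact: Lp.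
by apply: LB; apply: IH => s' sz; apply: Lp; rewrite sz size_mulat.
Qed.

Lemma Dif_eqM ds s s' : eqM s s' -> (1 < size s)%N ->
  L (size s) (Dif ds brk s - Dif ds brk s').
Proof.
elim: ds s s' => [|d ds IH] s s' /= Ms lt1; first exact: brk_eqM.
have e i : L (size s) (Dif ds brk (mulat i d.2 s) - Dif ds brk (mulat i d.2 s')).
  by have := IH _ _ (mulat_eqM i d.2 Ms); rewrite size_mulat; apply.
have := LB (e d.1.1) (e d.1.2).
by congr L; lmod_eq_with k ltac:(ring).
Qed.

(** Brackets of n + 1 arguments lie in [L n], the term of index n + 1, so the condition says that
    the operators vanish on B_{n+1}. *)
Definition killed n ds := forall s, size s = n.+1 -> L n.+1 (Dif ds brk s).

Definition eqDif n ds ds' :=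
  forall s, size s = n.+1 -> L n.+1 (Dif ds brk s - Dif ds' brk s).

Lemma eqDif_trans n ds1 ds2 ds3 : eqDif n ds1 ds2 -> eqDif n ds2 ds3 -> eqDif n ds1 ds3.
Proof.
move=> e12 e23 s sz; have := LD (e12 s sz) (e23 s sz).
by rewrite addrA subrK.
Qed.

Lemma eqDif_cons n d ds ds' : eqDif n ds ds' -> eqDif n (d :: ds) (d :: ds').
Proof.
move=> e s sz /=; have sz' i : size (mulat i d.2 s) = n.+1 by rewrite size_mulat.
have := LB (e _ (sz' d.1.1)) (e _ (sz' d.1.2)).
by congr L; lmod_eq_with k ltac:(ring).
Qed.

(** Multiplications in different arguments commute exactly; in the same argument they commute modulo
    [M3], which the bracket does not see. *)
Lemma eqDif_swap n d d' ds : (0 < n)%N -> eqDif n (d :: d' :: ds) (d' :: d :: ds).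
Proof.
move=> n0 s sz /=; have e i j := @Dif_eqM ds _ _ (mulatC i j d'.2 d.2 s).
have sz' i j : size (mulat i d'.2 (mulat j d.2 s)) = n.+1 by rewrite !size_mulat.
have {}e i j : L n.+1 (Dif ds brk (mulat i d'.2 (mulat j d.2 s)) - Dif ds brk (mulat j d.2 (mulat i d'.2 s))).
  by have := e i j; rewrite !sz'; apply; rewrite ltnS.
have := LB (LD (e d'.1.1 d.1.1) (e d'.1.2 d.1.2)) (LD (e d'.1.2 d.1.1) (e d'.1.1 d.1.2)).
by congr L; lmod_eq_with k ltac:(ring).
Qed.

Lemma eqDif_refl n ds : eqDif n ds ds.
Proof. by move=> s _; rewrite subrr; apply: L0. Qed.

Lemma eqDif_move n d ds1 ds2 : (0 < n)%N -> eqDif n (d :: ds1 ++ ds2) (ds1 ++ d :: ds2).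
Proof.
move=> n0; elim: ds1 => [|d1 ds1 IH] /=; first exact: eqDif_refl.
exact: eqDif_trans (eqDif_swap _ _ _ n0) (eqDif_cons _ IH).
Qed.

Lemma killed_perm n ds ds' : (0 < n)%N -> perm_eq ds ds' -> killed n ds -> killed n ds'.
Proof.
move=> n0; apply: catCA_perm_ind => {ds ds'} s1 s2 s3.
suff : eqDif n (s2 ++ s1 ++ s3) (s1 ++ s2 ++ s3).
  move=> e K s sz; have := LD (e s sz) (K s sz); rewrite subrK //.
elim: s2 => [|d s2 IH] /=; first exact: eqDif_refl.
apply: eqDif_trans (eqDif_cons _ IH) _; exact: eqDif_move.
Qed.

Lemma killed_cat n ds ds' : killed n ds -> killed n (ds' ++ ds).
Proof.
move=> K s sz; rewrite Dif_cat; apply: Dif_L => s' sz'; apply: K; rewrite sz' //.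
Qed.

Lemma killed_filter n (p : pred (nat * nat * A)) ds : (0 < n)%N ->
  killed n (filter p ds) -> killed n ds.
Proof.
move=> n0 /(@killed_cat _ _ (filter (predC p) ds)); apply: killed_perm => //.
by rewrite perm_catC perm_filterC.
Qed.

Lemma killed_split n j i (l : nat) a ds :
  killed n ((i, j, a) :: ds) -> killed n ((j, l, a) :: ds) -> killed n ((i, l, a) :: ds).
Proof.
move=> K1 K2 s sz; have := LD (K1 s sz) (K2 s sz).
by congr L; rewrite /=; lmod_eq_with k ltac:(ring).
Qed.

Lemma killed_same n i a ds : killed n ((i, i, a) :: ds).
Proof. by move=> s sz; rewrite /= subrr; apply: L0. Qed.

Lemma killed_opp n i j a ds : killed n ((i, j, a) :: ds) -> killed n ((j, i, a) :: ds).
Proof. by move=> K s sz; have := LN (K s sz); rewrite /= opprB. Qed.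

Definition okd n (d : nat * nat * A) := (d.1.1 <= n)%N && (d.1.2 <= n)%N.

(** Operators are exchanged one at a time for operators in [T]. This does not change the length of
    the list, so the bound [N] carries over. *)
Lemma killed_reduce n N (T : pred (nat * nat * A)) : (0 < n)%N ->
  (forall d ds, okd n d -> (forall d', T d' -> killed n (d' :: ds)) -> killed n (d :: ds)) ->
  (forall ds, all T ds -> (N <= size ds)%N -> killed n ds) ->
  forall ds, all (okd n) ds -> (N <= size ds)%N -> killed n ds.
Proof.
move=> n0 red KT ds okds szds; rewrite -[ds]cats0.
suff : forall ds2, all T ds2 -> (N <= size ds + size ds2)%N -> killed n (ds ++ ds2).
  by apply=> //; rewrite addn0.
elim: ds okds {szds} => [|d ds IH] /=; first by move=> _ ds2 T2 sz; apply: KT.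
move=> /andP[okd okds] ds2 T2 sz; apply: red => // d' Td'.
have pe : perm_eq (ds ++ d' :: ds2) (d' :: ds ++ ds2) by rewrite -cat1s perm_catCA.
apply: killed_perm pe _ => //; apply: IH => //=; first by rewrite Td'.
by rewrite addnS.
Qed.

(** The difference in b turns a bracket into b bracketed with the symmetrized product of the two
    arguments. The difference in a then produces an associator, so that the result is (1/4) [b, [a,
    [x, y]]]. This is the origin of the constant 2. *)
Lemma com_Dif2 a b x y :
  L 2 (com (jor b (jor a x)) y - com (jor a x) (jor b y)
       - (com (jor b x) (jor a y) - com x (jor b (jor a y)))).
Proof.
rewrite (com_jor b (jor a x)) (com_jor b x).
have -> : com b (jor (jor a x) y) + com (jor a x) (jor b y) - com (jor a x) (jor b y) -
  (com b (jor x (jor a y)) + com x (jor b (jor a y)) - com x (jor b (jor a y))) =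
  com b (jor (jor x a) y - jor x (jor a y)).
  by rewrite comBr (jorC x a); lmod_eq_with k ltac:(ring).
by rewrite jorA; apply/L_com/L_decr1/LZ; do 2!apply: L_com.
Qed.

Definition dif01 (d : nat * nat * A) := d.1 == (0%N, 1%N).
Definition diftail (d : nat * nat * A) := (0 < d.1.1)%N && (0 < d.1.2)%N.
Definition dif02 (d : nat * nat * A) := d.1 == (0%N, 2%N).

Lemma killed_base ds : all (okd 1) ds -> (2 <= size ds)%N -> killed 1 ds.
Proof.
apply: (@killed_reduce _ _ dif01) => //.
  move=> [[[|[|i]] [|[|j]]] a] {}ds //= _ K; try exact: killed_same.
    by apply: K.
  by apply/killed_opp/K.
move=> [|[ij a] [|[ij' b] {}ds]] //= /and3P[/eqP/= -> /eqP/= -> _] _.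
rewrite -[_ :: _]cat1s -[_ :: ds]cat1s catA.
have n01 : (0 < 1)%N by [].
apply: (killed_perm n01 (_ : perm_eq (ds ++ [:: (0%N, 1%N, a); (0%N, 1%N, b)]) _)).
  by rewrite perm_catC.
apply: killed_cat => -[|x [|y [|? ?]]] // _ /=.
exact: com_Dif2.
Qed.

Lemma Dif_shift ds a s : s != [::] ->
  Dif [seq ((d.1.1.+1, d.1.2.+1), d.2) | d <- ds] brk (a :: s) = com a (Dif ds brk s).
Proof.
elim: ds s => [|d ds IH] s s0 /=; first exact: brk_cons.
by rewrite !IH ?comBr // -size_eq0 size_mulat size_eq0.
Qed.

(* In an iterated bracket all but a bounded number of multiplications can then be
   moved to the last argument. *)
Definition bounded n N := forall ds, all (okd n) ds -> (N <= size ds)%N -> killed n ds.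

(** Operators between positions other than 0 act on the inner bracket of the last n + 1 arguments,
    where [bounded n N] applies once positions are shifted by one. *)
Lemma killed_tail n N ds : bounded n N -> all (okd n.+1) ds ->
  (N <= count diftail ds)%N -> killed n.+1 ds.
Proof.
move=> bN okds le; apply: (@killed_filter _ diftail) => //.
set ds' := filter diftail ds; pose dd (d : nat * nat * A) := ((d.1.1.-1, d.1.2.-1), d.2).
have -> : ds' = [seq ((d.1.1.+1, d.1.2.+1), d.2) | d <- map dd ds'].
  rewrite -map_comp -[LHS]map_id; apply/eq_in_map => -[[i j] a].
  by rewrite mem_filter /diftail /= => /andP[/andP[i0 j0] _]; rewrite !prednK.
move=> [|a s] // [sz]; rewrite Dif_shift; last by rewrite -size_eq0 sz.
apply: L_com; apply: bN => //; last by rewrite size_map size_filter.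
rewrite all_map; apply/allP => -[[i j] a']; rewrite mem_filter => /andP[b din].
have /allP/(_ _ din) := okds; move: b; rewrite /diftail /okd /=; case: i j {din} => [|i] [|j] //=.
Qed.

Definition sw s := if s is x :: y :: l then y :: x :: l else s.
Definition swi i := if i is 0 then 1%N else if i is 1 then 0%N else i.
Definition swd (d : nat * nat * A) := ((swi d.1.1, swi d.1.2), d.2).

Lemma mulat_sw i a s : (1 < size s)%N -> sw (mulat i a s) = mulat (swi i) a (sw s).
Proof. by case: s => [|x [|y l]] //; case: i => [|[|i]]. Qed.

Lemma Dif_sw ds phi s : (1 < size s)%N ->
  Dif ds (fun s => phi (sw s)) s = Dif (map swd ds) phi (sw s).
Proof.
elim: ds s => //= d ds IH s lt1.
by rewrite !IH ?size_mulat // !mulat_sw.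
Qed.

(* Jacobi: [x, [y, u]] = [[x, y], u] + [y, [x, u]].  Two operators (0, 1) kill the
   first term; in the second one the operators (0, 2) act inside [x, u]. *)
Lemma killed_dif02 n N ds ds2 : (0 < n)%N -> bounded n N -> all dif02 ds -> (N <= size ds)%N ->
  all dif01 ds2 -> (2 <= size ds2)%N -> killed n.+1 (ds ++ ds2).
Proof.
move=> n0 bN gds szds; case: ds2 => [|[ij a] [|[ij' b] ds2]] //= /and3P[/eqP/= -> /eqP/= -> _] _.
have n01 : (0 < n.+1)%N by [].
set d1 := (0%N, 1%N, a); set d2 := (0%N, 1%N, b).
apply: (killed_perm n01 (_ : perm_eq (ds2 ++ ds ++ [:: d1; d2]) _)).
  by rewrite perm_catCA perm_cat2l perm_catC.
apply: killed_cat => -[|x [|y s]] // [sz].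
pose psi s := if s is x :: y :: l then com (com x y) (brk l) else 0.
rewrite (@Dif_ext _ _ (fun s => psi s + brk (sw s))); last first.
  move=> [|x' [|y' [|c s']]] //=; rewrite ?sz //; first by case: (n) n0.
  by move=> _; rewrite jacobi subrK.
rewrite DifD; apply: LD.
  rewrite Dif_cat; apply: Dif_L => -[|x' [|y' s']] //= [sz'].
  (* Two differences put [x, y] into [L 2], and the remaining n arguments form an element of
     [L n.-1]; their bracket lies in [L (2 + n.-1).+1], that is [L n.+2]. *)
  rewrite -!comBl -(addn1 n.+1) -[n.+1](prednK) // addn1.
  rewrite -[n.+1]/(1 + n)%N -[X in (1 + X)%N](prednK n0) addnS.
  rewrite -[(_ + _).+2]/((2 + n.-1).+1).
  apply: L_comL; first exact: com_Dif2.
  by apply: brk_L; rewrite sz' sz prednK.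
rewrite Dif_sw // map_cat.
have : killed n.+1 (map swd ds ++ map swd [:: d1; d2]).
  apply: (@killed_tail _ N) => //.
    rewrite all_cat; apply/andP; split; last by rewrite /= /okd.
    by rewrite all_map; apply: sub_all gds => -[[i j] c] /eqP/= [-> ->]; rewrite /okd /= !ltnS.
  rewrite count_cat (leq_trans szds) // (leq_trans _ (leq_addr _ _)) //.
  rewrite count_map -size_filter; rewrite (_ : filter _ ds = ds) //.
  by apply/all_filterP; apply: sub_all gds => -[[i j] c] /eqP/= [-> ->].
by apply; rewrite /= sz.
Qed.

(** An operator (0, 1) can be spent to gain either one operator (0, 2) or one on the tail. After m
    exchanges one of these two kinds has reached N, and two operators (0, 1) are left for
    [killed_dif02]. *)
Lemma killed_dif01 n N m ds : (0 < n)%N -> bounded n N -> all (okd n.+1) ds ->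
  (2 + m <= count dif01 ds)%N -> (N + N <= count diftail ds + count dif02 ds + m)%N ->
  killed n.+1 ds.
Proof.
move=> n0 bN; elim: m ds => [|m IH] ds okds.
  rewrite !addn0 => le2 leN; have [le|lt] := leqP N (count diftail ds).
    exact: killed_tail le.
  have leg : (N <= count dif02 ds)%N by lia.
  apply: (@killed_filter _ (predU dif02 dif01)) => //.
  apply: (killed_perm _ (_ : perm_eq (filter dif02 ds ++ filter dif01 ds) _)) => //.
    set e := filter (predU _ _) ds.
    have pe : perm_eq (filter dif02 e ++ filter (predC dif02) e) e by rewrite perm_filterC.
    rewrite (_ : filter dif02 ds = filter dif02 e); last first.
      by rewrite -filter_predI; apply: eq_filter => -[[i j] a] /=; case: dif02.
    rewrite (_ : filter dif01 ds = filter (predC dif02) e) //.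
    rewrite -filter_predI; apply: eq_filter => -[[i j] a] /=.
    by rewrite /dif02 /dif01 /=; case: i j => [|[]] [|[|[]]].
  apply: killed_dif02 bN _ _ _ _ => //; rewrite ?filter_all ?size_filter //.
move=> le2 leN; have /hasP[[ij a] din /eqP/= ij01] : has dif01 ds by rewrite has_count; lia.
move: din; rewrite ij01 => {ij ij01} din.
have pe := perm_to_rem din; set ds0 := rem _ ds in pe.
have cnt p := seq.permP pe p.
have ok0 : all (okd n.+1) ds0 by move: okds; rewrite (perm_all _ pe) => /andP[].
move: le2 leN; rewrite !cnt /= => le2 leN.
apply: (killed_perm (n := n.+1) (ds := (0%N, 1%N, a) :: ds0)); rewrite // 1?perm_sym //.
(* (0, 1, a) = (0, 2, a) + (2, 1, a) *)
apply: (@killed_split _ 2); apply: IH; rewrite /= ?ok0 ?andbT /okd /= ?ltnS //; lia.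
Qed.

(** Every operator splits into kinds (0, 1) and tail. With fewer than N on the tail, at least 2 + 2N
    are of kind (0, 1): 2N of them can be exchanged and two kept. *)
Lemma bounded_step n N : (0 < n)%N -> bounded n N -> bounded n.+1 (2 + (N + N) + N).
Proof.
move=> n0 bN; apply: (@killed_reduce _ _ (predI (okd n.+1) (predU dif01 diftail))) => //.
  move=> [[[|i] [|j]] a] ds okd_ K; first exact: killed_same.
  - have [->|j0] := eqVneq j 0%N; first exact: K.
    by apply: (@killed_split _ 1); apply: K; rewrite //= ?andbT.
  - have [->|i0] := eqVneq i 0%N; first by apply/killed_opp/K.
    by apply/killed_opp/(@killed_split _ 1); apply: K; rewrite //= ?andbT -/(okd _ _) /okd /= andbC.
  - by apply: K; rewrite /= okd_.
move=> ds; rewrite all_predI => /andP[okds]; rewrite all_count => /eqP cU szds.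
have := count_predUI dif01 diftail ds; rewrite cU => cnt.
have [le|lt] := leqP N (count diftail ds); first exact: killed_tail le.
apply: (@killed_dif01 n N (N + N)) => //; lia.
Qed.

Lemma bounded_exists n : (0 < n)%N -> exists N, bounded n N.
Proof.
elim: n => // -[|n] IH _; first by exists 2%N => ds; apply: killed_base.
by have [N bN] := IH isT; exists (2 + (N + N) + N)%N; apply: bounded_step.
Qed.

End Bracket.

(** * Brackets of short words with an even form *)

Section Generation.
Variables (k : fieldType) (A : algType k).
Hypothesis char0 : [pchar k] =i pred0.
Variables (T : Type) (X : T -> A).
Local Notation L := (@L k A).
Local Notation M3 := (@M3 k A).
Local Notation brk := (@brk k A).

(* The generators are the letters and the commutators of two letters. *)
Definition genv (g : T + T * T) : A :=
  match g with inl t => X t | inr (t, u) => com (X t) (X u) end.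

Definition jprod (gs : seq (T + T * T)) : A := foldr (fun g => jor (genv g)) 1 gs.

Definition wordv (w : seq T) : A := foldr (fun t => *%R (X t)) 1 w.

Lemma wordv_cat w w' : wordv (w ++ w') = wordv w * wordv w'.
Proof. by elim: w => [|t w IH] /=; rewrite ?mul1r // IH mulrA. Qed.

Fixpoint altp (ys : seq T) : A :=
  if ys is y1 :: y2 :: ys' then com (X y1) (X y2) * altp ys' else 1.

(* [rho xs ys] is the form x_1 ... x_p dy_1 ... dy_r, for r even. *)
Definition rho (xs ys : seq T) : A := foldr (fun t => jor (X t)) (altp ys) xs.

Lemma jorDr (a x y : A) : jor a (x + y) = jor a x + jor a y.
Proof. by have := jor_linr a 1 x y; rewrite !scale1r. Qed.

Lemma jorNr (a x : A) : jor a (- x) = - jor a x.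
Proof. by rewrite /jor; nc_expand; lmod_eq_with k ltac:(ring). Qed.

Lemma jorBr (a x y : A) : jor a (x - y) = jor a x - jor a y.
Proof. by rewrite jorDr jorNr. Qed.

Let jspan := span (fun z => M3 z \/ exists gs, z = jprod gs).

Lemma jspan_M3 z : M3 z -> jspan z.
Proof. by move=> Mz; apply: span_in; left. Qed.

Lemma jspan_jor g z : jspan z -> jspan (jor (genv g) z).
Proof.
apply: span_lin => [s x y|x [Mx|[gs ->]]]; first exact: jor_linr.
  exact/jspan_M3/M3_jorl.
by apply: span_in; right; exists (g :: gs).
Qed.

Lemma jspan_com t gs : jspan (com (X t) (jprod gs)).
Proof.
elim: gs => [|g gs IH] /=.
  by rewrite /com mulr1 mul1r subrr; apply: span0.
rewrite com_jorr; apply: spanD; last exact: jspan_jor.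
case: g => [u|[u v]] /=; first by apply: span_in; right; exists (inr (t, u) :: gs).
by rewrite jorC; apply/jspan_M3/M3_jorl/M3_L2; do 2!apply: L_com.
Qed.

(** A product with a letter is the symmetrized product plus half a commutator. Bracketing with a
    letter is a derivation of the symmetrized product that sends letters to generators and
    commutators of letters into [M3]. *)
Lemma jspan_word w : jspan (wordv w).
Proof.
elim: w => [|t w IH] /=; first by apply: span_in; right; exists [::].
move: IH; apply: (span_lin (f := fun x => X t * x)) => [s x y|x [Mx|[gs ->]]].
- by rewrite mulrDr scalerAr.
- exact/jspan_M3/M3_mull.
rewrite mul_jor //; apply: spanD; last exact/spanZ/jspan_com.
by apply: span_in; right; exists (inl t :: gs).
Qed.

Lemma jprod_words gs :
  span (fun z => exists w, (size w <= (size gs).*2)%N /\ z = wordv w) (jprod gs).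
Proof.
elim: gs => [|g gs IH] /=; first by apply: span_in; exists [::].
move: IH; apply: span_lin => [s x y|_ [w [sw ->]]]; first exact: jor_linr.
have mw u : (size u <= 2)%N ->
    span (fun z => exists w, (size w <= (size gs).*2.+2)%N /\ z = wordv w)
    (2%:R^-1 *: (wordv u * wordv w + wordv w * wordv u)).
  move=> su; apply: spanZ; rewrite -!wordv_cat.
  apply: spanD; apply: span_in; [exists (u ++ w)|exists (w ++ u)].
    by rewrite size_cat; split=> //; lia.
  by rewrite size_cat; split=> //; lia.
case: g => [t|[t u]] /=.
  by have := mw [:: t] isT; rewrite /= mulr1.
have := spanB (mw [:: t; u] isT) (mw [:: u; t] isT); rewrite /= !mulr1.
by congr span; rewrite /jor /com; nc_expand; lmod_eq_with k ltac:(ring).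
Qed.

Lemma rho_comm c xs ys : M3 (jor (com (X c.1) (X c.2)) (rho xs ys) - rho xs (c.1 :: c.2 :: ys)).
Proof.
elim: xs => [|x xs IH] /=.
  set c' := com _ _; have -> : jor c' (altp ys) - c' * altp ys = - 2%:R^-1 *: com c' (altp ys).
    by rewrite [c' * _]mul_jor //; lmod_eq_with k ltac:(ring).
  by apply/M3_L2/LZ; rewrite comC; apply/LN; do 2!apply: L_com.
rewrite -(subrK (jor (X x) (jor (com (X c.1) (X c.2)) (rho xs ys))) (jor _ _)) -addrA -jorBr.
apply: spanD; [exact: jorCA_M3|exact: M3_jorl].
Qed.

Lemma jprod_rho gs : exists xs ys, ~~ odd (size ys) /\ M3 (jprod gs - rho xs ys).
Proof.
elim: gs => [|[t|c] gs [xs [ys [oy IH]]]] /=.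
- by exists [::], [::]; rewrite subrr; split=> //; apply: span0.
- by exists (t :: xs), ys; split=> //=; rewrite -jorBr; apply: M3_jorl.
exists xs, [:: c.1, c.2 & ys]; rewrite /= negbK; split=> //.
have := spanD (M3_jorl (genv (inr c)) IH) (rho_comm c xs ys).
by case: c => c1 c2 /=; rewrite jorBr addrA subrK.
Qed.

Lemma rho_swap xs1 t u xs2 ys : M3 (rho (xs1 ++ t :: u :: xs2) ys - rho (xs1 ++ u :: t :: xs2) ys).
Proof.
elim: xs1 => [|x xs1 IH] /=; first exact: jorCA_M3.
by rewrite -jorBr; apply: M3_jorl.
Qed.

(** Within a pair this is antisymmetry. Across two pairs, expanding [a, [bc, d]] shows that
    [a, b][c, d] + [a, c][b, d] lies in the ideal of triple commutators; even length provides the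
    partner d. *)
Lemma altp_swap ys1 t u ys2 : ~~ odd (size (ys1 ++ t :: u :: ys2)) ->
  M3 (altp (ys1 ++ t :: u :: ys2) + altp (ys1 ++ u :: t :: ys2)).
Proof.
have [n le] := ubnP (size ys1); elim: n ys1 le => // n IH [|y [|y' ys1]] /= le.
- by rewrite (comC (X u)) mulNr subrr => _; apply: span0.
- case: ys2 {IH} => [|v ys2] //= _; rewrite !mulrA -mulrDl; apply: M3_mulr.
  set a := X y; set b := X t; set c := X u; set d := X v.
  have -> : com a b * com c d + com a c * com b d = com a (com (b * c) d) -
     b * com a (com c d) - com a (com b d) * c + com (com a c) (com b d).
    by rewrite /com; nc_expand; lmod_eq_with k ltac:(ring).
  have l2 x y' z : L 2 (com x (com y' z)) by do 2!apply: L_com.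
  apply: spanD; last exact/M3_L2.
  apply: spanB; last exact/M3_mulr/M3_L2.
  by apply: spanB; [exact/M3_L2|exact/M3_mull/M3_L2].
- rewrite negbK => oy; rewrite -mulrDr; apply: M3_mull; apply: IH => //; lia.
Qed.

Lemma rho_alt xs ys1 t u ys2 : ~~ odd (size (ys1 ++ t :: u :: ys2)) ->
  M3 (rho xs (ys1 ++ t :: u :: ys2) + rho xs (ys1 ++ u :: t :: ys2)).
Proof.
move=> oy; elim: xs => [|x xs IH] /=; first exact: altp_swap.
by rewrite -jorDr; apply: M3_jorl.
Qed.

Lemma brk_lin s1 s2 (c : k) x y :
  brk (s1 ++ (c *: x + y) :: s2) = c *: brk (s1 ++ x :: s2) + brk (s1 ++ y :: s2).
Proof.
elim: s1 => [|a s1 IH]; first by case: s2 => //= b s2; rewrite com_linl.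
have ne (z : A) : s1 ++ z :: s2 != [::] by case: s1 {IH}.
by rewrite !cat_cons !brk_cons // IH com_linr.
Qed.

Lemma brk_M3slot s1 x s2 : (0 < size s1 + size s2)%N -> M3 x ->
  L (size s1 + size s2).+1 (brk (s1 ++ x :: s2)).
Proof.
move=> s0 Mx; have b0 : brk (s1 ++ 0 :: s2) = 0.
  by have := brk_lin s1 s2 (-1) 0 0; rewrite !scaleN1r addNr addNr.
rewrite -[brk _]subr0 -b0 -addnS -[(size s2).+1]/(size (x :: s2)) -size_cat.
apply: brk_eqM => //; last by rewrite size_cat /= addnS ltnS.
elim: s1 {s0 b0} => [|a s1 IH] /=; first by rewrite subr0; split=> //; apply: eqM_refl.
by rewrite subrr; split=> //; apply: span0.
Qed.

(** Multilinear expansion, one argument after the other, with the treated arguments in [s1]; a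
    summand in [M3] sends the whole bracket into the next term. *)
Lemma brk_span (P : nat -> A -> Prop) s : (1 < size s)%N ->
  (forall i, (i < size s)%N -> span (fun z => M3 z \/ P i z) (nth 0 s i)) ->
  span (fun z => L (size s) z \/ exists s', [/\ size s' = size s,
      (forall i, (i < size s)%N -> P i (nth 0 s' i)) & z = brk s']) (brk s).
Proof.
move=> lt1 Ps; rewrite -[X in brk X]cat0s.
suff H s2 s1 : (size s1 + size s2 = size s)%N ->
    (forall i, (i < size s1)%N -> P i (nth 0 s1 i)) ->
    (forall i, (i < size s2)%N -> span (fun z => M3 z \/ P (size s1 + i)%N z) (nth 0 s2 i)) ->
    span (fun z => L (size s) z \/ exists s', [/\ size s' = size s,
      (forall i, (i < size s)%N -> P i (nth 0 s' i)) & z = brk s']) (brk (s1 ++ s2)).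
  exact: H.
elim: s2 s1 => [|x s2 IH] s1.
  by rewrite addn0 cats0 => sz P1 _; apply: span_in; right; exists s1; rewrite -sz.
move=> sz P1 P2; have := P2 0%N isT; rewrite addn0 /=.
apply: (span_lin (f := fun x => brk (s1 ++ x :: s2))) => [c y z|y [My|Py]].
- exact: brk_lin.
- apply: span_in; left; rewrite -sz /= addnS; apply: brk_M3slot => //.
  by move: lt1; rewrite -sz /= addnS.
rewrite -cat_rcons; apply: IH.
- by rewrite size_rcons -sz addnS.
- move=> i; rewrite size_rcons ltnS leq_eqVlt nth_rcons => /orP[/eqP->|lti].
    by rewrite ltnn eqxx.
  by rewrite lti; apply: P1.
- by move=> i lti; rewrite size_rcons addSnnS; apply: P2 i.+1 lti.
Qed.

Fixpoint addat (i : nat) g (gss : seq (seq (T + T * T))) :=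
  match gss, i with
  | [::], _ => [::]
  | gs :: gss', 0 => (g :: gs) :: gss'
  | gs :: gss', i'.+1 => gs :: addat i' g gss'
  end.

Lemma size_addat i g gss : size (addat i g gss) = size gss.
Proof. by elim: gss i => [|gs gss IH] [|i] //=; rewrite IH. Qed.

Lemma map_addat i g gss : map jprod (addat i g gss) = mulat i (genv g) (map jprod gss).
Proof. by elim: gss i => [|gs gss IH] [|i] //=; rewrite IH. Qed.

Definition cnt n (gss : seq (seq (T + T * T))) := sumn (map size (take n gss)).

Lemma cnt_addat n i g gss : (i < size gss)%N -> cnt n (addat i g gss) = (cnt n gss + (i < n))%N.
Proof.
rewrite /cnt; elim: gss n i => [|gs gss IH] [|n] [|i] //=; rewrite ?addn0 //.
  by rewrite addn1.
by rewrite ltnS => /IH ->; rewrite addnA.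
Qed.

Lemma cnt_peel n gss : (0 < cnt n gss)%N ->
  exists i g gss', [/\ (i < n)%N, (i < size gss)%N & gss = addat i g gss'].
Proof.
rewrite /cnt; elim: gss n => [|[|g gs] gss IH] [|n] //=.
  rewrite add0n => /IH[i [g [gss' [lt1 lt2 e]]]].
  by exists i.+1, g, ([::] :: gss'); rewrite /= -e.
by move=> _; exists 0%N, g, (gs :: gss).
Qed.

Definition adds (ps : seq (nat * (T + T * T))) gss :=
  foldl (fun gss p => addat p.1 p.2 gss) gss ps.

Lemma size_adds ps gss : size (adds ps gss) = size gss.
Proof. by elim: ps gss => //= p ps IH gss; rewrite IH size_addat. Qed.

Lemma cnt_adds n ps gss : all (fun p => p.1 < n)%N ps -> (n <= size gss)%N ->
  cnt n (adds ps gss) = (cnt n gss + size ps)%N.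
Proof.
elim: ps gss => [|p ps IH] gss /=; first by rewrite addn0.
move=> /andP[lt all_lt] le; rewrite IH ?size_addat // cnt_addat ?lt ?(leq_trans lt) //.
by rewrite -addnA.
Qed.

Lemma cnt_peels n N gss : (N <= cnt n gss)%N -> (n <= size gss)%N -> exists ps gss',
  [/\ size ps = N, all (fun p => p.1 < n)%N ps & gss = adds ps gss'].
Proof.
elim: N gss => [|N IH] gss le sz; first by exists [::], gss.
have [i [g [gss' [lt1 lt2 e]]]] := cnt_peel (leq_ltn_trans (leq0n _) le).
have sz' : size gss = size gss' by rewrite e size_addat.
have [||ps [gss2 [sps alt e2]]] := IH gss'; rewrite -?sz' //.
  by move: le; rewrite e cnt_addat -?sz' // lt1 addn1 ltnS.
exists (rcons ps (i, g)), gss2; split; first by rewrite size_rcons sps.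
  by rewrite all_rcons lt1.
by rewrite /adds -cats1 foldl_cat /= -/(adds _ _) -e2.
Qed.

Definition slots n c z :=
  exists gss, [/\ size gss = n.+1, (cnt n gss < c)%N & z = brk (map jprod gss)].

Lemma slots_mono n c c' z : (c <= c')%N -> slots n c z -> slots n c' z.
Proof. by move=> le [gss [sz lt e]]; exists gss; split=> //; apply: leq_trans lt le. Qed.

(** When the differences are expanded, the term that always chooses the first position is the
    bracket of [adds ps gss]. Every other term has sent a factor to the last argument and so has
    fewer factors in the first n. *)
Lemma Dif_adds n ps gss : all (fun p => p.1 < n)%N ps -> size gss = n.+1 ->
  span (slots n (cnt n gss + size ps))
    (Dif [seq (p.1, n, genv p.2) | p <- ps] brk (map jprod gss) - brk (map jprod (adds ps gss))).
Proof.
elim: ps gss => [|p ps IH] gss /=; first by rewrite subrr => _ _; apply: span0.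
move=> /andP[lt alt] sz; rewrite -!map_addat.
have := IH (addat p.1 p.2 gss) alt; have := IH (addat n p.2 gss) alt.
have lt' : (p.1 < n.+1)%N by rewrite ltnS ltnW.
rewrite !size_addat !cnt_addat ?sz // lt ltnn addn0 addn1 addSnnS.
move=> /(_ erefl) S1 /(_ erefl) S2.
set D1 := Dif _ _ _ in S2 *; set D2 := Dif _ _ _ in S1 *.
set b1 := brk _ in S2 *; set b2 := brk _ in S1.
have -> : D1 - D2 - b1 = (D1 - b1) - ((D2 - b2) + b2) by lmod_eq_with k ltac:(ring).
apply: spanB => //; apply: spanD.
  by apply: span_sub S1 => z Sz; apply: span_in; apply: slots_mono Sz; lia.
apply: span_in; exists (adds ps (addat n p.2 gss)).
rewrite size_adds size_addat cnt_adds ?size_addat ?sz // cnt_addat ?sz // ltnn.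
by split=> //; lia.
Qed.

(** Induction on the number of factors before the last argument: while there are at least N, the
    expansion of N differences is killed, which expresses the bracket by brackets with fewer such
    factors. *)
Lemma brk_slots n N gss : (0 < n)%N -> @bounded k A n N -> size gss = n.+1 ->
  span (fun z => L n.+1 z \/ slots n N z) (brk (map jprod gss)).
Proof.
move=> n0 bN; have [c le] := ubnP (cnt n gss); elim: c gss le => // c IH gss le sz.
have [ltN|leN] := ltnP (cnt n gss) N; first by apply: span_in; right; exists gss.
have [|ps [gss' [sps alt e]]] := cnt_peels leN; first by rewrite sz.
have sz' : size gss' = n.+1 by rewrite -sz e size_adds.
have := Dif_adds alt sz'; rewrite -e; set D := Dif _ _ _; set b := brk _ => SD.
have LD : L n.+1 D.
  apply: bN; rewrite ?size_map ?sps // all_map; apply: sub_all alt => p lt /=.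
  by rewrite /okd /= leqnn andbT ltnW.
rewrite -[b](subKr D); apply: spanB; first by apply: span_in; left.
apply: span_sub SD => _ [hss [szh lth ->]]; apply: IH => //.
by move: le; rewrite e cnt_adds ?sz' //; lia.
Qed.

Lemma seq_choice (B : Type) (b0 : B) (R : nat -> B -> Prop) n :
  (forall i, (i < n)%N -> exists b, R i b) ->
  exists s, size s = n /\ forall i, (i < n)%N -> R i (nth b0 s i).
Proof.
elim: n R => [|n IH] R H; first by exists [::].
have [b Rb] := H 0%N isT; have [s [sz Rs]] := IH (fun i => R i.+1) (fun i => H i.+1).
by exists (b :: s); rewrite /= sz; split=> // -[|i] //; apply: Rs.
Qed.

Lemma size_nth_cnt n i gss : (i < n)%N -> (size (nth [::] gss i) <= cnt n gss)%N.
Proof.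
rewrite /cnt; elim: gss n i => [|gs gss IH] [|n] [|i] //=; first by rewrite leq_addr.
by rewrite ltnS => /IH le; rewrite (leq_trans le) // leq_addl.
Qed.

Lemma brk_generation n : (0 < n)%N -> exists M : nat, forall ws : seq (seq T), size ws = n.+1 ->
  span (fun z => L n.+1 z \/ exists us xs ys, [/\ size us = n, all (fun u => size u <= M)%N us,
        ~~ odd (size ys) & z = brk (rcons (map wordv us) (rho xs ys))]) (brk (map wordv ws)).
Proof.
(* Fewer than N generators remain before the last argument, and a generator has at most two letters:
   hence the length bound 2N. *)
move=> n0; have [N bN] := @bounded_exists k A char0 n n0; exists N.*2 => ws szw.
have szm : size (map wordv ws) = n.+1 by rewrite size_map.
have := @brk_span (fun _ z => exists gs, z = jprod gs) (map wordv ws).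
rewrite szm => /(_ n0) H.
have /H {H} : forall i, (i < n.+1)%N -> span (fun z => M3 z \/ exists gs, z = jprod gs)
    (nth 0 (map wordv ws) i).
  by move=> i lti; rewrite (nth_map [::]) ?szw //; apply: jspan_word.
apply: span_sub => ? [Lz|[s' [sz' Ps ->]]]; first by apply: span_in; left.
have [gss [szg Pg]] := seq_choice [::] Ps.
have -> : s' = map jprod gss.
  apply: (@eq_from_nth _ 0) => [|i]; rewrite ?size_map ?szg sz' // => lti.
  by rewrite Pg // (nth_map [::]) ?szg.
apply: span_sub (brk_slots n0 bN szg) => ? [Lz|[hss [szh lth ->]]]; first by apply: span_in; left.
have szj : size (map jprod hss) = n.+1 by rewrite size_map.
pose P i z := if (i < n)%N then exists w, (size w <= N.*2)%N /\ z = wordv w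
    else exists xs ys, ~~ odd (size ys) /\ z = rho xs ys.
have := @brk_span P (map jprod hss); rewrite szj => /(_ n0) H.
have /H {H} : forall i, (i < n.+1)%N -> span (fun z => M3 z \/ P i z)
    (nth 0 (map jprod hss) i).
  move=> i lti; rewrite (nth_map [::]) ?szh // /P; case: ltnP => ltin.
    apply: span_sub (jprod_words (nth [::] hss i)) => z [w [szw' ->]].
    apply: span_in; right; exists w; split=> //; apply: leq_trans szw' _.
    by rewrite leq_double ltnW // (leq_ltn_trans (size_nth_cnt hss ltin)).
  have [xs [ys [oy M]]] := jprod_rho (nth [::] hss i).
  rewrite -[jprod _](subrK (rho xs ys)); apply: spanD; apply: span_in; first by left.
  by right; exists xs, ys.
apply: span_sub => ? [Lz|[s2 [sz2 P2 ->]]]; first by apply: span_in; left.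
have [|us [szu Pu]] := @seq_choice _ [::] (fun i w => (size w <= N.*2)%N /\ nth 0 s2 i = wordv w) n.
  by move=> i lti; have := P2 i (leqW lti); rewrite /P lti.
have := P2 n (leqnn _); rewrite /P ltnn => -[xs [ys [oy e]]].
apply: span_in; right; exists us, xs, ys; split=> //.
  by apply/(all_nthP [::]) => i; rewrite szu => /Pu[].
congr brk; apply: (@eq_from_nth _ 0); first by rewrite size_rcons size_map szu.
move=> i; rewrite sz2 ltnS leq_eqVlt nth_rcons size_map szu => /orP[/eqP->|lti].
  by rewrite ltnn eqxx.
by rewrite lti (nth_map [::]) ?szu //; have [_ ->] := Pu i lti.
Qed.

End Generation.

(** * Formal sums of words and the free algebra *)

Section FormalSums.
Variable k : fieldType.

Definition lsum (M : lmodType k) (T : Type) (f : seq T -> M) (r : seq (k * seq T)) : M :=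
  \sum_(p <- r) p.1 *: f p.2.

Definition relabel (T U : Type) (f : T -> U) (r : seq (k * seq T)) : seq (k * seq U) :=
  [seq (p.1, map f p.2) | p <- r].

Lemma lsum_relabel (M : lmodType k) (T U : Type) (f : T -> U) (g : seq U -> M) r :
  lsum g (relabel f r) = lsum (fun w => g (map f w)) r.
Proof. by rewrite /lsum big_map. Qed.

Section FormalWords.
Variable T : Type.
Implicit Types (w u : seq T) (r : seq (k * seq T)).

(* Formal counterparts of [brk], [altp] and [rho], as lists of coefficients and
   words: they are evaluated both in algebras and on morphisms. *)
Fixpoint brl (ws : seq (seq T)) : seq (k * seq T) :=
  match ws with
  | [::] => [::]
  | w :: ws' => if ws' is [::] then [:: (1, w)] else
      [seq (p.1, w ++ p.2) | p <- brl ws'] ++ [seq (- p.1, p.2 ++ w) | p <- brl ws']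
  end.

Lemma brl_cons w (ws : seq (seq T)) : (0 < size ws)%N -> brl (w :: ws) =
  [seq (p.1, w ++ p.2) | p <- brl ws] ++ [seq (- p.1, p.2 ++ w) | p <- brl ws].
Proof. by case: ws. Qed.

Fixpoint altl (ys : seq T) : seq (k * seq T) :=
  if ys is y1 :: y2 :: ys' then
    [seq (p.1, [:: y1, y2 & p.2]) | p <- altl ys'] ++
    [seq (- p.1, [:: y2, y1 & p.2]) | p <- altl ys']
  else [:: (1, [::])].

Fixpoint rhol (xs ys : seq T) : seq (k * seq T) :=
  if xs is x :: xs' then
    [seq (2%:R^-1 * p.1, x :: p.2) | p <- rhol xs' ys] ++
    [seq (2%:R^-1 * p.1, rcons p.2 x) | p <- rhol xs' ys]
  else altl ys.

Definition genl (us : seq (seq T)) (xs ys : seq T) : seq (k * seq T) :=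
  flatten [seq [seq (p.1 * q.1, q.2) | q <- brl (rcons us p.2)] | p <- rhol xs ys].

Variables (A : algType k) (X : T -> A).
Local Notation wordv := (wordv X).

Lemma brk_brl ws : brk (map wordv ws) = lsum wordv (brl ws).
Proof.
elim: ws => [|w ws IH]; first by rewrite /lsum big_nil.
case: ws IH => [|w' ws] IH; first by rewrite /lsum big_seq1 /= scale1r.
rewrite map_cons brk_cons // IH (brl_cons w) //; move: (brl (w' :: ws)) => r {IH}.
rewrite /lsum big_cat !big_map /com mulr_sumr mulr_suml.
congr (_ + _); first by apply: eq_bigr => p _; rewrite wordv_cat scalerAr.
by rewrite -sumrN; apply: eq_bigr => p _; rewrite wordv_cat -scalerAl scaleNr.
Qed.

Lemma altp_altl ys : altp X ys = lsum wordv (altl ys).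
Proof.
have [n le] := ubnP (size ys); elim: n ys le => // n IH [|y1 [|y2 ys]] /= le.
- by rewrite /lsum big_seq1 scale1r.
- by rewrite /lsum big_seq1 scale1r.
rewrite IH; last exact: ltnW le.
rewrite /lsum big_cat !big_map /com mulrBl !mulr_sumr; congr (_ + _).
  by apply: eq_bigr => p _; rewrite /= -scalerAr !mulrA.
by rewrite -sumrN; apply: eq_bigr => p _; rewrite /= -scalerAr !mulrA scaleNr.
Qed.

Lemma rho_rhol xs ys : rho X xs ys = lsum wordv (rhol xs ys).
Proof.
elim: xs => [|x xs IH] /=; first exact: altp_altl.
rewrite -/(rho X xs ys) IH /jor /lsum big_cat !big_map mulr_sumr mulr_suml scalerDr.
rewrite !scaler_sumr; congr (_ + _); apply: eq_bigr => p _ /=.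
  by rewrite -scalerAr scalerA.
by rewrite -cats1 wordv_cat /= mulr1 -scalerAl scalerA.
Qed.

Lemma brk_genl us xs ys :
  brk (rcons (map wordv us) (rho X xs ys)) = lsum wordv (genl us xs ys).
Proof.
rewrite rho_rhol /lsum /genl big_flatten big_map /= -cats1.
have brk0 : brk (map wordv us ++ [:: 0]) = 0.
  by have := brk_lin (map wordv us) [::] (-1) 0 0; rewrite !scaleN1r !addNr.
elim: (rhol xs ys) => [|p r IH]; first by rewrite !big_nil.
rewrite !big_cons brk_lin IH; congr (_ + _).
rewrite cats1 -map_rcons brk_brl /lsum scaler_sumr big_map.
by apply: eq_bigr => q _; rewrite scalerA.
Qed.

End FormalWords.

Section Relabel.
Variables (T U : Type) (f : T -> U).

Lemma brl_map ws : brl (map (map f) ws) = relabel f (brl ws).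
Proof.
elim: ws => // w [|w' ws] IH //.
rewrite map_cons (brl_cons (map f w)) // (brl_cons w) // IH /relabel map_cat -!map_comp.
congr (_ ++ _).
  by apply: eq_map => p; rewrite /= map_cat.
by apply: eq_map => p; rewrite /= map_cat.
Qed.

Lemma altl_map ys : altl (map f ys) = relabel f (altl ys).
Proof.
have [n le] := ubnP (size ys); elim: n ys le => // n IH [|y1 [|y2 ys]] //= le.
by rewrite IH; [rewrite /relabel map_cat -!map_comp|exact: ltnW le].
Qed.

Lemma rhol_map xs ys : rhol (map f xs) (map f ys) = relabel f (rhol xs ys).
Proof.
elim: xs => [|x xs IH] /=; first exact: altl_map.
rewrite IH /relabel map_cat -!map_comp; congr (_ ++ _).
by apply: eq_map => p; rewrite /= map_rcons.
Qed.

Lemma genl_map us xs ys :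
  genl (map (map f) us) (map f xs) (map f ys) = relabel f (genl us xs ys).
Proof.
rewrite /genl rhol_map /relabel map_flatten -!map_comp; congr flatten.
by apply: eq_map => p /=; rewrite -map_rcons brl_map /relabel -!map_comp.
Qed.

End Relabel.

Section Perm.
Variable T : eqType.
Implicit Types (w u : seq T) (p : k * seq T).

Lemma brl_perm ws p : p \in brl ws -> perm_eq p.2 (flatten ws).
Proof.
elim: ws p => // w ws IH p; case: ws IH => [|w' ws] IH.
  by rewrite inE /= cats0 => /eqP->.
rewrite (brl_cons w) // mem_cat => /orP[] /mapP[q /IH pq ->] /=; first by rewrite perm_cat2l.
by rewrite perm_catC perm_cat2l.
Qed.

Lemma altl_perm ys p : ~~ odd (size ys) -> p \in altl ys -> perm_eq p.2 ys.
Proof.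
have [n le] := ubnP (size ys); elim: n ys p le => // n IH [|y1 [|y2 ys]] p //= le oy.
  by rewrite inE => /eqP->.
rewrite negbK in oy; rewrite mem_cat => /orP[] /mapP[q /(IH _ _ (ltnW le) oy) pq ->] /=.
  by rewrite !perm_cons.
by rewrite (permPl (permEl (perm_catCA [:: y2] [:: y1] q.2))) !perm_cons.
Qed.

Lemma rhol_perm xs ys p : ~~ odd (size ys) -> p \in rhol xs ys -> perm_eq p.2 (xs ++ ys).
Proof.
move=> oy; elim: xs p => [|x xs IH] p /=; first exact: altl_perm.
rewrite mem_cat => /orP[] /mapP[q /IH pq ->] /=; first by rewrite perm_cons.
by rewrite perm_rcons perm_cons.
Qed.

(** All words of the expansion have the same letters, so that they are either all multilinear or
    none is; evaluation treats the generator as a whole. *)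
Lemma genl_perm us xs ys p : ~~ odd (size ys) -> p \in genl us xs ys ->
  perm_eq p.2 (flatten us ++ xs ++ ys).
Proof.
move=> oy /flatten_mapP[q /(rhol_perm oy) pq /mapP[r /brl_perm pr ->]] /=.
by rewrite (permPl pr) -cats1 flatten_cat /= cats0 perm_cat2l.
Qed.

End Perm.
End FormalSums.

Section WordSpan.
Variables (k : fieldType) (A : algType k) (T : Type) (X : T -> A).
Hypothesis A_words : forall a : A, span (fun z => exists w, z = wordv X w) a.

Lemma L_words j y : L j y ->
  span (fun z => exists ws, size ws = j.+1 /\ z = brk (map (wordv X) ws)) y.
Proof.
elim: j y => [|j IH] y.
  by move=> _; apply: span_sub (A_words y) => _ [w ->]; apply: span_in; exists [:: w].
apply: span_sub => _ [a [l [/IH{}IH ->]]].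
move: IH; apply: (span_lin (f := com a)) => [c u v|_ [ws [sz ->]]]; first exact: com_linr.
move: (A_words a); apply: (span_lin (f := fun a => com a _)) => [c u v|_ [w ->]].
  exact: com_linl.
apply: span_in; exists (w :: ws); rewrite /= sz; split=> //.
by case: ws sz.
Qed.

End WordSpan.

(** * The free algebra on countably many letters *)

Section FreeAlgebra.
Variable k : fieldType.

Definition falg := {malg k[{fmonom nat}]}.

HB.instance Definition _ := GRing.Lalgebra.on falg.

Implicit Types (w u : seq nat) (x y : falg).

Definition mon w : falg := << FMonom w >>%R.

Lemma mon_mul w u : mon w * mon u = mon (w ++ u).
Proof. by rewrite malgM_def fgmulUU mul1r /= /mmul /= fmmulE. Qed.

Lemma falgE x : x = \sum_(m <- msupp x) x@_m *: mon m.
Proof.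
rewrite {1}[x]monalgE; apply: eq_bigr => m _; apply/malgP => m'.
by rewrite mcoeffZ !mcoeffU fmK mulr_natr.
Qed.

Lemma falg_scaleAr (c : k) (x y : falg) : c *: (x * y) = x * (c *: y).
Proof.
have comm : x * c%:MP = c%:MP * x.
  rewrite mul_malgC malgZ_def; transitivity (fgmul x << c *g mone >>) => //.
  rewrite fgmulgU; apply: eq_bigr => m _.
  by rewrite mulm1 mulrC.
by rewrite -(mul_malgC c y) mulrA comm mul_malgC -scalerAl.
Qed.

HB.instance Definition _ := GRing.Lalgebra_isAlgebra.Build k falg falg_scaleAr.

Definition letter (i : nat) : falg := mon [:: i].

Lemma wordv_letter w : wordv letter w = mon w.
Proof.
elim: w => [|i w IH] /=; last by rewrite IH mon_mul.
by rewrite /mon -fmoneE.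
Qed.

Lemma falg_words (a : falg) : span (fun z => exists w, z = wordv letter w) a.
Proof.
rewrite (falgE a); apply: span_sum => m; apply/spanZ/span_in; exists m.
by rewrite wordv_letter.
Qed.

Lemma mcoeff_word w u : (wordv letter w : {malg k[{fmonom nat}]})@_(FMonom u) = (w == u)%:R.
Proof. by rewrite wordv_letter mcoeffU1 fmP. Qed.

Section Evaluation.
Variables (M : lmodType k) (ws : seq (seq nat)) (f : seq nat -> M).
Hypothesis ws_uniq : uniq ws.

Definition feval (y : falg) : M := \sum_(w <- ws) y@_(FMonom w) *: f w.

Lemma feval_lin c x y : feval (c *: x + y) = c *: feval x + feval y.
Proof.
rewrite /feval scaler_sumr -big_split /=; apply: eq_bigr => w _.
by rewrite mcoeffD mcoeffZ scalerDl scalerA.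
Qed.

Lemma feval_word w : feval (wordv letter w) = if w \in ws then f w else 0.
Proof.
rewrite /feval; case: ifPn => [win|wnin].
  rewrite (bigD1_seq w) //= mcoeff_word eqxx scale1r big1 ?addr0 // => u ne.
  by rewrite mcoeff_word eq_sym (negbTE ne) scale0r.
rewrite big_seq big1 // => u uin; rewrite mcoeff_word.
by case: eqP uin wnin => [->->//|_ _ _]; rewrite scale0r.
Qed.

Lemma feval_lsum r : {in r, forall p, p.2 \in ws} -> feval (lsum (wordv letter) r) = lsum f r.
Proof.
elim: r => [|p r IH] rin.
  by rewrite /lsum !big_nil /feval big1 // => w _; rewrite mcoeff0 scale0r.
rewrite /lsum !big_cons feval_lin IH; last by move=> q qr; apply: rin; rewrite inE qr orbT.
by rewrite feval_word rin ?inE ?eqxx.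
Qed.

Lemma feval_lsum0 r : {in r, forall p, p.2 \notin ws} -> feval (lsum (wordv letter) r) = 0.
Proof.
elim: r => [|p r IH] rin.
  by rewrite /lsum !big_nil /feval big1 // => w _; rewrite mcoeff0 scale0r.
rewrite /lsum !big_cons feval_lin -/(lsum _ r) IH; last first.
  by move=> q qr; apply: rin; rewrite inE qr orbT.
by rewrite feval_word (negbTE (rin p _)) ?inE ?eqxx // scaler0 addr0.
Qed.

End Evaluation.

End FreeAlgebra.

(** * Coherence in symmetric monoidal categories *)

Local Open Scope cat_scope.

Section LinearCategory.
Context {k : fieldType} {C : linear_category k}.
Implicit Types (X Y Z : C).

Lemma compDl X Y Z (f : Mor X Y) (g g' : Mor Y Z) : (g + g') \c f = g \c f + g' \c f.
Proof. by have := comp_linear_l f 1 g g'; rewrite !scale1r. Qed.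
Lemma compDr X Y Z (g : Mor Y Z) (f f' : Mor X Y) : g \c (f + f') = g \c f + g \c f'.
Proof. by have := comp_linear_r g 1 f f'; rewrite !scale1r. Qed.
Lemma comp0f X Y Z (f : Mor X Y) : (0 : Mor Y Z) \c f = 0.
Proof. by apply: (addrI (0 \c f)); rewrite -compDl !addr0. Qed.
Lemma compf0 X Y Z (g : Mor Y Z) : g \c (0 : Mor X Y) = 0.
Proof. by apply: (addrI (g \c 0)); rewrite -compDr !addr0. Qed.
Lemma compZl X Y Z (f : Mor X Y) (g : Mor Y Z) a : (a *: g) \c f = a *: (g \c f).
Proof. by have := comp_linear_l f a g 0; rewrite comp0f !addr0. Qed.
Lemma compZr X Y Z (f : Mor X Y) (g : Mor Y Z) a : g \c (a *: f) = a *: (g \c f).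
Proof. by have := comp_linear_r g a f 0; rewrite compf0 !addr0. Qed.
Lemma compNl X Y Z (f : Mor X Y) (g : Mor Y Z) : (- g) \c f = - (g \c f).
Proof. by rewrite -scaleN1r compZl scaleN1r. Qed.
Lemma compNr X Y Z (f : Mor X Y) (g : Mor Y Z) : g \c (- f) = - (g \c f).
Proof. by rewrite -scaleN1r compZr scaleN1r. Qed.
Lemma compBl X Y Z (f : Mor X Y) (g g' : Mor Y Z) : (g - g') \c f = g \c f - g' \c f.
Proof. by rewrite compDl compNl. Qed.
Lemma compBr X Y Z (g : Mor Y Z) (f f' : Mor X Y) : g \c (f - f') = g \c f - g \c f'.
Proof. by rewrite compDr compNr. Qed.
Lemma comp_suml X Y Z I (r : seq I) (P : pred I) (f : Mor X Y) (g : I -> Mor Y Z) :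
  (\sum_(i <- r | P i) g i) \c f = \sum_(i <- r | P i) g i \c f.
Proof. by apply: (big_morph (fun g => g \c f)) => [g1 g2|]; rewrite ?compDl ?comp0f. Qed.
Lemma comp_sumr X Y Z I (r : seq I) (P : pred I) (f : I -> Mor X Y) (g : Mor Y Z) :
  g \c (\sum_(i <- r | P i) f i) = \sum_(i <- r | P i) g \c f i.
Proof. by apply: (big_morph (fun f => g \c f)) => [f1 f2|]; rewrite ?compDr ?compf0. Qed.

Lemma epi0 X Y (f : Mor X Y) :
  (forall T (g : Mor Y T), g \c f = 0 -> g = 0) -> epi f.
Proof.
by move=> f0 T g h e; apply/eqP; rewrite -subr_eq0; apply/eqP/f0; rewrite compBl e subrr.
Qed.

Lemma epi_comp X Y Z (f : Mor X Y) (g : Mor Y Z) : epi f -> epi g -> epi (g \c f).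
Proof. by move=> ef eg T h h'; rewrite !compA => /ef /eg. Qed.

Lemma iso_epi X Y (f : Mor X Y) : is_iso f -> epi f.
Proof.
move=> [g [_ fg]] T h h' /(congr1 (fun u => u \c g)).
by rewrite -!compA fg !comp_idr.
Qed.

Lemma iso_mono X Y (f : Mor X Y) : is_iso f -> mono f.
Proof.
move=> [g [gf _]] T h h' /(congr1 (fun u => g \c u)).
by rewrite !compA gf !comp_idl.
Qed.

End LinearCategory.

Section Monoidal.
Context {k : fieldType} {C : symTensorCategory k}.
Implicit Types (X Y Z V : C).
Local Notation "1_ X" := (idmor X) (at level 8, X at level 7, format "1_ X").

Lemma tensm_id X Y : 1_X \oxm 1_Y = idmor (X \ox Y).
Proof. exact: tensm0_id. Qed.
Lemma tensm_comp X X' X'' Y Y' Y'' (f' : Mor X' X'') (f : Mor X X') (g' : Mor Y' Y'')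
  (g : Mor Y Y') : (f' \c f) \oxm (g' \c g) = (f' \oxm g') \c (f \oxm g).
Proof. exact: tensm0_comp. Qed.
Lemma tensm_compl X X' X'' Y (f' : Mor X' X'') (f : Mor X X') :
  (f' \c f) \oxm 1_Y = (f' \oxm 1_Y) \c (f \oxm 1_Y).
Proof. by rewrite -tensm_comp comp_idl. Qed.
Lemma tensm_compr X X' X'' Y (f' : Mor X' X'') (f : Mor X X') :
  1_Y \oxm (f' \c f) = (1_Y \oxm f') \c (1_Y \oxm f).
Proof. by rewrite -tensm_comp comp_idl. Qed.
Lemma tensmE X X' Y Y' (f : Mor X X') (g : Mor Y Y') :
  f \oxm g = (f \oxm idmor _) \c (idmor _ \oxm g).
Proof. by rewrite -tensm_comp comp_idl comp_idr. Qed.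
Lemma tensmE' X X' Y Y' (f : Mor X X') (g : Mor Y Y') :
  f \oxm g = (idmor _ \oxm g) \c (f \oxm idmor _).
Proof. by rewrite -tensm_comp comp_idl comp_idr. Qed.
Lemma tensmDr X X' Y Y' (f : Mor X X') (g g' : Mor Y Y') : f \oxm (g + g') = f \oxm g + f \oxm g'.
Proof. by have := tensm0_linear_r (stc_mon C) f 1 g g'; rewrite !scale1r. Qed.
Lemma tensmDl X X' Y Y' (f f' : Mor X X') (g : Mor Y Y') : (f + f') \oxm g = f \oxm g + f' \oxm g.
Proof. by have := tensm0_linear_l (stc_mon C) g 1 f f'; rewrite !scale1r. Qed.
Lemma tensmr0 X X' Y Y' (f : Mor X X') : f \oxm (0 : Mor Y Y') = 0.
Proof. by apply: (addrI (f \oxm 0)); rewrite -tensmDr !addr0. Qed.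
Lemma tensm0l X X' Y Y' (g : Mor Y Y') : (0 : Mor X X') \oxm g = 0.
Proof. by apply: (addrI (0 \oxm g)); rewrite -tensmDl !addr0. Qed.
Lemma tensmZr X X' Y Y' (f : Mor X X') (g : Mor Y Y') a : f \oxm (a *: g) = a *: (f \oxm g).
Proof.
by have := tensm0_linear_r (stc_mon C) f a g 0; rewrite !addr0 -/(tensm _ 0) tensmr0 addr0.
Qed.
Lemma tensmZl X X' Y Y' (f : Mor X X') (g : Mor Y Y') a : (a *: f) \oxm g = a *: (f \oxm g).
Proof.
by have := tensm0_linear_l (stc_mon C) g a f 0; rewrite !addr0 -/(tensm 0 _) tensm0l addr0.
Qed.
Lemma tensm_sumr X X' Y Y' I (r : seq I) (P : pred I) (f : Mor X X') (g : I -> Mor Y Y') :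
  f \oxm (\sum_(i <- r | P i) g i) = \sum_(i <- r | P i) f \oxm g i.
Proof. by apply: (big_morph (tensm f)) => [g1 g2|]; rewrite ?tensmDr ?tensmr0. Qed.

Lemma assoc_nat X X' Y Y' Z Z' (f : Mor X X') (g : Mor Y Y') (h : Mor Z Z') :
  assoc X' Y' Z' \c (f \oxm g \oxm h) = (f \oxm (g \oxm h)) \c assoc X Y Z.
Proof. exact: assoc0_nat. Qed.
Lemma assoc_invK X Y Z : assoc X Y Z \c assoc_inv X Y Z = idmor _.
Proof. by rewrite /assoc_inv; case: cid => g []. Qed.
Lemma assocK X Y Z : assoc_inv X Y Z \c assoc X Y Z = idmor _.
Proof. by rewrite /assoc_inv; case: cid => g []. Qed.
Lemma assoc_iso X Y Z : is_iso (assoc X Y Z).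
Proof. exact: assoc0_iso. Qed.
Lemma symm_nat X X' Y Y' (f : Mor X X') (g : Mor Y Y') :
  symm X' Y' \c (f \oxm g) = (g \oxm f) \c symm X Y.
Proof. exact: symm0_nat. Qed.
Lemma symmK X Y : symm Y X \c symm X Y = idmor (X \ox Y).
Proof. exact: symm0K. Qed.
Lemma symm_iso X Y : is_iso (symm X Y).
Proof. by exists (symm Y X); split; rewrite symmK. Qed.
Lemma lunit_nat X X' (f : Mor X X') : lunit X' \c (1_tunit \oxm f) = f \c lunit X.
Proof. exact: lunit0_nat. Qed.
Lemma runit_nat X X' (f : Mor X X') : runit X' \c (f \oxm 1_tunit) = f \c runit X.
Proof. exact: runit0_nat. Qed.
Lemma lunit_iso X : is_iso (lunit X). Proof. exact: lunit0_iso. Qed.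
Lemma runit_iso X : is_iso (runit X). Proof. exact: runit0_iso. Qed.
Lemma pentagon X Y Z W :
  (1_W \oxm assoc X Y Z) \c assoc W (X \ox Y) Z \c (assoc W X Y \oxm 1_Z)
  = assoc W X (Y \ox Z) \c assoc (W \ox X) Y Z.
Proof. exact: pentagon0. Qed.
Lemma triangle X Y : (1_X \oxm lunit Y) \c assoc X tunit Y = runit X \oxm 1_Y.
Proof. exact: triangle0. Qed.
Lemma hexagon X Y Z :
  assoc Y Z X \c symm X (Y \ox Z) \c assoc X Y Z
  = (1_Y \oxm symm X Z) \c assoc Y X Z \c (symm X Y \oxm 1_Z).
Proof. exact: hexagon0. Qed.

Lemma iso_tens X X' Y Y' (f : Mor X X') (g : Mor Y Y') : is_iso f -> is_iso g -> is_iso (f \oxm g).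
Proof.
move=> [f' [ff' f'f]] [g' [gg' g'g]]; exists (f' \oxm g').
by split; rewrite -tensm_comp ?ff' ?gg' ?f'f ?g'g tensm_id.
Qed.
Lemma iso_id X : is_iso (1_X).
Proof. by exists (1_X); split; rewrite comp_idl. Qed.
Lemma iso_comp X Y Z (g : Mor Y Z) (f : Mor X Y) : is_iso f -> is_iso g -> is_iso (g \c f).
Proof.
move=> [f' [ff' f'f]] [g' [gg' g'g]]; exists (f' \c g'); split.
  by rewrite -compA (compA g') gg' comp_idl.
by rewrite -compA (compA f) f'f comp_idl.
Qed.

Lemma tunit_tens_inj X Y (f g : Mor X Y) : 1_tunit \oxm f = 1_tunit \oxm g -> f = g.
Proof.
by move=> e; apply: (iso_epi (lunit_iso X)); rewrite -!lunit_nat e.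
Qed.
Lemma tens_tunit_inj X Y (f g : Mor X Y) : f \oxm 1_tunit = g \oxm 1_tunit -> f = g.
Proof.
by move=> e; apply: (iso_epi (runit_iso X)); rewrite -!runit_nat e.
Qed.

(** Kelly's unit law: after tensoring with the unit, which is faithful, it follows from the pentagon
    and two triangles. *)
Lemma lunit_tens X Y : lunit (X \ox Y) \c assoc tunit X Y = lunit X \oxm 1_Y.
Proof.
apply: tunit_tens_inj; rewrite tensm_compr.
apply: (iso_epi (f := assoc tunit (tunit \ox X) Y \c (assoc tunit tunit X \oxm 1_Y))).
  by apply: iso_comp; [apply: iso_tens; [exact: assoc_iso|exact: iso_id]|exact: assoc_iso].
rewrite -(compA (1_tunit \oxm lunit _)) compA !compA -(compA (1_tunit \oxm lunit _)).
rewrite -(compA (1_tunit \oxm lunit _)) pentagon compA triangle -assoc_nat.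
rewrite -(tensm_id X Y) -assoc_nat -compA -tensm_compl triangle //.
Qed.

Lemma runit_tens X Y : runit (X \ox Y) = (1_X \oxm runit Y) \c assoc X Y tunit.
Proof.
apply: tens_tunit_inj; apply: (iso_mono (assoc_iso X Y tunit)).
rewrite tensm_compl compA assoc_nat -(triangle Y) tensm_compr.
rewrite -!compA (compA (1_X \oxm assoc _ _ _)) pentagon compA -assoc_nat tensm_id -compA triangle //.
Qed.

Lemma lunit_symm X : lunit X \c symm X tunit = runit X.
Proof.
apply: tens_tunit_inj; apply: (iso_mono (symm_iso X tunit)).
have /(congr1 (fun u => lunit _ \c u)) := hexagon X tunit tunit.
rewrite !compA lunit_tens lunit_nat -symm_nat -(compA (symm X tunit)) triangle.
by rewrite -(compA (symm X tunit)) lunit_tens -compA -tensm_compl => ->.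
Qed.

Lemma runit_symm X : runit X \c symm tunit X = lunit X.
Proof. by rewrite -lunit_symm -compA symmK comp_idr. Qed.

End Monoidal.

(** * Adjacent symmetries and permutation words *)

Section Braids.
Context {k : fieldType} {C : symTensorCategory k}.
Variable V : C.
Implicit Types (X Y Z : C).
Local Notation "1_ X" := (idmor X) (at level 8, X at level 7, format "1_ X").
Local Notation T := (tpow V).

Lemma assoc_inv_nat X X' Y Y' Z Z' (f : Mor X X') (g : Mor Y Y') (h : Mor Z Z') :
  assoc_inv X' Y' Z' \c (f \oxm (g \oxm h)) = (f \oxm g \oxm h) \c assoc_inv X Y Z.
Proof.
apply: (iso_mono (assoc_iso X' Y' Z')); rewrite !compA assoc_invK comp_idl assoc_nat.
by rewrite -compA assoc_invK comp_idr.
Qed.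

Lemma braid0_nat n (f : Mor (T n) (T n)) :
  braid V n.+2 0 \c (1_V \oxm (1_V \oxm f)) = (1_V \oxm (1_V \oxm f)) \c braid V n.+2 0.
Proof.
rewrite /= -compA assoc_inv_nat compA -(compA _ (_ \oxm _) (_ \oxm _)) -tensm_comp.
rewrite comp_idl tensm_id comp_idr tensmE' compA -(tensm_id V V) assoc_nat.
by rewrite !compA.
Qed.

Lemma braid_invol n i : braid V n i \c braid V n i = idmor (T n).
Proof.
elim: n i => [|n IH] [|i] /=; rewrite ?comp_idl //; last by rewrite -tensm_compr IH tensm_id.
case: n {IH} => [|n]; first by rewrite comp_idl.
rewrite -!compA (compA (assoc_inv _ _ _)) assocK comp_idl (compA (_ \oxm _)) -tensm_compl.
by rewrite symmK tensm_id comp_idl assoc_invK.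
Qed.

Lemma braid_far n i j : (i.+2 <= j)%N -> braid V n i \c braid V n j = braid V n j \c braid V n i.
Proof.
elim: i n j => [|i IH] [|n] [|j] //= le; rewrite ?comp_idl ?comp_idr //; last first.
  by rewrite -!tensm_compr IH.
case: n => [|n]; first by rewrite comp_idl comp_idr.
case: j le => // j _; exact: braid0_nat.
Qed.

(** Regroups three factors, so that the braid relation on V (x) (V (x) V) carries over to all tensor
    powers. *)
Let kappa Y : Mor ((V \ox (V \ox V)) \ox Y) (V \ox (V \ox (V \ox Y))) :=
  (1_V \oxm assoc V V Y) \c assoc V (V \ox V) Y.

Let s1 : Mor (V \ox (V \ox V)) (V \ox (V \ox V)) :=
  assoc V V V \c (symm V V \oxm 1_V) \c assoc_inv V V V.
Let s2 : Mor (V \ox (V \ox V)) (V \ox (V \ox V)) := 1_V \oxm symm V V.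

(** By the hexagon, [s2 \c s1] moves one factor past two. Naturality of this symmetry with respect
    to [symm V V] is the braid relation. *)
Let yang_baxter3 : s1 \c s2 \c s1 = s2 \c s1 \c s2.
Proof.
have h : assoc V V V \c symm V (V \ox V) = s2 \c s1.
  apply: (iso_epi (assoc_iso V V V)); rewrite hexagon /s1 -!compA assocK comp_idr.
  by rewrite /s2 !compA.
transitivity (assoc V V V \c (symm V V \oxm 1_V) \c symm V (V \ox V)).
  by rewrite -compA -h compA /s1 -(compA _ (assoc_inv _ _ _)) assocK comp_idr.
by rewrite -h -[RHS]compA /s2 symm_nat compA.
Qed.

Let braid1_kappa n : braid V n.+3 1 \c kappa (T n) = kappa (T n) \c (s2 \oxm 1_(T n)).
Proof.
rewrite /= /kappa compA -tensm_compr -[_ \c _ \c assoc V V _]compA -compA assocK comp_idr.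
by rewrite tensm_compr -!compA -assoc_nat.
Qed.

Let braid0_kappa n : braid V n.+3 0 \c kappa (T n) = kappa (T n) \c (s1 \oxm 1_(T n)).
Proof.
apply: (iso_epi (f := assoc V V V \oxm 1_(T n))).
  by apply: iso_tens; [exact: assoc_iso|exact: iso_id].
have kP : kappa (T n) \c (assoc V V V \oxm 1_(T n)) = assoc _ _ _ \c assoc _ _ _.
  exact: pentagon.
rewrite -[LHS]compA kP -[RHS]compA -tensm_compl /s1 -[_ \c _ \c assoc V V V]compA assocK.
rewrite comp_idr tensm_compl [RHS]compA kP /= -[LHS]compA (compA (assoc_inv _ _ _)) assocK.
by rewrite comp_idl -[LHS]compA -[RHS]compA assoc_nat tensm_id.
Qed.

Lemma yang_baxter_transport X Y (f : Mor X Y) (t1 t2 : Mor X X) (b1 b2 : Mor Y Y) :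
  epi f -> b1 \c f = f \c t1 -> b2 \c f = f \c t2 ->
  t1 \c t2 \c t1 = t2 \c t1 \c t2 -> b1 \c b2 \c b1 = b2 \c b1 \c b2.
Proof.
move=> ef e1 e2 yb; apply: ef; rewrite -!compA e1 e2 !compA -(compA b1) e2 -(compA b2) e1.
by rewrite !compA e1 e2 -!compA (compA t1) yb !compA.
Qed.

Lemma braid_yb n i : (i.+2 < n)%N ->
  braid V n i \c braid V n i.+1 \c braid V n i = braid V n i.+1 \c braid V n i \c braid V n i.+1.
Proof.
elim: i n => [|i IH] [|n] // lt; last by rewrite /= -!tensm_compr IH.
case: n lt => [|[|n]] // _.
apply: (yang_baxter_transport (f := kappa (T n)) _ (braid0_kappa n) (braid1_kappa n)).
  apply/iso_epi/iso_comp; first exact: assoc_iso.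
  by apply: iso_tens; [exact: iso_id|exact: assoc_iso].
by rewrite -!tensm_compl yang_baxter3.
Qed.

(* Moves the factor in position [j] to the front. *)
Fixpoint front n (j : nat) : Mor (T n) (T n) :=
  if j is j'.+1 then front n j' \c braid V n j' else 1_(T n).

Lemma frontE n j : front n j.+1 = front n j \c braid V n j.
Proof. by []. Qed.

Lemma frontS n j : front n.+2 j.+1 = braid V n.+2 0 \c (1_V \oxm front n.+1 j).
Proof.
elim: j => [|j IH]; first by rewrite /= comp_idl tensm_id comp_idr.
rewrite [LHS]/= -/(front n.+2 j.+1) IH -compA; congr (_ \c _).
by rewrite [front _ j.+1]/= tensm_compr.
Qed.

Lemma front_far n i j : (j <= i)%N -> front n j \c braid V n i.+1 = braid V n i.+1 \c front n j.
Proof.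
elim: j => [|j IH] le /=; first by rewrite comp_idl comp_idr.
by rewrite -compA braid_far // compA IH ?compA // ltnW.
Qed.

Lemma front_braid n i j : (i.+1 < j)%N -> (j < n)%N ->
  front n j \c braid V n i = braid V n i.+1 \c front n j.
Proof.
elim: j => // j IH; rewrite ltnS leq_eqVlt => /predU1P[<-|lt] ltn.
  by rewrite /= -!compA (compA (braid V n i)) braid_yb // !compA front_far.
by rewrite /= -compA -braid_far // !compA IH // ltnW.
Qed.

(** Both sides put the factor y first and x second: as x < y, moving x to the front leaves y in
    place, while moving y to the front leaves x at index x of the tail. *)
Lemma front_front n x y : (x < y)%N -> (y < n.+1)%N ->
  front n.+1 y \c front n.+1 x = (1_V \oxm front n x) \c front n.+1 y.
Proof.
elim: x => [|x IH] lt1 lt2; first by rewrite /= tensm_id comp_idl comp_idr.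
by rewrite !frontE compA IH ?(ltnW lt1) // -compA (front_braid lt1 lt2) compA -tensm_compr.
Qed.

Lemma braidS n i : braid V n.+1 i.+1 = 1_V \oxm braid V n i.
Proof. by []. Qed.

(* Puts the factor in position [w_i] in position [i]. *)
Fixpoint permw n (w : seq nat) : Mor (T n) (T n) :=
  match n return Mor (T n) (T n) with
  | 0 => 1_(T 0)
  | m.+1 => if w is x :: w' then (1_V \oxm permw m (map (unbump x) w')) \c front m.+1 x
            else 1_(T m.+1)
  end.

Fixpoint swp (i : nat) (w : seq nat) : seq nat :=
  match i, w with
  | 0, x :: y :: w' => y :: x :: w'
  | i'.+1, x :: w' => x :: swp i' w'
  | _, _ => w
  end.

Lemma swp_perm i w : perm_eq (swp i w) w.
Proof.
elim: w i => [|x w IH] [|i] //=; last by rewrite perm_cons.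
by case: w {IH} => // y w; exact: (permEl (perm_catCA [:: y] [:: x] w)).
Qed.

Lemma map_swp f i w : map f (swp i w) = swp i (map f w).
Proof. by elim: w i => [|x w IH] [|i] //=; [case: w {IH}|rewrite IH]. Qed.

Definition isperm n w := perm_eq w (iota 0 n).

Lemma isperm_uniq n w : isperm n w -> uniq w.
Proof. by move=> /perm_uniq ->; apply: iota_uniq. Qed.

Lemma isperm_mem n w : isperm n w -> w =i gtn n.
Proof. by move=> /perm_mem e x; rewrite e mem_iota. Qed.

Lemma isperm_size n w : isperm n w -> size w = n.
Proof. by move=> /perm_size ->; rewrite size_iota. Qed.

Lemma isperm_unbump n x w : isperm n.+1 (x :: w) -> isperm n (map (unbump x) w).
Proof.
move=> pw; have /= /andP[xw uw] := isperm_uniq pw; have mw := isperm_mem pw.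
apply: uniq_perm; rewrite ?iota_uniq //.
  rewrite map_inj_in_uniq // => y z yw zw; rewrite /unbump => e.
  have yx : y != x by apply: contraNneq xw => <-.
  have zx : z != x by apply: contraNneq xw => <-.
  by move: e yx zx; case: (ltngtP x y); case: (ltngtP x z); lia.
have lx : (x < n.+1)%N by have := mw x; rewrite inE eqxx.
move=> y; rewrite mem_iota /= add0n; apply/mapP/idP => [[z zw ->]|ly].
  have : (z < n.+1)%N by have := mw z; rewrite inE zw orbT => /esym.
  have : z != x by apply: contraNneq xw => <-.
  by rewrite /unbump; lia.
exists (bump x y); last by rewrite bumpK.
have := mw (bump x y); rewrite !inE eq_sym (negbTE (neq_bump _ _)) /= => ->.
by rewrite /bump; lia.
Qed.

(** Only the exchange of the first two entries has content: for increasing entries it is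
    [front_front], and the other order follows because [braid] is an involution. *)
Lemma permw_swp n i w : isperm n w -> (i.+1 < n)%N -> permw n (swp i w) = braid V n i \c permw n w.
Proof.
elim: n i w => // n IH [|i] [|x w] pw lt.
- by have := isperm_size pw.
- case: w pw => [|y w] pw; first by have := isperm_size pw => /= - [e]; rewrite -e in lt.
  case: n {IH lt} pw => [|n] pw; first by have := isperm_size pw.
  have /= uw := isperm_uniq pw; have mw := isperm_mem pw.
  have xy : x != y by move: uw; rewrite inE negb_or => /and3P[/andP[]].
  have ly : (y < n.+2)%N by have := mw y; rewrite !inE eqxx orbT.
  have lx : (x < n.+2)%N by have := mw x; rewrite !inE eqxx.
  have H x' y' : (x' < y')%N -> (y' < n.+2)%N ->
      permw n.+2 (y' :: x' :: w) = braid V n.+2 0 \c permw n.+2 (x' :: y' :: w).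
    move=> lt1 lt2; rewrite [permw _ _]/= [permw _ (x' :: _)]/=.
    have -> : unbump y' x' = x' by rewrite /unbump; lia.
    have -> : unbump x' y' = y'.-1 by rewrite /unbump; lia.
    rewrite -!map_comp.
    have -> : map (unbump x' \o unbump y') w = map (unbump y'.-1 \o unbump x') w.
      by apply: eq_map => z /=; rewrite /unbump; lia.
    case: y' lt1 lt2 => // y' lt1 lt2; rewrite succnK.
    move: (permw _ _) => w2; rewrite !tensm_compr -[LHS]compA.
    rewrite -(front_front (n := n.+1) lt1 lt2) frontS.
    rewrite [LHS]compA (compA _ (braid V n.+2 0)) -braid0_nat [RHS]compA.
    by rewrite [in RHS](compA _ (1_V \oxm (1_V \oxm w2))).
  case: (ltngtP x y) xy => // lt _; first exact: H.
  rewrite -[LHS]/(permw n.+2 [:: y, x & w]) -[RHS]/(braid V n.+2 0 \c permw n.+2 [:: x, y & w]).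
  by rewrite (H y x) // (compA (braid V n.+2 0)) braid_invol comp_idl.
- by have := isperm_size pw.
rewrite /= map_swp IH ?braidS ?tensm_compr ?compA //; exact: isperm_unbump.
Qed.

Lemma permw_iota n : permw n (iota 0 n) = idmor (T n).
Proof.
elim: n => //= n IH; rewrite comp_idr (_ : map _ _ = iota 0 n) ?IH ?tensm_id //.
rewrite -[1%N]/(1 + 0)%N iotaDl -map_comp -[RHS]map_id; apply: eq_map => x /=.
by rewrite /unbump; lia.
Qed.

End Braids.

Lemma ltn_adj n (i : 'I_n.-1) : (i.+1 < n)%N.
Proof. by case: n i => [|m] i; [case: i|rewrite ltnS]. Qed.

Lemma val_adj_tperm n (i : 'I_n.-1) (j : 'I_n) : adj_tperm i j =
  (if j == i :> nat then i.+1 else if j == i.+1 :> nat then val i else j) :> nat.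
Proof.
case: n i j => [|m] i j; first by case: i.
rewrite /adj_tperm; case: tpermP => [->|->|]; rewrite /= ?/bump ?eqxx ?leq0n ?add1n //=.
  by case: eqP => // /eqP; rewrite eqn_leq ltnn.
move=> /eqP ne1 /eqP ne2; rewrite -val_eqE in ne1; rewrite -val_eqE /= /bump add1n in ne2.
by rewrite (negbTE ne1) (negbTE ne2).
Qed.

(** * One-line notation of permutations *)

Section PermutationWords.
Variable n : nat.
Implicit Types (s t : 'S_n) (w u : seq nat).

Definition wordp s : seq nat := [seq val (s j) | j <- enum 'I_n].

Lemma size_wordp s : size (wordp s) = n.
Proof. by rewrite size_map size_enum_ord. Qed.

Lemma nth_wordp s (j : 'I_n) : nth 0%N (wordp s) j = s j.
Proof. by rewrite (nth_map j) ?size_enum_ord // nth_ord_enum. Qed.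

Lemma eq_wordP w u : size w = n -> size u = n ->
  (forall j : 'I_n, nth 0%N w j = nth 0%N u j) -> w = u.
Proof.
move=> sw su e; apply: (@eq_from_nth _ 0%N); rewrite ?sw // => j lt.
exact: (e (Ordinal lt)).
Qed.

Lemma wordpM s t : wordp (s * t)%g = map (nth 0%N (wordp t)) (wordp s).
Proof.
apply: eq_wordP => [||j]; [exact: size_wordp|by rewrite size_map size_wordp|].
by rewrite nth_wordp permM (nth_map 0%N) ?size_wordp // !nth_wordp.
Qed.

Lemma isperm_wordp s : isperm n (wordp s).
Proof.
apply: uniq_perm; rewrite ?iota_uniq //.
  by rewrite map_inj_uniq ?enum_uniq // => i j /val_inj /perm_inj.
move=> x; rewrite mem_iota add0n; apply/mapP/idP => [[j _ ->]|lt]; first exact: ltn_ord.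
by exists ((s^-1)%g (Ordinal lt)); rewrite ?mem_enum // permKV.
Qed.

Lemma wordp1 : wordp 1%g = iota 0 n.
Proof.
rewrite -val_enum_ord; apply: eq_map => j; rewrite perm1 //.
Qed.

Lemma wordp_surj w : isperm n w -> exists s, wordp s = w.
Proof.
move=> pw; have sw := isperm_size pw.
have lt (j : 'I_n) : (nth 0%N w j < n)%N.
  by have := isperm_mem pw (nth 0%N w j); rewrite mem_nth ?sw // => /esym.
have inj : injective (fun j => Ordinal (lt j)).
  move=> i j /(congr1 val) /= /eqP; rewrite nth_uniq ?sw ?(isperm_uniq pw) //.
  by move=> /eqP /val_inj.
exists (perm inj); apply: eq_wordP => // [|j]; first exact: size_wordp.
by rewrite nth_wordp permE.
Qed.

Lemma size_swp i w : size (swp i w) = size w.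
Proof. by have /perm_size := swp_perm i w. Qed.

Lemma nth_swp i j w : (i.+1 < size w)%N ->
  nth 0%N (swp i w) j = nth 0%N w (if j == i then i.+1 else if j == i.+1 then i else j).
Proof.
elim: w i j => [|x w IH] [|i] [|j] //= lt; first by case: w lt {IH}.
  by case: w lt {IH} => [|y w] //; case: j.
by rewrite IH // ?eqSS; case: (j == i) => //; case: (j == i.+1).
Qed.

Lemma wordp_adj (i : 'I_n.-1) s : wordp (adj_tperm i * s)%g = swp i (wordp s).
Proof.
have lt := ltn_adj i.
apply: eq_wordP => [||j]; rewrite ?size_swp ?size_wordp //.
by rewrite nth_wordp permM nth_swp ?size_wordp // -nth_wordp val_adj_tperm.
Qed.

Lemma isperm_ind (P : seq nat -> Prop) : P (iota 0 n) ->
  (forall i w, isperm n w -> (i.+1 < n)%N -> P w -> P (swp i w)) ->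
  forall w, isperm n w -> P w.
Proof.
move=> P0 PS w /wordp_surj[s <-]; have [ts ->] := adj_tperm_gen s.
elim: ts => [|i ts IH]; first by rewrite big_nil wordp1.
rewrite big_cons wordp_adj; apply: PS => //; first exact: isperm_wordp.
exact: ltn_adj.
Qed.

Lemma isperm_map_nth w u : isperm n w -> isperm n u -> isperm n (map (nth 0%N u) w).
Proof.
by move=> /wordp_surj[s <-] /wordp_surj[t <-]; rewrite -wordpM; apply: isperm_wordp.
Qed.

Lemma isperm_swp i w : isperm n w -> isperm n (swp i w).
Proof. by move=> pw; apply: perm_trans pw; apply: swp_perm. Qed.

Lemma isperm_iota : isperm n (iota 0 n).
Proof. exact: perm_refl. Qed.

End PermutationWords.

(** * The action of the symmetric group and concatenation *)

Section Coherence.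
Context {k : fieldType} {C : symTensorCategory k}.
Variable V : C.
Implicit Types (X Y Z : C).
Local Notation "1_ X" := (idmor X) (at level 8, X at level 7, format "1_ X").
Local Notation T := (tpow V).

Lemma permw_comp n w u : isperm n w -> isperm n u ->
  permw V n (map (nth 0%N u) w) = permw V n w \c permw V n u.
Proof.
move=> pw pu; elim/isperm_ind: w / pw => [|i w pw lt IH].
  have -> : map (nth 0%N u) (iota 0 n) = u by rewrite -(isperm_size pu) map_nth_iota0 // take_size.
  by rewrite permw_iota comp_idl.
by rewrite map_swp !permw_swp ?IH ?compA //; apply: isperm_map_nth.
Qed.

(** [permw] lists the factor that each position receives, whereas [tensor_perm V s] sends factor j
    to position [s j]; hence the inverse. The right-hand side does not involve the chosen
    decomposition of s, which is the coherence statement. *)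
Lemma tensor_permE n (s : 'S_n) : tensor_perm V s = permw V n (wordp s^-1).
Proof.
rewrite /tensor_perm; case: cid => w /= -> {s}.
elim/last_ind: w => [|w i IH]; first by rewrite big_nil invg1 wordp1 permw_iota.
rewrite -cats1 foldl_cat IH big_cat big_seq1 invMg /= -[X in _ = permw _ _ (wordp X)]/(_ * _)%g.
have -> : ((adj_tperm i)^-1 = adj_tperm i)%g.
  by case: (n) i => [|m] i; [case: i|rewrite tpermV].
rewrite wordp_adj permw_swp //; first exact: isperm_wordp.
exact: ltn_adj.
Qed.

Lemma tensor_permM n (s t : 'S_n) : tensor_perm V (s * t)%g = tensor_perm V t \c tensor_perm V s.
Proof.
rewrite !tensor_permE invMg wordpM permw_comp //; exact: isperm_wordp.
Qed.

Lemma tensor_perm1 n : tensor_perm V (1%g : 'S_n) = idmor (T n).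
Proof. by rewrite tensor_permE invg1 wordp1 permw_iota. Qed.

Lemma concat_iso a b : is_iso (concat V a b).
Proof.
elim: a => [|a IH] /=; first exact: lunit_iso.
by apply: iso_comp; [exact: assoc_iso|apply: iso_tens; [exact: iso_id|]].
Qed.

Lemma braid_concatr a b i :
  braid V (a + b) (a + i) \c concat V a b = concat V a b \c (1_(T a) \oxm braid V b i).
Proof.
elim: a => [|a IH]; first by rewrite /= lunit_nat.
rewrite -[braid V _ _]/(1_V \oxm braid V (a + b) (a + i)) [concat _ _ _]/= [LHS]compA.
rewrite -tensm_compr IH tensm_compr.
by rewrite -[LHS]compA -[RHS]compA -assoc_nat tensm_id.
Qed.

Lemma concat2_assoc p b : concat V p.+2 b \c (assoc V V (T p) \oxm 1_(T b)) =
  assoc V V (T (p + b)) \c (1_(V \ox V) \oxm concat V p b) \c assoc (V \ox V) (T p) (T b).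
Proof.
rewrite [concat V p.+2 b]/= tensm_compr -tensm_id assoc_nat -[RHS]compA -pentagon.
by rewrite !compA.
Qed.

Lemma braid_concatl a b i : (i.+1 < a)%N ->
  braid V (a + b) i \c concat V a b = concat V a b \c (braid V a i \oxm 1_(T b)).
Proof.
elim: i a => [|i IH] [|a] // lt; last first.
  rewrite -[braid V (_ + _) _]/(1_V \oxm braid V (a + b) i) -[braid V a.+1 _]/(1_V \oxm braid V a i).
  rewrite [concat _ _ _]/= [LHS]compA -tensm_compr IH // tensm_compr.
  by rewrite -[LHS]compA -[RHS]compA assoc_nat.
case: a lt => // p _.
apply: (iso_epi (f := assoc V V (T p) \oxm 1_(T b))).
  by apply: iso_tens; [exact: assoc_iso|exact: iso_id].
rewrite -[LHS]compA -[RHS]compA concat2_assoc -tensm_compl.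
have -> : braid V p.+2 0 \c assoc V V (T p) = assoc V V (T p) \c (symm V V \oxm 1_(T p)).
  by rewrite /= -compA assocK comp_idr.
rewrite tensm_compl.
rewrite [RHS]compA concat2_assoc -[RHS]compA assoc_nat /=.
set s := symm V V; set c := concat V p b; set A := assoc V V (T (p + b)).
have -> : A \c (s \oxm 1_(T (p + b))) \c assoc_inv V V (T (p + b)) \c
    (A \c (1_(V \ox V) \oxm c) \c assoc (V \ox V) (T p) (T b)) =
    A \c ((s \oxm 1_(T (p + b))) \c (1_(V \ox V) \oxm c)) \c assoc (V \ox V) (T p) (T b).
  by rewrite -!compA (compA (assoc_inv _ _ _)) assocK comp_idl.
by rewrite -tensmE tensmE' tensm_id !compA.
Qed.

End Coherence.

(** * The symmetry of two tensor powers as a block permutation *)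

Section BlockSwap.
Context {k : fieldType} {C : symTensorCategory k}.
Variable V : C.
Implicit Types (X Y Z : C).
Local Notation "1_ X" := (idmor X) (at level 8, X at level 7, format "1_ X").
Local Notation T := (tpow V).

Lemma lunit_runit_tunit : lunit (tunit : C) = runit tunit.
Proof.
apply: tens_tunit_inj; rewrite -triangle -lunit_tens; congr (_ \c _).
by apply: (iso_mono (lunit_iso (tunit : C))); rewrite lunit_nat.
Qed.

(** The hexagon for a product in the first argument, obtained by inverting all symmetries. *)
Lemma symm_tensl X Y Z : symm (Y \ox Z) X =
  assoc X Y Z \c (symm Y X \oxm 1_Z) \c assoc_inv Y X Z \c (1_Y \oxm symm Z X) \c assoc Y Z X.
Proof.
apply: (iso_epi (f := symm X (Y \ox Z) \c assoc X Y Z)).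
  by apply: iso_comp; [exact: assoc_iso|exact: symm_iso].
rewrite compA symmK comp_idl -[RHS]compA (compA (assoc Y Z X)) hexagon.
rewrite -!compA (compA (1_Y \oxm symm Z X)) -tensm_compr symmK tensm_id comp_idl.
by rewrite (compA (assoc_inv _ _ _)) assocK comp_idl -tensm_compl symmK tensm_id comp_idr.
Qed.

(** Degrees such as a + b and b + a are equal but not convertible; tensor powers are transported
    along the equality. *)
Definition tcast m n (e : m = n) : Mor (T m) (T n) :=
  match e in _ = n return Mor (T m) (T n) with erefl => 1_(T m) end.

Lemma tcast_id n (e : n = n) : tcast e = 1_(T n).
Proof. by rewrite (eq_irrelevance e erefl). Qed.

Lemma tcast_comp m n p (e : m = n) (e' : n = p) (e'' : m = p) : tcast e' \c tcast e = tcast e''.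
Proof. by subst n p; rewrite !tcast_id comp_idl. Qed.

Lemma tcastS m n (e : m = n) (e' : m.+1 = n.+1) : 1_V \oxm tcast e = tcast e'.
Proof. by subst n; rewrite !tcast_id tensm_id. Qed.

Lemma tcast_permw m n (e : m = n) w : permw V n w \c tcast e = tcast e \c permw V m w.
Proof. by subst n; rewrite tcast_id comp_idl comp_idr. Qed.

Lemma concat_runit a (e : a = (a + 0)%N) : concat V a 0 = tcast e \c runit (T a).
Proof.
elim: a e => [|a IH] e; first by rewrite tcast_id comp_idl /= lunit_runit_tunit.
have e' : a = (a + 0)%N by rewrite addn0.
by rewrite [LHS]/= (IH e') tensm_compr (tcastS e' e) -[LHS]compA -runit_tens.
Qed.

(** Tensor powers grow on the left; this isomorphism attaches a factor at the right end without
    changing the order. *)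
Fixpoint snoc (a : nat) : Mor (T a \ox V) (T a.+1) :=
  match a return Mor (T a \ox V) (T a.+1) with
  | 0 => symm tunit V
  | a'.+1 => (1_V \oxm snoc a') \c assoc V (T a') V
  end.

Lemma symm_snoc a : symm (T a) V = front V a.+1 a \c snoc a.
Proof.
elim: a => [|a IH]; first by rewrite comp_idl.
by rewrite [LHS]symm_tensl frontS IH tensm_compr /= -!compA.
Qed.

Lemma snoc_assoc a b (e : (a + b.+1)%N = (a.+1 + b)%N) :
  concat V a.+1 b \c (snoc a \oxm 1_(T b)) = tcast e \c concat V a b.+1 \c assoc (T a) V (T b).
Proof.
elim: a e => [|a IH] e.
  rewrite tcast_id comp_idl /= triangle -tensm_compl runit_symm -lunit_tens //.
have e' : (a + b.+1)%N = (a.+1 + b)%N by rewrite addnS.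
have concatS x y : concat V x.+1 y = (1_V \oxm concat V x y) \c assoc V (T x) (T y) by [].
rewrite (concatS a.+1) (concatS a b.+1); have {IH} := IH e'.
move: (concat V a.+1 b) (concat V a b.+1) => c c' IH.
rewrite [snoc a.+1]/= tensm_compl [LHS]compA -(compA (1_V \oxm c)) assoc_nat compA.
rewrite -tensm_compr IH !tensm_compr (tcastS e' e) -!compA; do 2!congr (_ \c _).
by rewrite compA pentagon.
Qed.

Lemma concat_frontl a b j : (j < a)%N ->
  concat V a b \c (front V a j \oxm 1_(T b)) = front V (a + b) j \c concat V a b.
Proof.
elim: j => [|j IH] lt; first by rewrite /= tensm_id comp_idl comp_idr.
rewrite !frontE tensm_compl compA IH 1?ltnW // -[LHS]compA -[RHS]compA.
by rewrite braid_concatl.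
Qed.

Definition blockw a b := iota a b ++ iota 0 a.

Lemma isperm_blockw a b : isperm (a + b) (blockw a b).
Proof. by rewrite /isperm /blockw iotaD perm_catC. Qed.

Lemma blockwS a b : blockw a b.+1 = a :: map (bump a) (blockw a b).
Proof.
rewrite /blockw map_cat /=; congr (_ :: _ ++ _).
  rewrite -add1n iotaDl; apply/eq_in_map => x; rewrite mem_iota /bump => /andP[-> _] //.
rewrite -[LHS]map_id; apply/eq_in_map => x; rewrite mem_iota /bump /= add0n => lt.
by rewrite leqNgt lt.
Qed.

(** Induction on b: by the hexagon the first block passes the leading factor of the second one,
    which is a [front] move by [symm_snoc], and then the remaining b factors. *)
Lemma block_swap a b (e : (a + b)%N = (b + a)%N) :
  concat V b a \c symm (T a) (T b) = tcast e \c permw V (a + b) (blockw a b) \c concat V a b.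
Proof.
elim: b e => [|b IH] e.
  rewrite /= lunit_symm /blockw /= -[a in iota 0 a](addn0 a) permw_iota comp_idr.
  by rewrite (concat_runit (esym (addn0 a))) compA (tcast_comp _ _ erefl) comp_idl.
have e1 : (a + b)%N = (b + a)%N by rewrite addnC.
have e2 : (a + b.+1)%N = (a.+1 + b)%N by rewrite addnS.
have e3 : (a.+1 + b)%N = (b.+1 + a)%N by rewrite addnC addnS.
have ew : permw V (a.+1 + b) (blockw a b.+1) =
    (1_V \oxm permw V (a + b) (blockw a b)) \c front V (a.+1 + b) a.
  rewrite blockwS /= -map_comp; congr (_ \oxm permw _ _ _ \c _).
  by rewrite -[RHS]map_id; apply: eq_map => x; rewrite /= bumpK.
have concatS x y : concat V x.+1 y = (1_V \oxm concat V x y) \c assoc V (T x) (T y) by [].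
apply: (iso_epi (assoc_iso (T a) V (T b))).
have [c ec] : exists c, c = concat V a.+1 b by exists (concat V a.+1 b).
transitivity ((1_V \oxm (tcast e1 \c permw V (a + b) (blockw a b))) \c front V (a.+1 + b) a
    \c (c \c (snoc a \oxm 1_(T b)))).
  rewrite (concatS b) -[LHS]compA -[LHS]compA (compA (assoc V (T b) (T a))) hexagon.
  rewrite !compA -tensm_compr IH symm_snoc tensm_compl !tensm_compr compA.
  rewrite -(compA _ (1_V \oxm concat V a b) (assoc V (T a) (T b))) -(concatS a) -ec.
  by rewrite -[X in X \c _ = _]compA ec concat_frontl // -ec !compA.
rewrite ec (snoc_assoc e2) tensm_compr (tcastS e1 e3) -[X in X \c _ = _]compA -ew.
rewrite -(tcast_comp e2 e3 e) -(compA (tcast e3)) -tcast_permw.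
by move: (concat _ _ _) => c'; rewrite !compA.
Qed.

End BlockSwap.

(** * Images, cokernels and finite sums *)

Section Abelian.
Context {k : fieldType} {C : symTensorCategory k}.
Implicit Types (X Y Z W : C).
Local Notation "1_ X" := (idmor X) (at level 8, X at level 7, format "1_ X").

Lemma kernel_mono K X Y (i : Mor K X) (f : Mor X Y) : is_kernel i f -> mono i.
Proof.
move=> [fi0 uni] T g h e.
have fig : f \c (i \c g) = 0 by rewrite compA fi0 comp0f.
have [u [_ uu]] := uni T (i \c g) fig.
by rewrite -(uu g erefl) -(uu h (esym e)).
Qed.

Lemma cokernel_epi X Y Q (p : Mor Y Q) (f : Mor X Y) : is_cokernel p f -> epi p.
Proof.
move=> [pf0 uni] T g h e.
have gpf : g \c p \c f = 0 by rewrite -compA pf0 compf0.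
have [u [_ uu]] := uni T (g \c p) gpf.
by rewrite -(uu g erefl) -(uu h (esym e)).
Qed.

Lemma im_inc_mono X Y (f : Mor X Y) : mono (im_inc f).
Proof. exact: kernel_mono (ker_incP _). Qed.

(** If g q = 0, then q factors through the kernel i of g. The mono [im_inc f \c i] is the kernel of
    its cokernel c; since c kills f, it kills [im_inc f], which therefore factors through that mono.
    So i has a right inverse, and g = 0. *)
Lemma im_factor X Y (f : Mor X Y) : exists q : Mor X (im f), im_inc f \c q = f /\ epi q.
Proof.
have [pf0 _] := coker_prP f; have [pi0 kuni] := ker_incP (coker_pr f).
have [q [qE _]] := kuni _ f pf0; exists q; split=> //.
apply: epi0 => T g gq0.
have [_ /(_ _ q gq0) [q' [q'E _]]] := ker_incP g.
set i := ker_inc g in q'E; have i_mono : mono i := kernel_mono (ker_incP g).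
have j_mono : mono (im_inc f \c i).
  by move=> U a b; rewrite -!compA => /im_inc_mono /i_mono.
have [_ juni] := mono_normal (stc_ab C) j_mono.
set c := coker_arr _ in juni; have [cj0 _] : is_cokernel c (im_inc f \c i) by exact: coker_arrP.
have cf0 : c \c f = 0.
  transitivity (c \c (im_inc f \c q)); first by rewrite qE.
  by rewrite -q'E (compA (im_inc f)) (compA c) cj0 comp0f.
have [_ /(_ _ c cf0) [c' [c'E _]]] := coker_prP f.
have ci0 : c \c im_inc f = 0 by rewrite -c'E -compA pi0 compf0.
have [s [sE _]] := juni _ (im_inc f) ci0.
have is1 : i \c s = idmor _ by apply: (im_inc_mono (f := f)); rewrite compA sE comp_idr.
have [gi0 _] := ker_incP g.
by rewrite -[g]comp_idr -is1 compA gi0 comp0f.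
Qed.

Lemma coker_im X Y (f : Mor X Y) : short_exact (im_inc f) (coker_pr f).
Proof.
have [q [qE _]] := im_factor f; split; first exact: ker_incP.
have [pi0 _] := ker_incP (coker_pr f); split=> // T g gi0.
by have [_] := coker_prP f; apply; rewrite -qE compA gi0 comp0f.
Qed.

Lemma epi_exact X Y (f : Mor X Y) : epi f -> short_exact (ker_inc f) f.
Proof. by move=> ef; split; [exact: ker_incP|exact: epi_normal]. Qed.

Lemma epi_tensr W X Y (f : Mor X Y) : epi f -> epi (1_W \oxm f).
Proof. by move=> /epi_exact /(tens_exact_l W) [_ /cokernel_epi]. Qed.

Lemma epi_tensl W X Y (f : Mor X Y) : epi f -> epi (f \oxm 1_W).
Proof. by move=> /epi_exact /(tens_exact_r W) [_ /cokernel_epi]. Qed.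

(** By exactness the tensored projection is a cokernel of the tensored inclusion of the image, and h
    kills that inclusion because the source of f still covers the image after tensoring. *)
Lemma factor_midl X Y0 Y Z U (f : Mor Y0 Y) (h : Mor (X \ox (Y \ox Z)) U) :
  h \c (1_X \oxm (f \oxm 1_Z)) = 0 ->
  exists h', h' \c (1_X \oxm (coker_pr f \oxm 1_Z)) = h.
Proof.
move=> hf0; have [q [qE qe]] := im_factor f.
have [_ [_ uni]] := tens_exact_l X (tens_exact_r Z (coker_im f)).
have [|h' [h'E _]] := uni _ h; last by exists h'.
change (h \c (1_X \oxm (im_inc f \oxm 1_Z)) = 0).
apply: (epi_tensr (W := X) (epi_tensl (W := Z) qe)); rewrite comp0f -compA.
by rewrite -[RHS]hf0; congr (_ \c _); rewrite -[in RHS]qE tensm_compl tensm_compr.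
Qed.

Lemma factor_midr X Y0 Y Z U (f : Mor Y0 Y) (h : Mor (X \ox (Z \ox Y)) U) :
  h \c (1_X \oxm (1_Z \oxm f)) = 0 ->
  exists h', h' \c (1_X \oxm (1_Z \oxm coker_pr f)) = h.
Proof.
move=> hf0; have [q [qE qe]] := im_factor f.
have [_ [_ uni]] := tens_exact_l X (tens_exact_l Z (coker_im f)).
have [|h' [h'E _]] := uni _ h; last by exists h'.
change (h \c (1_X \oxm (1_Z \oxm im_inc f)) = 0).
apply: (epi_tensr (W := X) (epi_tensr (W := Z) qe)); rewrite comp0f -compA.
by rewrite -[RHS]hf0; congr (_ \c _); rewrite -[in RHS]qE !tensm_compr.
Qed.

Definition joint_pr {I : finType} {X Y} (f : I -> Mor X Y) : Mor Y (joint_coker f) :=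
  coker_pr (\sum_i f i \c fproj (fun=> X) i).

Lemma factor_joint X Y0 Y Z0 Z U (I J : finType) (f : I -> Mor Y0 Y) (g : J -> Mor Z0 Z)
    (h : Mor (X \ox (Y \ox Z)) U) :
  (forall i, h \c (1_X \oxm (f i \oxm 1_Z)) = 0) ->
  (forall j, h \c (1_X \oxm (1_Y \oxm g j)) = 0) ->
  exists h', h' \c (1_X \oxm (joint_pr f \oxm joint_pr g)) = h.
Proof.
move=> hf hg.
have [|h1 h1E] := @factor_midl X _ _ Z U (\sum_i f i \c fproj (fun=> Y0) i) h.
  rewrite (big_morph (fun x => x \oxm 1_Z) (id1 := 0) (op1 := +%R)); last exact: tensm0l.
    rewrite tensm_sumr comp_sumr big1 // => i _.
    by rewrite tensm_compl tensm_compr compA hf comp0f.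
  by move=> a b; rewrite tensmDl.
have e1 : epi (1_X \oxm (joint_pr f \oxm 1_Z)).
  exact/epi_tensr/epi_tensl/(cokernel_epi (coker_prP _)).
have [|h2 h2E] := @factor_midr X _ _ (joint_coker f) U (\sum_j g j \c fproj (fun=> Z0) j) h1.
  rewrite !tensm_sumr comp_sumr big1 // => j _.
  rewrite !tensm_compr compA (_ : h1 \c _ = 0) ?comp0f //.
  have e1' : epi (1_X \oxm (joint_pr f \oxm 1_Z0)).
    exact/epi_tensr/epi_tensl/(cokernel_epi (coker_prP _)).
  apply: e1'; rewrite comp0f -compA.
  have -> : (1_X \oxm (1_(joint_coker f) \oxm g j)) \c (1_X \oxm (joint_pr f \oxm 1_Z0)) =
      (1_X \oxm (joint_pr f \oxm 1_Z)) \c (1_X \oxm (1_Y \oxm g j)).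
    by rewrite -!tensm_compr -tensmE -tensmE'.
  by rewrite compA h1E hg.
by exists h2; rewrite (tensmE' (joint_pr f)) tensm_compr compA h2E.
Qed.

Lemma fprojK (I : finType) (X : I -> C) i : fproj X i \c finj X i = idmor (X i).
Proof. exact: bip_projK. Qed.

Lemma fproj0 (I : finType) (X : I -> C) i j : i != j -> fproj X j \c finj X i = 0.
Proof. exact: bip_proj0. Qed.

Lemma fsum_projE (I : finType) (X : I -> C) Y (h : forall i, Mor (X i) Y) i :
  (\sum_j h j \c fproj X j) \c finj X i = h i.
Proof.
rewrite comp_suml (bigD1 i) //= -compA fprojK comp_idr big1 ?addr0 // => j ne.
by rewrite -compA fproj0 1?eq_sym // compf0.
Qed.

End Abelian.

(** * Completeness of the Specht modules *)

Section CycleType.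
Variable n : nat.
Implicit Types (s t g : 'S_n).

(* The position that follows [i] in its cycle, for cycles of lengths [sh] that are
   written one after the other. *)
Definition cycle_succ (sh : seq nat) (i : nat) : nat :=
  let r := reshape_index sh i in let c := reshape_offset sh i in
  flatten_index sh r (if c.+1 == nth 0%N sh r then 0%N else c.+1).

Lemma fcycle_next (f : 'I_n -> 'I_n) x0 l c : fcycle f l -> (c < size l)%N ->
  f (nth x0 l c) = nth x0 l (if c.+1 == size l then 0%N else c.+1).
Proof.
case: l => // x p fp lt; have /pathP H := fp.
have := H x0 c; rewrite size_rcons => /(_ lt) /eqP; rewrite nth_rcons.
have -> : nth x0 (x :: rcons p x) c = nth x0 (x :: p) c.
  by rewrite -rcons_cons nth_rcons lt.
rewrite /= eqSS => ->; move: lt; rewrite ltnS leq_eqVlt.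
by have [-> _|ne /= lt] := eqVneq c (size p); rewrite ?ltnn // lt.
Qed.

Lemma cycles_next (f : 'I_n -> 'I_n) x0 ls i : all (fun l => fcycle f l) ls ->
  (i < size (flatten ls))%N ->
  f (nth x0 (flatten ls) i) = nth x0 (flatten ls) (cycle_succ (shape ls) i).
Proof.
move=> cyc; rewrite size_flatten => lt; have ltr := reshape_indexP lt.
have ltc := reshape_offsetP lt; rewrite nth_shape in ltc.
rewrite /cycle_succ nth_shape !nth_flatten.
set r := reshape_index _ i in ltr ltc *; set c := reshape_offset _ i in ltc *.
have cr : fcycle f (nth [::] ls r).
  by apply: (allP cyc); apply: mem_nth; rewrite size_map in ltr.
rewrite (fcycle_next _ cr ltc).
set c' := if _ then _ else _; have ltc' : (c' < nth 0%N (shape ls) r)%N.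
  rewrite nth_shape /c'; case: eqP => [_|/eqP ne]; first exact: leq_ltn_trans ltc.
  by rewrite ltn_neqAle ne.
by rewrite flatten_indexKl // flatten_indexKr.
Qed.

Lemma cycles_exist s : exists ls : seq (seq 'I_n),
  [/\ all (fun l => fcycle s l) ls, perm_eq (flatten ls) (enum 'I_n),
      sorted geq (shape ls) & 0%N \notin shape ls].
Proof.
pose ls0 := [seq fingraph.orbit s x | x <- enum (froots s)].
pose ls := sort (fun l1 l2 : seq 'I_n => geq (size l1) (size l2)) ls0.
have pls : perm_eq ls ls0 by rewrite perm_sort.
have symm : connect_sym (frel s) by apply: fconnect_sym; apply: perm_inj.
exists ls; split.
- apply/allP => l; rewrite (perm_mem pls) => /mapP[x _ ->].
  exact: cycle_orbit (@perm_inj _ s) x.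
- apply: perm_trans (perm_flatten pls) _.
  have cnt y : count_mem y (flatten ls0) = 1%N.
    rewrite count_flatten -map_comp.
    have -> : map (count_mem y \o fingraph.orbit s) (enum (froots s)) =
        map (fun x => nat_of_bool (pred1 (froot s y) x)) (enum (froots s)).
      apply/eq_in_map => x; rewrite mem_enum => xr /=.
      rewrite count_uniq_mem ?orbit_uniq // -fconnect_orbit.
      by rewrite symm -(root_connect symm) (eqP xr) eq_sym.
    rewrite (sumn_count (pred1 (froot s y))) (count_uniq_mem _ (enum_uniq _)) mem_enum.
    by rewrite [_ \in _](roots_root symm y).
  apply: uniq_perm; rewrite ?enum_uniq //.
    apply: count_mem_uniq => y; rewrite cnt; apply/esym/eqP; rewrite eqb1.
    by rewrite -has_pred1 has_count cnt.
  by move=> y; rewrite mem_enum -has_pred1 has_count cnt.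
- rewrite /shape sorted_map; apply: sort_sorted => l1 l2 /=; exact: leq_total.
- apply/negP => /mapP[l]; rewrite (perm_mem pls) => /mapP[x _ ->].
  by rewrite size_orbit => /eqP; rewrite eq_sym -leqn0 leqNgt fingraph.order_gt0.
Qed.

(** The cycles written one after the other, by decreasing length, list all points. If the lengths
    agree, matching the two lists position by position conjugates s to t. *)
Lemma cycle_type_exists : exists ct : 'S_n -> young_diagram,
  (forall s, yd_size (ct s) = n) /\
  forall s t, yd_rows (ct s) = yd_rows (ct t) -> exists g, t = (s ^ g)%g.
Proof.
pose ls s := projT1 (cid (cycles_exist s)).
have lsP s : [/\ all (fun l => fcycle s l) (ls s), perm_eq (flatten (ls s)) (enum 'I_n),
      sorted geq (shape (ls s)) & 0%N \notin shape (ls s)].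
  by rewrite /ls; case: cid.
have shP s : sorted geq (shape (ls s)) && (0%N \notin shape (ls s)).
  by have [_ _ -> ->] := lsP s.
exists (fun s => YoungDiagram (shP s)); split=> [s|s t /= e].
  rewrite /yd_size /= -size_flatten; have [_ /perm_size -> _ _] := lsP s.
  by rewrite size_enum_ord.
have szl s' : size (flatten (ls s')) = n.
  by have [_ /perm_size -> _ _] := lsP s'; rewrite size_enum_ord.
have unl s' : uniq (flatten (ls s')).
  by have [_ /perm_uniq -> _ _] := lsP s'; rewrite enum_uniq.
have inj s' : injective (fun i : 'I_n => nth i (flatten (ls s')) i).
  move=> i j; rewrite (set_nth_default j) ?szl // => /eqP.
  by rewrite nth_uniq ?szl // => /eqP/val_inj.
pose al s' := perm (@inj s').
have alE s' (x0 i : 'I_n) : al s' i = nth x0 (flatten (ls s')) i.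
  by rewrite permE; apply: set_nth_default; rewrite szl.
have nu s' (i j : 'I_n) : cycle_succ (shape (ls s')) i = j -> s' (al s' i) = al s' j.
  move=> e'; rewrite !(alE _ i) -e'; have [cyc _ _ _] := lsP s'.
  by rewrite (cycles_next i cyc) ?szl.
exists ((al s)^-1 * al t)%g; rewrite conjgE invMg invgK.
have lt (i : 'I_n) : (cycle_succ (shape (ls s)) i < n)%N.
  have lti : (i < sumn (shape (ls s)))%N by rewrite -size_flatten szl.
  rewrite -[n in (_ < n)%N](szl s) size_flatten; apply: flatten_indexP.
  by have := reshape_offsetP lti; case: eqP => [_|/eqP ne] ltc;
    [exact: leq_ltn_trans ltc|rewrite ltn_neqAle ne].
apply: (mulgI (al t)); rewrite !mulgA mulgV mul1g.
apply/permP => i; rewrite !permM.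
have e1 := @nu s i (Ordinal (lt i)) erefl.
have e2 := @nu t i (Ordinal (lt i)); rewrite -e in e2.
by rewrite e2 // e1 permK.
Qed.

End CycleType.

(** * Characters of Young symmetrizers and their pairing *)

Section YoungSubgroups.
Import Num.Theory Order.TTheory.
Variable n : nat.
Implicit Types (s t g x p q : 'S_n) (sh : seq nat) (f : nat -> nat).

Definition level_stab (f : nat -> nat) : {set 'S_n} := [set s : 'S_n | [forall i, f (s i) == f i]].

Lemma level_stabP f s : reflect (forall i, f (s i) = f i) (s \in level_stab f).
Proof. by rewrite inE; apply: (iffP forallP) => H i; apply/eqP. Qed.

Lemma level_stab1 f : 1%g \in level_stab f.
Proof. by apply/level_stabP => i; rewrite perm1. Qed.

Lemma level_stabM f s t : s \in level_stab f -> t \in level_stab f -> (s * t)%g \in level_stab f.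
Proof. by move=> /level_stabP Hs /level_stabP Ht; apply/level_stabP => i; rewrite permM Ht Hs. Qed.

Lemma level_stabV f s : (s^-1%g \in level_stab f) = (s \in level_stab f).
Proof.
by apply/level_stabP/level_stabP => H i; [rewrite -{2}(permK s i) H|rewrite -{2}(permKV s i) H].
Qed.

Lemma level_stabMl f s t : s \in level_stab f -> ((s * t)%g \in level_stab f) = (t \in level_stab f).
Proof.
move=> Hs; apply/idP/idP => [Hst|]; last exact: level_stabM.
by rewrite -(mulKg s t); apply: level_stabM; rewrite ?level_stabV.
Qed.

Lemma level_stabMr f s t : s \in level_stab f -> ((t * s)%g \in level_stab f) = (t \in level_stab f).
Proof.
move=> Hs; apply/idP/idP => [Hst|]; last by move=> Ht; apply: level_stabM.
by rewrite -(mulgK s t); apply: level_stabM; rewrite ?level_stabV.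
Qed.

Lemma level_stab_tperm f (i j : 'I_n) : f i = f j -> tperm i j \in level_stab f.
Proof. by move=> e; apply/level_stabP => l; case: tpermP => // ->. Qed.

(* The sum over [g] of the coefficient of [g] in [c g s], where [c] is the Young
   symmetrizer: up to a scalar, the character of the left ideal generated by [c]. *)
Definition young_trace sh s : int :=
  \sum_g \sum_(p in level_stab (reshape_index sh)) \sum_(q in level_stab (reshape_offset sh))
    (-1) ^+ q *+ ((q * p * g * s)%g == g).

Lemma young_traceJ sh s x : young_trace sh (s ^ x)%g = young_trace sh s.
Proof.
rewrite /young_trace (reindex_inj (mulIg x)) /=; apply: eq_bigr => g _.
apply: eq_bigr => p _; apply: eq_bigr => q _; congr (_ *+ (_ : bool)).
have -> : (q * p * (g * x) * s ^ x = q * p * g * s * x)%g by rewrite conjgE !mulgA mulgK.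
exact: (inj_eq (mulIg x)).
Qed.

Lemma young_traceV sh s : young_trace sh s^-1%g = young_trace sh s.
Proof.
rewrite /young_trace [LHS]exchange_big [RHS]exchange_big /=.
rewrite (reindex_inj invg_inj) /=; apply: eq_big => [p|p _]; first exact: level_stabV.
rewrite [LHS]exchange_big [RHS]exchange_big /=.
rewrite (reindex_inj invg_inj) /=; apply: eq_big => [q|q _]; first exact: level_stabV.
rewrite odd_permV [LHS](reindex_inj (mulgI q^-1)%g) /=; apply: eq_bigr => g _.
congr (_ *+ (_ : bool)).
rewrite -!mulgA (inj_eq (mulgI _)) !mulgA; apply/eqP/eqP => e.
  by rewrite -{1}e !mulgA mulgK mulgV mul1g mulgKV.
by rewrite -{1}e !mulgA mulgK mulgKV mulVg mul1g.
Qed.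

Definition young_pairing sh sh' : int := \sum_s young_trace sh s * young_trace sh' s^-1%g.

Lemma young_pairingC sh sh' : young_pairing sh sh' = young_pairing sh' sh.
Proof.
by rewrite /young_pairing; apply: eq_bigr => s _; rewrite !young_traceV mulrC.
Qed.

(** Only p = q = 1 contributes: a permutation that preserves both row and column of every cell is
    the identity. *)
Lemma young_trace1 sh : sumn sh = n -> young_trace sh 1%g = #|[set: 'S_n]|%:R.
Proof.
move=> shn; rewrite /young_trace -sumr_const; apply: eq_big => [g|g _]; first by rewrite inE.
rewrite (bigD1 1%g) ?level_stab1 //= (bigD1 1%g) ?level_stab1 //= !mul1g mulg1 eqxx odd_perm1 mulr1n.
rewrite big1 => [|q /andP[_ /negbTE ne]]; last first.
  by rewrite !mulg1 -[X in _ == X]mul1g (inj_eq (mulIg g)) ne mulr0n.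
rewrite big1 ?addr0 // => p /andP[pP /negbTE ne].
rewrite big1 // => q qQ; rewrite mulg1 -[X in _ == X]mul1g (inj_eq (mulIg g)).
case: eqP => // e; case/negP: (negbT ne); apply/eqP/permP => i; rewrite perm1.
have pe : p = q^-1%g by rewrite -[LHS](mulKg q) e mulg1.
apply/val_inj; rewrite /= -(reshape_indexK sh (p i)) -(reshape_indexK sh i).
move/level_stabP: pP => ->; rewrite pe; move: qQ; rewrite -level_stabV => /level_stabP -> //.
Qed.

(** By invariance under inversion this is a sum of squares, with the square of n! at the
    identity. *)
Lemma young_pairing_gt0 sh : sumn sh = n -> 0 < young_pairing sh sh.
Proof.
move=> shn; rewrite /young_pairing (bigD1 1%g) //= ltr_wpDr //.
  by apply: sumr_ge0 => s _; rewrite young_traceV -expr2 sqr_ge0.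
by rewrite invg1 -expr2 young_trace1 // exprn_gt0 // ltr0n; apply/card_gt0P; exists 1%g; rewrite inE.
Qed.

Lemma young_pairingE sh sh' : young_pairing sh sh' =
  \sum_(h : 'S_n) \sum_(p in level_stab (reshape_index sh')) \sum_(q in level_stab (reshape_offset sh'))
    (-1) ^+ q * young_trace sh (q * p)%g.
Proof.
rewrite /young_pairing; under eq_bigr => s _ do rewrite [young_trace sh' _]/young_trace mulr_sumr.
rewrite exchange_big; apply: eq_bigr => h _.
under eq_bigr => s _ do rewrite mulr_sumr.
rewrite exchange_big; apply: eq_bigr => p _.
under eq_bigr => s _ do rewrite mulr_sumr.
rewrite exchange_big; apply: eq_bigr => q _ /=.
have e s : ((q * p * h * s^-1)%g == h) = (s == ((q * p) ^ h)%g).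
  apply/eqP/eqP => [e|->]; last by rewrite (conjgC _ h) mulgK.
  by apply: (mulgI h); rewrite -(conjgC _ h) -{1}e mulgKV.
rewrite (bigD1 ((q * p) ^ h)%g) //= e eqxx mulr1n young_traceJ mulrC big1 ?addr0 // => s ne.
by rewrite e (negbTE ne) mulr0n mulr0.
Qed.

(** The classical vanishing argument: for each relative position x some transposition lies in the
    row group of [sh] while its conjugate by x lies in the column group of [sh']. *)
Lemma young_pairing_eq0 sh sh' :
  (forall x, exists i j : 'I_n, [/\ i != j, reshape_index sh i = reshape_index sh j &
     reshape_offset sh' (x i) = reshape_offset sh' (x j)]) -> young_pairing sh sh' = 0.
Proof.
move=> H; rewrite young_pairingE big1 // => h _; rewrite big1 // => p' _; rewrite /young_trace.
under eq_bigr => q' _ do rewrite mulr_sumr.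
rewrite exchange_big big1 // => g _ /=.
under eq_bigr => q' _ do rewrite exchange_big mulr_sumr.
rewrite exchange_big big1 // => q _ /=.
under eq_bigr => q' _ do rewrite mulr_sumr.
(* The transposition [(i j)] gives a sign-reversing involution of the summands. *)
have [i [j [ij /level_stab_tperm tP /level_stab_tperm tQ]]] := H g.
set X := \sum_(_ in _) _; suff : X = - X by move: X => X; lia.
rewrite {1}/X (reindex_inj (mulgI (tperm (g i) (g j)))) -sumrN.
apply: eq_big => [q'|q' _]; first by rewrite level_stabMl.
rewrite (reindex_inj (mulIg (tperm i j))) -sumrN.
apply: eq_big => [p|p _]; first by rewrite level_stabMr.
rewrite odd_mul_tperm (inj_eq perm_inj) ij signr_addb expr1 mulN1r mulNr.
congr (- (_ * (_ *+ (_ : bool)))); rewrite -tpermJ conjgE.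
by rewrite !mulgA mulgK -(mulgA (q * p)%g (tperm i j)) tperm2 mulg1.
Qed.

End YoungSubgroups.

(** * Dominance order on diagrams *)

Lemma sumn_take_mono sh a b : (a <= b)%N -> (sumn (take a sh) <= sumn (take b sh))%N.
Proof.
by move=> ab; rewrite -(subnKC ab) takeD sumn_cat leq_addr.
Qed.

Lemma reshape_index_lt sh r i : (i < sumn sh)%N ->
  (reshape_index sh i < r)%N = (i < sumn (take r sh))%N.
Proof.
move=> lti; have ltr := reshape_indexP lti; have ltc := reshape_offsetP lti.
rewrite -{2}(reshape_indexK sh i) /flatten_index.
set r' := reshape_index sh i in ltr ltc *; have [lt|le] := ltnP r' r.
  apply/esym/(leq_trans _ (sumn_take_mono _ lt)).
  by rewrite (take_nth 0%N) // sumn_rcons ltn_add2l.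
by apply/esym/negbTE; rewrite -leqNgt (leq_trans (sumn_take_mono _ le)) ?leq_addr.
Qed.

(** The value of [find] is the height of column c, the number of rows longer than c. *)
Lemma reshape_offset_lt_nth sh r c : sorted geq sh ->
  (c < nth 0 sh r)%N = (r < find (fun a => a <= c)%N sh)%N.
Proof.
move=> srt; set h := find _ _; have [lt|le] := ltnP r h.
  by rewrite ltnNge (before_find _ lt).
apply/negbTE; rewrite -leqNgt; have [ltr|/(nth_default _) -> //] := ltnP r (size sh).
have hs : has (fun a => a <= c)%N sh by rewrite has_find; apply: leq_ltn_trans ltr.
apply: leq_trans (nth_find 0%N hs).
have tr : transitive geq by move=> a b d /= ab bd; apply: leq_trans bd ab.
apply: (sorted_leq_nth tr (fun x : nat => leqnn x : geq x x) 0%N srt) => //=.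
by rewrite inE -has_find.
Qed.

Section Dominance.
Variables (n : nat) (sh sh' : seq nat) (x : 'S_n).
Hypotheses (shn : sumn sh = n) (shn' : sumn sh' = n) (srt : sorted geq sh').
Hypothesis sep : forall i j : 'I_n, i != j -> reshape_index sh i = reshape_index sh j ->
  reshape_offset sh' (x i) = reshape_offset sh' (x j) -> False.

(** By [sep] each of the first r rows of [sh] contributes at most one point, and x maps the points
    injectively into column c, of height h. The first r rows of [sh'] meet that column in min(r, h)
    cells. *)
Lemma card_column_le r c :
  (#|[set i : 'I_n | (reshape_index sh i < r) && (reshape_offset sh' (x i) == c)]|
   <= #|[set i : 'I_n | (reshape_index sh' i < r) && (reshape_offset sh' i == c)]|)%N.
Proof.
set S := finset _; set T := finset _; pose h := find (fun a => a <= c)%N sh'.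
have cut (B : nat) (f : 'I_n -> nat) : {in S &, injective f} -> (forall i, i \in S -> f i < B)%N ->
    (#|S| <= B)%N.
  move=> inj lt; rewrite cardE -(size_map f) -[X in (_ <= X)%N](size_iota 0).
  apply: uniq_leq_size; first by rewrite map_inj_in_uniq ?enum_uniq // => i j;
    rewrite !mem_enum; apply: inj.
  by move=> _ /mapP[i iS ->]; rewrite mem_iota add0n /= lt // -mem_enum.
have Sr : (#|S| <= r)%N.
  apply: (cut r (fun i => reshape_index sh i)); last by move=> i; rewrite inE => /andP[].
  move=> i j; rewrite !inE => /andP[_ /eqP ci] /andP[_ /eqP cj] e.
  by have [//|ne] := eqVneq i j; case: (sep ne e); rewrite ci cj.
have Sh : (#|S| <= h)%N.
  apply: (cut h (fun i => reshape_index sh' (x i))).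
    move=> i j; rewrite !inE => /andP[_ /eqP ci] /andP[_ /eqP cj] e.
    apply: (@perm_inj _ x); apply: val_inj => /=.
    by rewrite -(reshape_indexK sh' (x i)) e ci -cj reshape_indexK.
  move=> i; rewrite inE -reshape_offset_lt_nth // => /andP[_ /eqP <-].
  by apply: reshape_offsetP; rewrite shn'.
pose g rho := flatten_index sh' rho c.
have gP rho : (rho < #|S|)%N -> [/\ (g rho < n)%N, reshape_index sh' (g rho) = rho
    & reshape_offset sh' (g rho) = c].
  move=> lt; have lt' : (c < nth 0 sh' rho)%N.
    by rewrite reshape_offset_lt_nth // (leq_trans lt).
  by rewrite /g flatten_indexKl // flatten_indexKr // -{1}shn' flatten_indexP.
rewrite [X in (_ <= X)%N]cardE -(size_map val) -(size_iota 0 #|S|) -(size_map g).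
apply: uniq_leq_size.
  rewrite map_inj_in_uniq ?iota_uniq // => a b.
  rewrite !mem_iota !add0n /= => /gP[_ ea _] /gP[_ eb _] e.
  by rewrite -ea -eb e.
move=> y /mapP[rho + ->]; rewrite mem_iota add0n /= => lt.
have [ltn er ec] := gP _ lt; apply/mapP; exists (Ordinal ltn) => //.
by rewrite mem_enum inE /= er ec eqxx (leq_trans lt).
Qed.

Lemma dominance r : (sumn (take r sh) <= sumn (take r sh'))%N.
Proof.
have cnt sh0 : sumn sh0 = n ->
    sumn (take r sh0) = #|[set i : 'I_n | (reshape_index sh0 i < r)%N]|.
  move=> e; have le : (sumn (take r sh0) <= n)%N.
    by rewrite -e -[X in (_ <= sumn X)%N](cat_take_drop r) sumn_cat leq_addr.
  rewrite -sum1_card (eq_bigl (fun i : 'I_n => (i < sumn (take r sh0))%N)); last first.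
    by move=> i; rewrite inE reshape_index_lt ?e.
  by rewrite (big_ord_narrow_cond (P := xpredT) le) sum1_card card_ord.
have lt (i : 'I_n) : (reshape_offset sh' i < n)%N.
  by apply: leq_ltn_trans (ltn_ord i); apply: leq_subr.
pose col i := Ordinal (lt i).
have part (P : pred 'I_n) (f : 'I_n -> 'I_n) :
    #|[set i | P i]| = (\sum_c #|[set i | P i && (f i == c)]|)%N.
  rewrite -sum1_card (partition_big f xpredT) //=; apply: eq_bigr => c _.
  by rewrite -sum1_card; apply: eq_bigl => i; rewrite !inE.
rewrite !cnt // (part _ (fun i => col (x i))) (part _ col); apply: leq_sum => c _.
exact: card_column_le.
Qed.

End Dominance.

(** Partial sums determine a row sequence up to trailing zeros, which diagrams exclude. *)
Lemma young_diagram_ext (lam mu : young_diagram) :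
  (forall r, sumn (take r lam) = sumn (take r mu)) -> yd_rows lam = yd_rows mu.
Proof.
move=> e.
have nthE r : nth 0%N lam r = nth 0%N mu r.
  have sE (sh : seq nat) : sumn (take r.+1 sh) = (sumn (take r sh) + nth 0 sh r)%N.
    have [lt|ge] := ltnP r (size sh); first by rewrite (take_nth 0%N) // sumn_rcons.
    by rewrite nth_default // addn0 !take_oversize // (leq_trans ge).
  by apply/eqP; rewrite -(eqn_add2l (sumn (take r lam))) -sE e sE e.
have szE (al be : young_diagram) : (forall r, nth 0%N al r = nth 0%N be r) ->
    (size al <= size be)%N.
  move=> ab; rewrite leqNgt; apply/negP => lt.
  have /andP[_ /negP] := yd_rowsP al; case.
  by rewrite -(nth_default 0%N (leqnn (size be))) -ab mem_nth.
apply: (@eq_from_nth _ 0%N) => [|r _ //]; apply/eqP; rewrite eqn_leq.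
by rewrite !szE.
Qed.

(** A nonzero pairing forces dominance, and by symmetry of the pairing in both directions. *)
Lemma young_pairing_diag n (lam mu : young_diagram) : yd_size lam = n -> yd_size mu = n ->
  yd_rows lam <> yd_rows mu -> young_pairing n lam mu = 0.
Proof.
move=> sl sm ne; apply: contrapT => /eqP nz.
have dom (al be : young_diagram) : yd_size al = n -> yd_size be = n ->
    young_pairing n al be != 0 -> forall r, (sumn (take r al) <= sumn (take r be))%N.
  move=> sa sb nz'; have /andP[srt _] := yd_rowsP be.
  apply: contrapT => /existsNP[r nle]; case/negP: nz'; apply/eqP/young_pairing_eq0 => x.
  apply: contrapT => nex; apply: nle; apply: (@dominance n al be x) => // i j ij e1 e2.
  by apply: nex; exists i, j.
apply: ne; apply: young_diagram_ext => r; apply/eqP; rewrite eqn_leq.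
by rewrite !dom // young_pairingC.
Qed.

(** * Young characters span the class functions *)

Section Completeness.
Import Num.Theory Order.TTheory.
Variables (k : fieldType) (char0 : [pchar k] =i pred0) (n : nat).
Local Notation G := [set: 'S_n]%G.
Local Notation N := #|classes G|.

Lemma intr_char0 (z : int) : z != 0 -> z%:~R != 0 :> k.
Proof.
move/pcharf0P: char0 => c0; case: z => [m|m] nz; first by rewrite -[_%:~R]/(m%:R) c0.
by rewrite NegzE mulrNz oppr_eq0 [_%:~R](_ : _ = m.+1%:R) ?c0.
Qed.

(* The functions [young_trace] of distinct diagrams are orthogonal and nonzero, and
   there are as many diagrams as classes, so that they span the class functions. *)
Lemma young_trace_delta : exists (lam : 'I_N -> young_diagram) (v : 'I_N -> k),
  (forall i, yd_size (lam i) = n) /\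
  forall s : 'S_n, \sum_i v i * (young_trace (lam i) s)%:~R = (s == 1%g)%:R.
Proof.
have [ct [ctn ctJ]] := cycle_type_exists n.
pose r (i : 'I_N) : 'S_n := repr (enum_val i).
have rE i : enum_val i = (r i ^: G)%g.
  by have /repr_classesP[_ {1}->] := enum_valP i.
pose Z : 'M[k]_N := \matrix_(i, j) (young_trace (ct (r i)) (r j))%:~R.
pose c : 'rV[k]_N := \row_j #|pred_of_set (enum_val j)|%:R.
have ZE i i' : (Z *m (diag_mx c *m Z^T)) i i' = (young_pairing n (ct (r i)) (ct (r i')))%:~R.
  rewrite mxE /young_pairing (rmorph_sum (intmul 1)) /=.
  under [RHS]eq_bigr => s _ do rewrite young_traceV rmorphM /=.
  rewrite (eq_bigl (fun s => s \in G)) => [|s]; last by rewrite inE.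
  rewrite (sum_by_classes (G := G)) => [|s g _ _]; last by rewrite !young_traceJ.
  rewrite [RHS]big_enum_val; apply: eq_bigr => j _.
  rewrite mul_diag_mx !mxE; rewrite -/(r j); exact: mulrCA.
have rinj i i' : yd_rows (ct (r i)) = yd_rows (ct (r i')) -> i = i'.
  move=> /ctJ [g eg]; apply: enum_val_inj; rewrite !rE eg.
  by rewrite classGidl // inE.
(* Weighted by the class sizes, [Z] times its transpose is the Gram matrix of the pairing: diagonal
   by orthogonality, with positive integers on the diagonal. *)
have uZ : Z \in unitmx.
  suff : Z *m (diag_mx c *m Z^T) \in unitmx by rewrite unitmx_mul => /andP[].
  have -> : Z *m (diag_mx c *m Z^T) = diag_mx (\row_i (young_pairing n (ct (r i)) (ct (r i)))%:~R).
    apply/matrixP => i i'; rewrite ZE !mxE; have [->//|ne] := eqVneq i i'.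
    by rewrite young_pairing_diag ?mulr0n // => /rinj /eqP; rewrite (negbTE ne).
  rewrite unitmxE det_diag unitfE prodf_seq_neq0; apply/allP => i _ /=.
  by rewrite mxE intr_char0 // gt_eqF // young_pairing_gt0 //; exact: ctn.
pose v : 'rV[k]_N := (\row_j (r j == 1%g)%:R) *m invmx Z.
exists (fun i => ct (r i)), (v 0); split=> // s.
have sG : (s ^: G)%g \in classes G by apply: mem_classes; rewrite inE.
have [j ej] : exists j : 'I_N, enum_val j = (s ^: G)%g.
  by exists (enum_rank_in sG (s ^: G)%g); rewrite enum_rankK_in.
have /imsetP[g _ eg] : r j \in (s ^: G)%g by rewrite -ej rE class_refl.
have e := congr1 (fun M : 'rV_N => M 0 j) (mulmxKV uZ (\row_j (r j == 1%g)%:R)).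
rewrite -/v [LHS]mxE [RHS]mxE eg conjg_eq1 in e; rewrite -e; apply: eq_bigr => i _.
by rewrite [Z i j]mxE eg young_traceJ.
Qed.

End Completeness.

Section SpechtCoefficients.
Variables (k : fieldType) (lam : young_diagram).
Local Notation n := (yd_size lam).
Local Notation G := [set: 'S_n]%G.
Local Notation aG := (regular_repr k G).

Lemma young_symmetrizer_coef (g s : 'S_n) :
  (young_symmetrizer k lam *m aG g *m aG s) 0 (gring_index G g) =
  \sum_(p in row_stab lam) \sum_(q in col_stab lam)
     ((-1) ^+ q *+ ((q * p * g * s)%g == g))%:~R.
Proof.
rewrite /young_symmetrizer /gring_row -!row_mul mxE.
rewrite !mulmx_suml summxE; apply: eq_bigr => p _.
rewrite !mulmx_suml summxE; apply: eq_bigr => q _.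
rewrite -!scalemxAl -!repr_mxM ?inE // !mxE eqxx gring_indexK ?inE // mul1g /=.
have -> : (gring_index G g == gring_index G (q * p * g * s)%g) = ((q * p * g * s)%g == g).
  apply/eqP/eqP => [/(congr1 enum_val)|->//].
  by rewrite !gring_indexK ?inE.
by case: eqP => _; rewrite ?mulr1n ?mulr0n ?mulr1 ?mulr0 ?rmorph_sign.
Qed.

(** The character is a combination of matrix coefficients: with c the symmetrizer, the coefficient
    of g in c g s is a coordinate of a vector of the module generated by c, on which s acts by the
    Specht matrices. *)
Lemma specht_young_trace (M : lmodType k) (th : 'S_n -> M) :
  (forall u v, \sum_s specht k lam s u v *: th s = 0) ->
  \sum_s (young_trace lam s)%:~R *: th s = 0.
Proof.
move=> th0; set U := cyclic_mx aG (young_symmetrizer k lam).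
pose w (g : 'S_n) := in_submod U (young_symmetrizer k lam *m aG g).
have ws g s : val_submod (w g *m specht k lam s) = young_symmetrizer k lam *m aG g *m aG s.
  rewrite val_submodJ ?inE // in_submodK //.
  by apply: mxmodule_trans; rewrite ?cyclic_mx_module ?cyclic_mx_id ?inE.
have zE s : (young_trace lam s)%:~R = \sum_g \sum_u \sum_v
    w g 0 u * (row_base U) v (gring_index G g) * specht k lam s u v.
  rewrite /young_trace rmorph_sum; apply: eq_bigr => g _.
  transitivity ((young_symmetrizer k lam *m aG g *m aG s) 0 (gring_index G g)).
    rewrite young_symmetrizer_coef rmorph_sum; apply: eq_bigr => p _.
    by rewrite rmorph_sum.
  rewrite -ws /val_submod /= !mxE exchange_big; apply: eq_bigr => v _.
  by rewrite !mxE mulr_suml; apply: eq_bigr => u _; rewrite mulrAC.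
under eq_bigr => s _ do rewrite zE scaler_suml.
rewrite exchange_big big1 // => g _; under eq_bigr => s _ do rewrite scaler_suml.
rewrite exchange_big big1 // => u _; under eq_bigr => s _ do rewrite scaler_suml.
rewrite exchange_big big1 // => v _; under eq_bigr => s _ do rewrite -scalerA.
by rewrite -scaler_sumr th0 scaler0.
Qed.

End SpechtCoefficients.

(** * Tensor powers are covered by Schur functors *)

Section SchurCover.
Context {k : fieldType} {C : symTensorCategory k}.
Hypothesis char0 : [pchar k] =i pred0.
Variable V : C.

Section Averaging.
Variable lam : young_diagram.
Local Notation n := (yd_size lam).
Local Notation act := (diag_act (lam := lam) V).

Lemma diag_act_coef (s : 'S_n) a b :
  fproj _ b \c act s \c finj _ a = specht k lam s a b *: tensor_perm V s.
Proof.
rewrite comp_sumr comp_suml (bigD1 a) //= [X in _ + X]big1 ?addr0 => [|a' ne]; last first.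
  rewrite comp_sumr comp_suml big1 // => b' _.
  by rewrite compZr compZl -!compA fproj0 1?eq_sym // !compf0 scaler0.
rewrite comp_sumr comp_suml (bigD1 b) //= [X in _ + X]big1 ?addr0 => [|b' ne].
  by rewrite compZr compZl -!compA fprojK comp_idr (compA _ (finj _ b)) fprojK comp_idl.
by rewrite compZr compZl !compA fproj0 // !comp0f scaler0.
Qed.

Lemma diag_actM (s t : 'S_n) : act t \c act s = act (s * t)%g.
Proof.
rewrite {2}/diag_act comp_sumr; apply: eq_bigr => a _.
rewrite comp_sumr /diag_act.
under eq_bigr => b _.
  rewrite compZr comp_suml (bigD1 b) //= [X in _ + X]big1 ?addr0 => [|b' ne]; last first.
    rewrite comp_suml big1 // => c _.
    by rewrite compZl -!compA (compA (fproj _ b')) fproj0 1?eq_sym // comp0f !compf0 scaler0.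
  rewrite comp_suml scaler_sumr.
  under eq_bigr => c _.
    rewrite compZl scalerA -!compA (compA (fproj _ b)) fprojK comp_idl.
    rewrite (compA (tensor_perm V t)) -tensor_permM. over.
  over.
rewrite exchange_big; apply: eq_bigr => c _; rewrite -scaler_suml; congr (_ *: _); last first.
  by rewrite -compA.
by rewrite repr_mxM ?inE // mxE.
Qed.

(** The sum over the group is unchanged by a further [act t], so it lands in the joint kernel that
    defines the invariants. *)
Lemma averaging_factor :
  exists (i : Mor (schur lam V) (fsum (fun=> tpow V n))) u, i \c u = \sum_(s : 'S_n) act s.
Proof.
set f := \sum_(s : 'S_n) finj (fun=> fsum (fun=> tpow V n)) s \c (act s - idmor _).
exists (ker_inc f); have [_ /(_ _ (\sum_(s : 'S_n) act s))] := ker_incP f.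
case=> [|u [uE _]]; last by exists u.
rewrite /f comp_suml big1 // => t _; rewrite -compA compBl comp_idl comp_sumr.
rewrite [X in _ \c (_ - X)](reindex_inj (mulIg t)) /=.
by under eq_bigr => s _ do rewrite diag_actM; rewrite subrr compf0.
Qed.

(** The blocks of the sum over the group are the sums of [specht k lam s a b *: tensor_perm V s].
    This sum factors through the Schur functor, so g kills every block, hence also the combination
    given by the character. *)
Lemma schur_kill m : n = m -> exists (d : nat) (h : 'I_d -> Mor (schur lam V) (tpow V m)),
  forall Y (g : Mor (tpow V m) Y), (forall b, g \c h b = 0) ->
  \sum_(s : 'S_m) (young_trace lam s)%:~R *: (g \c tensor_perm V s) = 0.
Proof.
move=> <-; have [i [u iu]] := averaging_factor.
exists (specht_dim k lam), (fun b => fproj _ b \c i) => Y g g0; apply: specht_young_trace => a b.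
under eq_bigr => s _ do rewrite -compZr -diag_act_coef.
rewrite -comp_sumr -comp_suml -comp_sumr -iu !compA -(compA g) g0.
by rewrite !comp0f.
Qed.

End Averaging.

(** A combination of the characters is the delta function at 1, which acts as the identity, so g
    itself vanishes. *)
Lemma schur_cover n : exists (N : nat) (lam : 'I_N -> young_diagram)
  (h : forall a, Mor (schur (lam a) V) (tpow V n)),
  forall Y (g : Mor (tpow V n) Y), (forall a, g \c h a = 0) -> g = 0.
Proof.
have [lam [v [lamn vE]]] := young_trace_delta char0 n.
pose d i := projT1 (cid (schur_kill (lamn i))).
have [h hP] : exists h : forall i, 'I_(d i) -> Mor (schur (lam i) V) (tpow V n),
   forall i Y (g : Mor (tpow V n) Y), (forall b, g \c h i b = 0) ->
   \sum_(s : 'S_n) (young_trace (lam i) s)%:~R *: (g \c tensor_perm V s) = 0.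
  have e i : exists h : 'I_(d i) -> Mor (schur (lam i) V) (tpow V n),
    forall Y (g : Mor (tpow V n) Y), (forall b, g \c h b = 0) ->
    \sum_(s : 'S_n) (young_trace (lam i) s)%:~R *: (g \c tensor_perm V s) = 0.
    by rewrite /d; case: cid.
  by exists (fun i => projT1 (cid (e i))) => i; case: cid.
pose I := {i : 'I_#|classes [set: 'S_n]| & 'I_(d i)}.
exists #|{: I}|, (fun a => lam (tag (enum_val a))), (fun a => h _ (tagged (enum_val a))).
move=> Y g g0; have gh i b : g \c h i b = 0.
  by have := g0 (enum_rank (Tagged (fun i => 'I_(d i)) b)); rewrite enum_rankK.
rewrite -[g]comp_idr -(tensor_perm1 V n).
have <- : \sum_(s : 'S_n) (s == 1%g)%:R *: (g \c tensor_perm V s) = g \c tensor_perm V 1%g.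
  rewrite (bigD1 1%g) //= eqxx scale1r big1 ?addr0 // => s /negbTE ->.
  by rewrite scale0r.
under eq_bigr => s _ do rewrite -vE scaler_suml.
rewrite exchange_big big1 // => i _; under eq_bigr => s _ do rewrite -scalerA.
by rewrite -scaler_sumr hP ?scaler0.
Qed.

End SchurCover.

(** * The lower central series of the tensor algebra *)

Lemma swp_cat i (s w : seq nat) : swp (size s + i) (s ++ w) = s ++ swp i w.
Proof. by elim: s => //= x s ->. Qed.

Section Sums.
Context {k : fieldType} {D : sumTensorCategory k}.
Implicit Types (X Y Z W : D).
Local Notation "1_ X" := (idmor X) (at level 8, X at level 7, format "1_ X").

Lemma copairE (X : nat -> D) S (inj : forall n, Mor (X n) S) (H : is_coproduct inj) Y
  (f : forall n, Mor (X n) Y) n : copair H f \c inj n = f n.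
Proof. by rewrite /copair; case: cid => u [/= uE _]. Qed.

Lemma coproduct_ext (X : nat -> D) S (inj : forall n, Mor (X n) S) (H : is_coproduct inj) Y
  (u v : Mor S Y) : (forall n, u \c inj n = v \c inj n) -> u = v.
Proof. by move=> e; have [w [_ uw]] := H Y (fun n => v \c inj n); rewrite -(uw u) ?(uw v). Qed.

Lemma csum_extr W (X : nat -> D) Y (u v : Mor (W \ox csum X) Y) :
  (forall n, u \c (1_W \oxm cinj X n) = v \c (1_W \oxm cinj X n)) -> u = v.
Proof. exact: (coproduct_ext (tens_sum_l D W X)). Qed.

(** Exchanges the last two factors, so that a sum in the middle place can be handled as a sum in the
    last place. *)
Definition tswap W X Z : Mor ((W \ox Z) \ox X) (W \ox (X \ox Z)) :=
  (1_W \oxm symm Z X) \c assoc W Z X.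

Lemma tswap_iso W X Z : is_iso (tswap W X Z).
Proof.
apply: iso_comp; first exact: assoc_iso.
by apply: iso_tens; [exact: iso_id|exact: symm_iso].
Qed.

Lemma tswap_nat W W' X X' Z Z' (a : Mor W W') (f : Mor X X') (b : Mor Z Z') :
  tswap W' X' Z' \c (a \oxm b \oxm f) = (a \oxm (f \oxm b)) \c tswap W X Z.
Proof.
rewrite /tswap -[LHS]compA assoc_nat compA -tensm_comp symm_nat comp_idl.
by rewrite [RHS]compA -tensm_comp comp_idr.
Qed.

Lemma csum_extm W (X : nat -> D) Z Y (u v : Mor (W \ox (csum X \ox Z)) Y) :
  (forall n, u \c (1_W \oxm (cinj X n \oxm 1_Z)) = v \c (1_W \oxm (cinj X n \oxm 1_Z))) -> u = v.
Proof.
move=> e; apply: (iso_epi (tswap_iso W (csum X) Z)); apply: csum_extr => n.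
by rewrite -(compA u) -(compA v) -(tensm_id W Z) tswap_nat (compA u) (compA v) e.
Qed.

Lemma csum2_copair W (P Q : nat -> D) Y (f : forall p q, Mor (W \ox (P p \ox Q q)) Y) :
  exists u : Mor (W \ox (csum P \ox csum Q)) Y,
    forall p q, u \c (1_W \oxm (cinj P p \oxm cinj Q q)) = f p q.
Proof.
have [f1 f1E] : exists f1 : forall q, Mor (W \ox (csum P \ox Q q)) Y,
    forall p q, f1 q \c (1_W \oxm (cinj P p \oxm 1_(Q q))) = f p q.
  suff H q : exists f1 : Mor (W \ox (csum P \ox Q q)) Y,
      forall p, f1 \c (1_W \oxm (cinj P p \oxm 1_(Q q))) = f p q.
    by exists (fun q => projT1 (cid (H q))) => p q; case: (cid (H q)).
  have [g [tg gt]] := tswap_iso W (csum P) (Q q).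
  exists (copair (tens_sum_l D (W \ox Q q) P) (fun p => f p q \c tswap W (P p) (Q q)) \c g) => p.
  apply: (iso_epi (tswap_iso W (P p) (Q q))); rewrite -[LHS]compA -tswap_nat tensm_id.
  by rewrite -[LHS]compA (compA g) tg comp_idl [LHS]copairE.
exists (copair (tens_sum_l D (W \ox csum P) Q) (fun q => f1 q \c assoc W (csum P) (Q q))
          \c assoc_inv W (csum P) (csum Q)) => p q.
rewrite (tensmE' (cinj P p)) tensm_compr -(f1E p q) [LHS]compA; congr (_ \c _).
rewrite -compA assoc_inv_nat tensm_id compA [X in X \c _]copairE.
by rewrite -compA assoc_invK comp_idr.
Qed.

End Sums.

Section TensorAlgebra.
Context {k : fieldType} {D : sumTensorCategory k}.
Variable V : D.
Implicit Types (X Y Z W : D).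
Local Notation "1_ X" := (idmor X) (at level 8, X at level 7, format "1_ X").
Local Notation T := (tpow V).
Local Notation A := (tens_alg V).
Local Notation m := (tens_alg_mul V).
Local Notation cin := (cinj (tpow V)).

Lemma tens_alg_mulE a b : m \c (cin a \oxm cin b) = cin (a + b)%N \c concat V a b.
Proof.
rewrite tensmE' /tens_alg_mul compA [X in X \c _]copairE.
exact: copairE.
Qed.

Lemma cin_tcast a b (e : a = b) : cin b \c tcast V e = cin a.
Proof. by subst b; rewrite tcast_id comp_idr. Qed.

Lemma permw_concatr a b w : isperm b w ->
  permw V (a + b) (iota 0 a ++ map (addn a) w) \c concat V a b =
  concat V a b \c (1_(T a) \oxm permw V b w).
Proof.
move=> pw; elim/isperm_ind: w / pw => [|i w pw lt IH].
  by rewrite -iotaDl addn0 -iotaD !permw_iota tensm_id comp_idl comp_idr.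
have e : iota 0 a ++ map (addn a) (swp i w) = swp (a + i) (iota 0 a ++ map (addn a) w).
  by have := swp_cat i (iota 0 a) (map (addn a) w); rewrite size_iota => ->; rewrite map_swp.
have pw' : isperm (a + b) (iota 0 a ++ map (addn a) w).
  by rewrite /isperm iotaD perm_cat2l (addnC 0%N) iotaDl; apply: perm_map.
rewrite e permw_swp //; last by rewrite -addnS ltn_add2l.
by rewrite -compA IH compA braid_concatr -compA permw_swp // tensm_compr.
Qed.

(** The morphism that a multilinear word stands for: position i receives the factor with label w_i,
    and the result is embedded in degree n. *)
Definition phi n (w : seq nat) : Mor (T n) A := cin n \c permw V n w.

Lemma phi_comp n w u : isperm n w -> isperm n u ->
  phi n (map (nth 0%N u) w) = phi n w \c permw V n u.
Proof. by move=> pw pu; rewrite /phi permw_comp // compA. Qed.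

Lemma map_nth_block a b w : size w = b ->
  map (nth 0%N (iota 0 a ++ w)) (blockw a b) = w ++ iota 0 a.
Proof.
move=> sw; rewrite /blockw map_cat; congr (_ ++ _).
  have -> : iota a b = map (addn a) (iota 0 b) by rewrite -iotaDl addn0.
  rewrite -map_comp -sw.
  rewrite (eq_map (_ : _ =1 nth 0%N w)) => [|i] /=; first by rewrite map_nth_iota0 // take_size.
  by rewrite nth_cat size_iota ltnNge leq_addr /= addKn.
rewrite -[RHS](take_size) -[RHS](map_nth_iota0 0%N) ?size_iota //.
apply/eq_in_map => i; rewrite mem_iota /= => lt.
by rewrite nth_cat size_iota lt.
Qed.

Lemma isperm_shift a b w : isperm b w -> isperm (a + b) (iota 0 a ++ map (addn a) w).
Proof. by move=> pw; rewrite /isperm iotaD perm_cat2l (addnC 0%N) iotaDl; apply: perm_map. Qed.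

(** The product of the tensor algebra concatenates words. In the opposite product the symmetry is,
    by [block_swap], the word that puts the last b letters first. *)
Lemma phi_com a b w : isperm b w -> commutator m \c (cin a \oxm phi b w) =
  (phi (a + b) (iota 0 a ++ map (addn a) w) -
   phi (a + b) (map (addn a) w ++ iota 0 a)) \c concat V a b.
Proof.
move=> pw; rewrite /commutator -compA compBl comp_idl symm_nat compBr compBl; congr (_ - _).
  rewrite -[cin a]comp_idr /phi tensm_comp compA tens_alg_mulE -!compA.
  by rewrite permw_concatr.
have e : (a + b)%N = (b + a)%N by rewrite addnC.
have pw' := isperm_shift a pw; have pb := isperm_blockw a b.
rewrite -(map_nth_block a (b := b) (w := map (addn a) w)) ?size_map ?(isperm_size pw) //.
rewrite phi_comp // -[RHS]compA permw_concatr //.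
have -> : phi b w \oxm cin a = (cin b \oxm cin a) \c (permw V b w \oxm 1_(T a)).
  by rewrite -tensm_comp comp_idr.
rewrite -(compA _ (permw V b w \oxm _)) -symm_nat (compA m) tens_alg_mulE.
have [c cE] : exists c, c = concat V b a by exists (concat V b a).
have [c' c'E] : exists c, c = concat V a b by exists (concat V a b).
have bs : c \c symm (T a) (T b) = tcast V e \c permw V (a + b) (blockw a b) \c c'.
  by rewrite cE c'E (block_swap V e).
rewrite -cE -c'E -(compA (cin _)) (compA c) bs /phi.
by rewrite !compA cin_tcast.
Qed.

Local Notation lcs := (Defs.lcs m).

(** Counterpart of [L j] for generalized elements of the tensor algebra. *)
Definition inL j X (h : Mor X A) := exists u : Mor X (lcs j), so_inc (lcs j) \c u = h.

Lemma so_inc_mono j : mono (so_inc (lcs j)).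
Proof.
case: j => [|j] /=; last exact: im_inc_mono.
by move=> X f g; rewrite !comp_idl.
Qed.

Lemma inL0 j X : inL j (0 : Mor X A).
Proof. by exists 0; rewrite compf0. Qed.
Lemma inLD j X (f g : Mor X A) : inL j f -> inL j g -> inL j (f + g).
Proof. by move=> [u <-] [v <-]; exists (u + v); rewrite compDr. Qed.
Lemma inLZ j X (f : Mor X A) c : inL j f -> inL j (c *: f).
Proof. by move=> [u <-]; exists (c *: u); rewrite compZr. Qed.
Lemma inL_comp j X Y (f : Mor X A) (g : Mor Y X) : inL j f -> inL j (f \c g).
Proof. by move=> [u <-]; exists (u \c g); rewrite compA. Qed.
Lemma inL_com j X Y (g : Mor X A) (h : Mor Y A) : inL j h -> inL j.+1 (commutator m \c (g \oxm h)).
Proof.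
move=> [u <-]; have [q [qE _]] := im_factor (commutator m \c (1_A \oxm so_inc (lcs j))).
exists (q \c (g \oxm u)); rewrite compA qE -compA -tensm_comp comp_idl //.
Qed.

(* [h] has its values in L_{j+1}, and [c] is its class in B_{j+1}. *)
Definition isclass j X (h : Mor X A) (c : Mor X (lcs_quot m j.+1)) :=
  exists2 u : Mor X (lcs j), so_inc (lcs j) \c u = h & c = coker_pr (lcs_inc m j) \c u.

Lemma isclassP j X (h : Mor X A) : inL j h -> exists c, @isclass j X h c.
Proof. by move=> [u uE]; exists (coker_pr (lcs_inc m j) \c u), u. Qed.

Lemma isclass_uniq j X (h : Mor X A) c c' : @isclass j X h c -> @isclass j X h c' -> c = c'.
Proof. by move=> [u <- ->] [v /so_inc_mono <- ->]. Qed.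

Lemma isclassD j X (h h' : Mor X A) c c' :
  @isclass j X h c -> @isclass j X h' c' -> @isclass j X (h + h') (c + c').
Proof. by move=> [u <- ->] [v <- ->]; exists (u + v); rewrite compDr. Qed.

Lemma isclassZ j X (h : Mor X A) c a : @isclass j X h c -> @isclass j X (a *: h) (a *: c).
Proof. by move=> [u <- ->]; exists (a *: u); rewrite compZr. Qed.

Lemma isclass_comp j X Y (h : Mor X A) c (f : Mor Y X) :
  @isclass j X h c -> @isclass j Y (h \c f) (c \c f).
Proof. by move=> [u <- ->]; exists (u \c f); rewrite compA. Qed.

Lemma isclass0 j X (h : Mor X A) : inL j.+1 h -> @isclass j X h 0.
Proof.
move=> [u <-]; have lE : so_inc (lcs j) \c lcs_inc m j = so_inc (lcs j.+1).
  by rewrite /lcs_inc; case: cid.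
exists (lcs_inc m j \c u); first by rewrite compA lE.
by have [p0 _] := coker_prP (lcs_inc m j); rewrite compA p0 comp0f.
Qed.

(** [ns] holds the degrees of the outer arguments and [n0] that of the last one, so the number of
    brackets is the size of [ns]. *)
Fixpoint itobj (n0 : nat) (ns : seq nat) : D :=
  if ns is n :: ns' then T n \ox itobj n0 ns' else T n0.

Fixpoint itcom n0 ns : Mor (itobj n0 ns) A :=
  if ns is n :: ns' then commutator m \c (cin n \oxm itcom n0 ns') else cin n0.

Definition ittot n0 ns := foldr addn n0 ns.

Fixpoint itconcat n0 ns : Mor (itobj n0 ns) (T (ittot n0 ns)) :=
  if ns is n :: ns' then concat V n (ittot n0 ns') \c (1_(T n) \oxm itconcat n0 ns') else 1_(T n0).

Lemma itconcat_iso n0 ns : is_iso (itconcat n0 ns).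
Proof.
elim: ns => [|n ns IH] /=; first exact: iso_id.
by apply: iso_comp; [apply: iso_tens; [exact: iso_id|]|exact: concat_iso].
Qed.

Lemma inL_itcom n0 ns : inL (size ns) (itcom n0 ns).
Proof.
elim: ns => [|n ns IH] /=; last exact: inL_com.
by exists (cin n0); rewrite comp_idl.
Qed.

Fixpoint Apow j : D := if j is j'.+1 then A \ox Apow j' else A.

Fixpoint Acom j : Mor (Apow j) A :=
  if j is j'.+1 then commutator m \c (1_A \oxm Acom j') else 1_A.

Fixpoint itinc n0 ns : Mor (itobj n0 ns) (Apow (size ns)) :=
  if ns is n :: ns' then cin n \oxm itinc n0 ns' else cin n0.

Lemma Acom_itinc n0 ns : Acom (size ns) \c itinc n0 ns = itcom n0 ns.
Proof.
elim: ns => [|n ns IH] /=; first by rewrite comp_idl.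
by rewrite -compA -tensm_comp comp_idl IH.
Qed.

Lemma itinc_ext W j Y (u v : Mor (W \ox Apow j) Y) :
  (forall n0 ns (e : size ns = j),
     u \c (1_W \oxm ecast j (Mor (itobj n0 ns) (Apow j)) e (itinc n0 ns)) =
     v \c (1_W \oxm ecast j (Mor (itobj n0 ns) (Apow j)) e (itinc n0 ns))) -> u = v.
Proof.
elim: j W u v => [|j IH] W u v H.
  by apply: csum_extr => n; apply: (H n [::] erefl).
apply: csum_extm => n; apply: (iso_epi (assoc_iso W (T n) (Apow j))).
apply: IH => n0 ns e; subst j; have {H} := H n0 (n :: ns) erefl => /= H.
have E (x : Mor (W \ox (A \ox Apow (size ns))) Y) :
    x \c (1_W \oxm (cin n \oxm 1_(Apow (size ns)))) \c assoc W (T n) (Apow (size ns))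
      \c (1_(W \ox T n) \oxm itinc n0 ns) =
    x \c (1_W \oxm (cin n \oxm itinc n0 ns)) \c assoc W (T n) (itobj n0 ns).
  rewrite -(tensm_id W) -(compA _ (assoc _ _ _)) assoc_nat -!compA; congr (_ \c _).
  by rewrite compA -tensm_compr -tensmE.
by rewrite !E H.
Qed.

(** Tensoring preserves epimorphisms, so the successive images collapse to the image of a single
    iterated bracket on j + 1 copies of A. *)
Lemma Acom_epi j : exists2 q : Mor (Apow j) (lcs j), so_inc (lcs j) \c q = Acom j & epi q.
Proof.
elim: j => [|j [q qE qe]]; first by exists (1_A); [rewrite comp_idl|exact: iso_epi (iso_id _)].
have [r [rE re]] := im_factor (commutator m \c (1_A \oxm so_inc (lcs j))).
exists (r \c (1_A \oxm q)); last by apply: epi_comp => //; apply: epi_tensr.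
by rewrite [LHS]compA rE -compA -tensm_compr qE.
Qed.

(* B_{j+1} is generated by the brackets of the homogeneous components. *)
Lemma lcs_quot_ext j Y (g : Mor (lcs_quot m j.+1) Y) :
  (forall n0 ns c, size ns = j -> @isclass j _ (itcom n0 ns) c -> g \c c = 0) -> g = 0.
Proof.
move=> H; have [q qE qe] := Acom_epi j.
apply: (cokernel_epi (coker_prP (lcs_inc m j))); rewrite comp0f.
(* The unit object is inserted as the spectator factor [W] of [itinc_ext]. *)
apply: qe; rewrite comp0f; apply: (iso_epi (lunit_iso (Apow j))).
apply: itinc_ext => n0 ns e; subst j => /=; rewrite -!(compA _ (lunit _)) lunit_nat.
rewrite comp0f !compA -!compA.
have -> : g \c (coker_pr (lcs_inc m (size ns)) \c (q \c (itinc n0 ns \c lunit (itobj n0 ns)))) =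
   (g \c (coker_pr (lcs_inc m (size ns)) \c (q \c itinc n0 ns))) \c lunit (itobj n0 ns).
  by rewrite -!compA.
rewrite (H n0 ns) ?comp0f //; exists (q \c itinc n0 ns) => //.
by rewrite compA qE Acom_itinc.
Qed.

End TensorAlgebra.

(** * From the free algebra to morphisms *)

Section Link.
Context {k : fieldType} {D : sumTensorCategory k}.
Hypothesis char0 : [pchar k] =i pred0.
Variable V : D.
Implicit Types (X Y Z W : D).
Local Notation "1_ X" := (idmor X) (at level 8, X at level 7, format "1_ X").
Local Notation T := (tpow V).
Local Notation A := (tens_alg V).
Local Notation m := (tens_alg_mul V).
Local Notation cin := (cinj (tpow V)).
Local Notation wd := (wordv (letter k)).

Definition perms n := permutations (iota 0 n).

Lemma mem_perms n w : (w \in perms n) = isperm n w.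
Proof. exact: mem_permutations. Qed.

(* Words that are not permutations of [0, ..., n - 1] are sent to [0]. *)
Definition ev n : falg k -> Mor (T n) A := feval (perms n) (phi V n).

Lemma ev_lin n c x y : ev n (c *: x + y) = c *: ev n x + ev n y.
Proof. exact: feval_lin. Qed.

Lemma ev_lsum n r : {in r, forall p, isperm n p.2} -> ev n (lsum wd r) = lsum (phi V n) r.
Proof.
move=> rin; apply: feval_lsum; first exact: permutations_uniq.
by move=> p /rin; rewrite mem_perms.
Qed.

Lemma ev_lsum0 n r : {in r, forall p, ~~ isperm n p.2} -> ev n (lsum wd r) = 0.
Proof.
move=> rin; apply: feval_lsum0; first exact: permutations_uniq.
by move=> p /rin; rewrite mem_perms.
Qed.

Lemma lsum_phi_relabel n u r : isperm n u -> {in r, forall p, isperm n p.2} ->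
  lsum (phi V n) (relabel (nth 0%N u) r) = lsum (phi V n) r \c permw V n u.
Proof.
move=> pu pr; rewrite lsum_relabel /lsum comp_suml; apply: eq_big_seq => p /pr pp.
by rewrite phi_comp // compZl.
Qed.

(** Consecutive words of prescribed lengths: the universal multilinear arguments of a bracket, from
    which all others arise by relabelling. *)
Fixpoint stdws n0 ns : seq (seq nat) :=
  if ns is n :: ns' then iota 0 n :: map (map (addn n)) (stdws n0 ns') else [:: iota 0 n0].

Lemma size_stdws n0 ns : size (stdws n0 ns) = (size ns).+1.
Proof. by elim: ns => //= n ns; rewrite size_map => ->. Qed.

Lemma shape_stdws n0 ns : shape (stdws n0 ns) = rcons ns n0.
Proof.
elim: ns => [|n ns IH] /=; first by rewrite size_iota.
by rewrite size_iota /shape -map_comp -IH; congr (_ :: _); apply: eq_map => w /=; rewrite size_map.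
Qed.

Lemma flatten_stdws n0 ns : flatten (stdws n0 ns) = iota 0 (ittot n0 ns).
Proof.
elim: ns => [|n ns IH] /=; first by rewrite cats0.
by rewrite -map_flatten IH -iotaDl addn0 -iotaD.
Qed.

Lemma itcomE n0 ns :
  itcom V n0 ns = lsum (phi V (ittot n0 ns)) (brl k (stdws n0 ns)) \c itconcat V n0 ns.
Proof.
elim: ns => [|n ns IH].
  by rewrite /lsum /= big_seq1 scale1r /phi permw_iota !comp_idr.
have pr : {in brl k (stdws n0 ns), forall p, isperm (ittot n0 ns) p.2}.
  by move=> p /brl_perm; rewrite flatten_stdws.
rewrite [itcom _ _ _]/= IH [stdws _ _]/= brl_cons; last by rewrite size_map size_stdws.
rewrite brl_map; move: (brl k (stdws n0 ns)) pr => r pr {IH}.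
have -> : cin n \oxm (lsum (phi V (ittot n0 ns)) r \c itconcat V n0 ns) =
   (cin n \oxm lsum (phi V (ittot n0 ns)) r) \c (1_(T n) \oxm itconcat V n0 ns).
  by rewrite -tensm_comp comp_idr.
rewrite [itconcat _ _ _]/= !compA; congr (_ \c _).
rewrite /lsum /relabel tensm_sumr comp_sumr big_cat !big_map /= -big_split comp_suml.
apply: eq_big_seq => p /pr pp /=.
by rewrite tensmZr compZr phi_com // -compZl scalerBr scaleNr.
Qed.

Lemma map_nth_word u f n : isperm n u -> f =1 nth 0%N u -> map f (iota 0 n) = u.
Proof.
by move=> pu /eq_map ->; rewrite -(isperm_size pu) map_nth_iota0 // take_size.
Qed.

(** It suffices to treat a bracket of words. If it is not multilinear it evaluates to 0; otherwise
    it relabels the bracket of consecutive words, which is [itcom] up to an isomorphism and a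
    permutation of the source. *)
Lemma ev_L n j y : L j y -> inL j (ev n y).
Proof.
move=> /(L_words (@falg_words k)) /spanP_sum[r [rws ->]].
have ev_sum (s : seq (k * falg k)) : ev n (\sum_(p <- s) p.1 *: p.2) = \sum_(p <- s) p.1 *: ev n p.2.
  elim: s => [|p s IH]; last by rewrite !big_cons ev_lin IH.
  by rewrite !big_nil; have := ev_lin n (-1) 0 0; rewrite !scaleN1r !addNr.
rewrite ev_sum big_seq; elim/big_rec: _ => [|p h /rws[ws [sz ->]] Lh]; first exact: inL0.
apply: inLD => //; apply: inLZ; rewrite brk_brl.
have [pu|npu] := boolP (isperm n (flatten ws)); last first.
  rewrite ev_lsum0; first exact: inL0.
  by move=> q /brl_perm; rewrite /isperm => /permPl ->.
have pb (w : seq (seq nat)) : flatten w = flatten ws \/ flatten w = iota 0 n ->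
    {in brl k w, forall q, isperm n q.2}.
  by move=> [] e q /brl_perm pq; apply: perm_trans pq _; rewrite e //; apply: perm_refl.
rewrite ev_lsum; last by apply: pb; left.
case/lastP e: (shape ws) => [|ns n0].
  by have := congr1 size e; rewrite /shape size_map sz.
have en : ittot n0 ns = n.
  have := isperm_size pu; rewrite size_flatten e /ittot -cats1 sumn_cat /= addn0 => <-.
  by elim: (ns) => //= x s ->; rewrite addnA.
have ews : ws = map (map (nth 0%N (flatten ws))) (stdws n0 ns).
  apply: eq_from_flatten_shape.
    by rewrite -map_flatten flatten_stdws en (map_nth_word pu).
  rewrite e -(shape_stdws n0 ns) /shape -map_comp; apply: eq_map => w /=.
  by rewrite size_map.
rewrite [in brl k ws]ews brl_map lsum_phi_relabel //; last first.
  by apply: pb; right; rewrite flatten_stdws en.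
apply: inL_comp; have [K [_ KE]] := itconcat_iso V n0 ns.
have := inL_itcom V n0 ns; have -> : size ns = j.
  by have := congr1 size e; rewrite /shape size_map sz size_rcons => -[].
move=> /(inL_comp K); rewrite itcomE -compA KE comp_idr; by rewrite en.
Qed.

Definition stdus js := reshape js (iota 0 (sumn js)).

Lemma flatten_stdus js : flatten (stdus js) = iota 0 (sumn js).
Proof. by rewrite reshapeKr // size_iota. Qed.

Lemma shape_stdus js : shape (stdus js) = js.
Proof. by rewrite reshapeKl // size_iota. Qed.

Lemma size_stdus js : size (stdus js) = size js.
Proof. by rewrite -[in RHS](shape_stdus js) size_map. Qed.

Definition gendeg js p r := (sumn js + (p + r))%N.

(* The generator whose first arguments are words of lengths [js] and whose last one
   is a form with [p] letters and [r] differentials, on the letters 0, 1, ... *)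
Definition genm js p r : Mor (T (gendeg js p r)) A :=
  lsum (phi V (gendeg js p r)) (genl k (stdus js) (iota (sumn js) p) (iota (sumn js + p) r)).

Lemma isperm_std js p r :
  flatten (stdus js) ++ iota (sumn js) p ++ iota (sumn js + p) r = iota 0 (gendeg js p r).
Proof. by rewrite flatten_stdus -iotaD -[in iota (sumn js) _](add0n (sumn js)) -iotaD. Qed.

Lemma genl_isperm n us xs ys : ~~ odd (size ys) -> isperm n (flatten us ++ xs ++ ys) ->
  {in genl k us xs ys, forall q, isperm n q.2}.
Proof. by move=> oy pu q /(genl_perm oy) pq; apply: perm_trans pq _. Qed.

Lemma genl_relabel n us xs ys (js := shape us) (p := size xs) (r := size ys) :
  ~~ odd r -> isperm n (flatten us ++ xs ++ ys) -> exists e : n = gendeg js p r,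
  lsum (phi V n) (genl k us xs ys) =
  genm js p r \c (permw V (gendeg js p r) (flatten us ++ xs ++ ys) \c tcast V e).
Proof.
move=> oy pu; have e : n = gendeg js p r.
  by rewrite -(isperm_size pu) !size_cat size_flatten.
exists e; subst n; rewrite tcast_id comp_idr.
set u := flatten us ++ _ in pu *.
have := map_nth_word pu (fun=> erefl); rewrite -isperm_std !map_cat map_flatten => /eqP.
rewrite eqseq_cat; last first.
  by rewrite -map_flatten size_map flatten_stdus size_iota size_flatten.
rewrite eqseq_cat ?size_map ?size_iota // => /and3P[/eqP eu /eqP ex /eqP ey].
have eus : us = map (map (nth 0%N u)) (stdus js).
  apply: eq_from_flatten_shape; first by rewrite eu.
  rewrite -[LHS]/js -[LHS]shape_stdus /shape -map_comp; apply: eq_map => w /=.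
  by rewrite size_map.
rewrite [in LHS]eus -[in LHS]ex -[in LHS]ey genl_map lsum_phi_relabel //.
apply: genl_isperm; first by rewrite size_iota.
by rewrite isperm_std; apply: isperm_iota.
Qed.

End Link.

(** * Factorization of the generators through even forms *)

Lemma swp_catl i (s t : seq nat) : (i.+1 < size s)%N -> swp i (s ++ t) = swp i s ++ t.
Proof.
elim: s i => // x s IH [|i] /= lt; last by rewrite IH.
by case: s lt {IH}.
Qed.

Lemma swp_split i (s : seq nat) : (i.+1 < size s)%N ->
  exists s1 t u s2, s = s1 ++ t :: u :: s2 /\ swp i s = s1 ++ u :: t :: s2.
Proof.
elim: s i => // x s IH [|i] /= lt.
  by case: s lt {IH} => // y s _; exists [::], x, y, s.
by have [s1 [t [u [s2 [-> ->]]]]] := IH i lt; exists (x :: s1), t, u, s2.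
Qed.

Section Components.
Context {k : fieldType} {D : sumTensorCategory k}.
Hypothesis char0 : [pchar k] =i pred0.
Variable V : D.
Implicit Types (X Y Z W : D).
Local Notation "1_ X" := (idmor X) (at level 8, X at level 7, format "1_ X").
Local Notation T := (tpow V).
Local Notation A := (tens_alg V).
Local Notation m := (tens_alg_mul V).
Local Notation wd := (wordv (letter k)).
Local Notation inL := (@inL k D V).
Local Notation isclass j := (@isclass k D V j _).

(** The relation sits in the last argument of a bracket, where an element of [M3] contributes only
    to the next term; [ev_L] carries this over to morphisms. *)
Lemma inL_gen_rel n us xs ys xs' ys' c : (0 < size us)%N ->
  ~~ odd (size ys) -> ~~ odd (size ys') ->
  isperm n (flatten us ++ xs ++ ys) -> isperm n (flatten us ++ xs' ++ ys') ->
  M3 (rho (letter k) xs ys + c *: rho (letter k) xs' ys') ->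
  inL (size us).+1 (lsum (phi V n) (genl k us xs ys) + c *: lsum (phi V n) (genl k us xs' ys')).
Proof.
move=> us0 oy oy' pu pu' M.
rewrite -!ev_lsum; try by apply: genl_isperm.
rewrite addrC -ev_lin -!brk_genl -!cats1 -brk_lin addrC.
apply: ev_L; have := @brk_M3slot _ _ char0 (map wd us) _ [::] _ M.
by rewrite size_map addn0; apply.
Qed.

Lemma inL_genm js p r : ~~ odd r -> inL (size js) (genm V js p r).
Proof.
move=> or; rewrite /genm -ev_lsum; last first.
  apply: genl_isperm; first by rewrite size_iota.
  by rewrite isperm_std; apply: isperm_iota.
by apply: ev_L; rewrite -brk_genl; apply: brk_L; rewrite size_rcons size_map size_stdus.
Qed.

Lemma permw_swp_iota n i : (i.+1 < n)%N -> permw V n (swp i (iota 0 n)) = braid V n i.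
Proof. by move=> lt; rewrite permw_swp ?permw_iota ?comp_idr //; apply: isperm_iota. Qed.

Lemma genm_swp js p r i xs ys : ~~ odd r -> size xs = p -> size ys = r ->
  (i.+1 < gendeg js p r)%N ->
  swp i (iota 0 (gendeg js p r)) = iota 0 (sumn js) ++ xs ++ ys ->
  isperm (gendeg js p r) (flatten (stdus js) ++ xs ++ ys) /\
  genm V js p r \c braid V (gendeg js p r) i =
    lsum (phi V (gendeg js p r)) (genl k (stdus js) xs ys).
Proof.
move=> or sx sy lt e; set n := gendeg js p r in lt e *.
have pu : isperm n (swp i (iota 0 n)) by apply: isperm_swp; apply: isperm_iota.
split; first by rewrite flatten_stdus -e.
rewrite -permw_swp_iota // /genm -lsum_phi_relabel //; last first.
  apply: genl_isperm; first by rewrite size_iota.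
  by rewrite isperm_std; apply: isperm_iota.
rewrite -genl_map; have := map_nth_word pu (f := nth 0%N (swp i (iota 0 n))) (fun=> erefl).
set f := nth 0%N _; rewrite e -[iota 0 n](isperm_std js p r) !map_cat => /eqP.
rewrite eqseq_cat ?size_map ?flatten_stdus ?size_iota //.
rewrite eqseq_cat ?size_map ?size_iota // => /and3P[/eqP eu /eqP -> /eqP ->].
congr (lsum _ (genl _ _ _ _)).
by rewrite [in LHS]/stdus map_reshape eu.
Qed.

Lemma genm_symm js p r i : (0 < size js)%N -> ~~ odd r -> (i.+1 < p)%N ->
  inL (size js).+1 (genm V js p r - genm V js p r \c braid V (gendeg js p r) (sumn js + i)).
Proof.
move=> js0 or lt; set xs := iota (sumn js) p; set ys := iota (sumn js + p) r.
have e : swp (sumn js + i) (iota 0 (gendeg js p r)) = iota 0 (sumn js) ++ swp i xs ++ ys.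
  rewrite -(isperm_std js p r) flatten_stdus; have := swp_cat i (iota 0 (sumn js)) (xs ++ ys).
  by rewrite size_iota => ->; rewrite swp_catl ?size_iota.
have lt' : ((sumn js + i).+1 < gendeg js p r)%N by rewrite /gendeg; lia.
have [||pu ->] := genm_swp or _ _ lt' e; rewrite ?size_swp ?size_iota //.
rewrite -scaleN1r -(size_stdus js); apply: inL_gen_rel; rewrite ?size_stdus ?size_iota //.
  by rewrite isperm_std; apply: isperm_iota.
rewrite scaleN1r; have [|s1 [t [u [s2 [ex ->]]]]] := @swp_split i xs; first by rewrite size_iota.
by rewrite -/xs ex; apply: rho_swap.
Qed.

Lemma genm_alt js p r i : (0 < size js)%N -> ~~ odd r -> (i.+1 < r)%N ->
  inL (size js).+1 (genm V js p r + genm V js p r \c braid V (gendeg js p r) (sumn js + (p + i))).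
Proof.
move=> js0 or lt; set xs := iota (sumn js) p; set ys := iota (sumn js + p) r.
have e : swp (sumn js + (p + i)) (iota 0 (gendeg js p r)) = iota 0 (sumn js) ++ xs ++ swp i ys.
  rewrite -(isperm_std js p r) flatten_stdus.
  have := swp_cat (p + i) (iota 0 (sumn js)) (xs ++ ys); rewrite size_iota => ->.
  by have := swp_cat i xs ys; rewrite size_iota => ->.
have lt' : ((sumn js + (p + i)).+1 < gendeg js p r)%N by rewrite /gendeg; lia.
have [||pu ->] := genm_swp or _ _ lt' e; rewrite ?size_swp ?size_iota //.
rewrite -[X in _ + X]scale1r -(size_stdus js).
apply: inL_gen_rel; rewrite ?size_swp ?size_stdus ?size_iota //.
  by rewrite isperm_std; apply: isperm_iota.
have [|s1 [t [u [s2 [ey ->]]]]] := @swp_split i ys; first by rewrite size_iota.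
rewrite scale1r -/ys ey; apply: rho_alt => //.
by rewrite -ey size_iota.
Qed.

Definition gencat js p r : Mor (T (sumn js) \ox (T p \ox T r)) (T (gendeg js p r)) :=
  concat V (sumn js) (p + r) \c (1_(T (sumn js)) \oxm concat V p r).

Lemma gencat_iso js p r : is_iso (gencat js p r).
Proof.
by apply: iso_comp; [apply: iso_tens; [exact: iso_id|]|]; exact: concat_iso.
Qed.

Lemma gencat_braidl js p r i : (i.+1 < p)%N ->
  gencat js p r \c (1_(T (sumn js)) \oxm (braid V p i \oxm 1_(T r))) =
  braid V (gendeg js p r) (sumn js + i) \c gencat js p r.
Proof.
move=> lt; rewrite /gencat -[LHS]compA -tensm_compr -braid_concatl // tensm_compr [LHS]compA.
by rewrite -braid_concatr -[LHS]compA.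
Qed.

Lemma gencat_braidr js p r i :
  gencat js p r \c (1_(T (sumn js)) \oxm (1_(T p) \oxm braid V r i)) =
  braid V (gendeg js p r) (sumn js + (p + i)) \c gencat js p r.
Proof.
rewrite /gencat -[LHS]compA -tensm_compr -braid_concatr // tensm_compr [LHS]compA.
by rewrite -braid_concatr -[LHS]compA.
Qed.

Lemma isclass_zero j X (h : Mor X A) c : inL j.+1 h -> isclass j h c -> c = 0.
Proof. by move=> /isclass0 c0 /isclass_uniq /(_ c0). Qed.

(** By [genm_symm] and [genm_alt] the class of a generator kills the relations that define symmetric
    and exterior powers, so it factors through their tensor product. The factors for all p and q are
    then glued over the two sums. *)
Lemma gen_map js : (0 < size js)%N ->
  exists F : Mor (T (sumn js) \ox omega_even V) (lcs_quot m (size js).+1),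
  forall p q c, isclass (size js) (genm V js p q.*2 \c gencat js p q.*2) c ->
    exists h, c = F \c h.
Proof.
move=> js0; have oq q : ~~ odd q.*2 by rewrite odd_double.
have cls p q : exists c, isclass (size js) (genm V js p q.*2 \c gencat js p q.*2) c.
  exact/isclassP/inL_comp/inL_genm.
have fac p q : exists h' : Mor (T (sumn js) \ox (sym_pow V p \ox ext_pow V q.*2))
      (lcs_quot m (size js).+1),
    forall c, isclass (size js) (genm V js p q.*2 \c gencat js p q.*2) c -> exists h, c = h' \c h.
  have [c cc] := cls p q.
  have [||h' h'E] := factor_joint (f := fun i : 'I_p.-1 => 1_(T p) - braid V p i)
     (g := fun i : 'I_q.*2.-1 => 1_(T q.*2) + braid V q.*2 i) (h := c).
  - move=> i; have lt := ltn_adj i; apply: isclass_zero (isclass_comp _ cc).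
    rewrite -(compA _ (gencat _ _ _)).
    have -> : gencat js p q.*2 \c (1_(T (sumn js)) \oxm ((1_(T p) - braid V p i) \oxm 1_(T q.*2))) =
       gencat js p q.*2 - braid V (gendeg js p q.*2) (sumn js + i) \c gencat js p q.*2.
      rewrite -gencat_braidl // -scaleN1r tensmDl tensmZl tensmDr tensmZr scaleN1r !tensm_id.
      by rewrite compBr comp_idr.
    rewrite compBr compA -compBl; apply: inL_comp; exact: genm_symm.
  - move=> i; have lt := ltn_adj i; apply: isclass_zero (isclass_comp _ cc).
    rewrite -(compA _ (gencat _ _ _)).
    have -> : gencat js p q.*2 \c (1_(T (sumn js)) \oxm (1_(T p) \oxm (1_(T q.*2) + braid V q.*2 i))) =
       gencat js p q.*2 + braid V (gendeg js p q.*2) (sumn js + (p + i)) \c gencat js p q.*2.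
      by rewrite -gencat_braidr // !tensmDr !tensm_id compDr comp_idr.
    rewrite compDr compA -compDl; apply: inL_comp; exact: genm_alt.
  exists h' => c' /(isclass_uniq cc) <-.
  by exists (1_(T (sumn js)) \oxm (joint_pr _ \oxm joint_pr _)).
have [F FE] := csum2_copair (fun p q => projT1 (cid (fac p q))).
exists F => p q c cc; case: (cid (fac p q)) (FE p q) => /= h' h'P h'E.
by have [h ->] := h'P c cc; rewrite -h'E -compA; eexists.
Qed.

End Components.

(** * Assembly of the epimorphism *)

Section Assembly.
Context {k : fieldType} {D : sumTensorCategory k}.
Hypothesis char0 : [pchar k] =i pred0.
Variable V : D.
Implicit Types (X Y Z W : D).
Local Notation "1_ X" := (idmor X) (at level 8, X at level 7, format "1_ X").
Local Notation T := (tpow V).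
Local Notation A := (tens_alg V).
Local Notation m := (tens_alg_mul V).
Local Notation wd := (wordv (letter k)).
Local Notation inL := (@inL k D V).
Local Notation isclass j := (@isclass k D V j _).

Lemma cover_tens n (N : nat) (lam : 'I_N -> young_diagram)
    (h : forall a, Mor (schur (lam a) V) (T n)) :
  (forall Y (g : Mor (T n) Y), (forall a, g \c h a = 0) -> g = 0) ->
  forall Z Y (g : Mor (T n \ox Z) Y), (forall a, g \c (h a \oxm 1_Z) = 0) -> g = 0.
Proof.
move=> cov Z Y g g0.
have e : epi (\sum_a h a \c fproj (fun a => schur (lam a) V) a).
  apply: epi0 => Y' g' g'0; apply: cov => a.
  by rewrite -(fsum_projE h a) compA g'0 comp0f.
apply: (epi_tensl (W := Z) e); rewrite comp0f.
rewrite (big_morph (fun x => x \oxm 1_Z) (id1 := 0) (op1 := +%R)); first last.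
- exact: tensm0l.
- by move=> x y; rewrite tensmDl.
by rewrite comp_sumr big1 // => a _; rewrite tensm_compl compA g0 comp0f.
Qed.

(** Test condition for joint epimorphy: [h] defines a class that g kills. It is stable under linear
    combinations and precomposition. *)
Definition zclass j Y (g : Mor (lcs_quot m j.+1) Y) X (h : Mor X A) :=
  exists2 c, isclass j h c & g \c c = 0.

Lemma zclassD j Y g X (h h' : Mor X A) : @zclass j Y g X h -> zclass g h' -> zclass g (h + h').
Proof.
move=> [c cc gc] [c' cc' gc']; exists (c + c'); first exact: isclassD.
by rewrite compDr gc gc' addr0.
Qed.

Lemma zclassZ j Y g X (h : Mor X A) a : @zclass j Y g X h -> zclass g (a *: h).
Proof.
by move=> [c cc gc]; exists (a *: c); [exact: isclassZ|rewrite compZr gc scaler0].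
Qed.

Lemma zclass_comp j Y g X Z (h : Mor X A) (f : Mor Z X) : @zclass j Y g X h -> zclass g (h \c f).
Proof.
by move=> [c cc gc]; exists (c \c f); [exact: isclass_comp|rewrite compA gc comp0f].
Qed.

Lemma zclass_inL j Y (g : Mor (lcs_quot m j.+1) Y) X (h : Mor X A) : inL j.+1 h -> zclass g h.
Proof. by move=> Lh; exists 0; [exact: isclass0|rewrite compf0]. Qed.

Lemma zclass_span j Y (g : Mor (lcs_quot m j.+1) Y) n (P : falg k -> Prop) y :
  (forall y, P y -> zclass g (ev V n y)) -> span P y -> zclass g (ev V n y).
Proof.
move=> Pz; elim=> {y} [|y /Pz //|x y _ Zx _ Zy|c y _ Zy].
- have -> : ev V n 0 = 0 by have := ev_lin V n (-1) 0 0; rewrite !scaleN1r !addNr.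
  exact/zclass_inL/inL0.
- by have := ev_lin V n 1 x y; rewrite !scale1r => ->; apply: zclassD.
- have -> : ev V n (c *: y) = c *: ev V n y.
    have e0 : ev V n 0 = 0 by have := ev_lin V n (-1) 0 0; rewrite !scaleN1r !addNr.
    by have := ev_lin V n c y 0; rewrite !addr0 e0 addr0.
  exact: zclassZ.
Qed.

(** [brk_generation] is applied to consecutive words and evaluated: terms deeper in the series have
    class zero, terms that are not multilinear vanish, and the others are standard generators
    precomposed with a permutation. *)
Lemma lcs_quot_generated j : (0 < j)%N ->
  exists M : nat, forall (F : forall js, Mor (T (sumn js) \ox omega_even V) (lcs_quot m j.+1)),
  (forall js, size js = j -> all (fun x => x <= M)%N js ->
     forall p q c, isclass j (genm V js p q.*2 \c gencat V js p q.*2) c ->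
       exists h, c = F js \c h) ->
  forall Y (g : Mor (lcs_quot m j.+1) Y),
    (forall js, size js = j -> all (fun x => x <= M)%N js -> g \c F js = 0) -> g = 0.
Proof.
move=> j0; have [M gM] := brk_generation char0 (letter k) j0.
exists M => F FP Y g g0; apply: lcs_quot_ext => n0 ns c sns cc.
have [c' cc' gc'] : zclass g (itcom V n0 ns); last by rewrite (isclass_uniq cc cc').
rewrite itcomE -ev_lsum; last by move=> p /brl_perm; rewrite flatten_stdws.
apply: zclass_comp; rewrite -brk_brl; set n := ittot n0 ns.
apply: zclass_span (gM (stdws n0 ns) _); last by rewrite size_stdws sns.
move=> y [Ly|[us [xs [ys [sus aus oys ->]]]]]; first exact/zclass_inL/ev_L.
rewrite brk_genl; have [pu|npu] := boolP (isperm n (flatten us ++ xs ++ ys)); last first.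
  rewrite ev_lsum0; first exact/zclass_inL/inL0.
  by move=> q /(genl_perm oys) /permPl e; rewrite /isperm e.
rewrite ev_lsum; last exact: genl_isperm.
have [e ->] := genl_relabel V oys pu; apply: zclass_comp.
have [K [_ KE]] := gencat_iso V (shape us) (size xs) (size ys).
have sj : size (shape us) = j by rewrite /shape size_map.
rewrite -[genm _ _ _ _]comp_idr -KE compA; apply: zclass_comp.
(* The even part of the forms is indexed by half the number of differentials. *)
have eq : (size ys)./2.*2 = size ys by rewrite -[RHS]odd_double_half (negbTE oys).
rewrite -eq in oys *.
have [d dd] : exists d, isclass j (genm V (shape us) (size xs) (size ys)./2.*2
     \c gencat V (shape us) (size xs) (size ys)./2.*2) d.
  by apply/isclassP/inL_comp; rewrite -sj; apply: inL_genm.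
exists d => //; have [|h ->] := FP (shape us) sj _ _ _ d dd; first by rewrite all_map.
by rewrite compA g0 ?comp0f // all_map.
Qed.

Lemma fsum_epi (I : finType) (lam : I -> young_diagram) B
   (f : forall a, Mor (schur_omega (lam a) V) B) :
  (forall Y (g : Mor B Y), (forall a, g \c f a = 0) -> g = 0) ->
  exists (n : nat) (lam' : 'I_n -> young_diagram)
    (f' : Mor (fsum (fun a => schur_omega (lam' a) V)) B), epi f'.
Proof.
move=> fP; exists #|I|, (fun a => lam (enum_val a)).
exists (\sum_a f (enum_val a) \c fproj (fun a => schur_omega (lam (enum_val a)) V) a).
apply: epi0 => Y g g0; apply: fP => a; rewrite -(enum_rankK a).
by rewrite -(fsum_projE (fun a => f (enum_val a)) (enum_rank a)) compA g0 comp0f.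
Qed.

Lemma lcs_quot_epi j : (0 < j)%N ->
  exists (n : nat) (lam : 'I_n -> young_diagram)
    (f : Mor (fsum (fun a => schur_omega (lam a) V)) (lcs_quot m j.+1)), epi f.
Proof.
move=> j0; have [M MP] := lcs_quot_generated j0.
have FE js : exists F : Mor (T (sumn js) \ox omega_even V) (lcs_quot m j.+1), size js = j ->
    forall p q c, isclass j (genm V js p q.*2 \c gencat V js p q.*2) c -> exists h, c = F \c h.
  (* The zero morphism serves for lists of the wrong size and makes [F] total. *)
  have [sj|/eqP sj] := eqVneq (size js) j; last by exists 0 => /sj.
  have js0 : (0 < size js)%N by rewrite sj.
  by subst j; have [F FP] := gen_map char0 V js0; exists F.
pose F js := projT1 (cid (FE js)).
have FP js : size js = j -> forall p q c, isclass j (genm V js p q.*2 \c gencat V js p q.*2) c ->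
    exists h, c = F js \c h.
  by rewrite /F; case: cid.
pose N n := projT1 (cid (schur_cover char0 V n)).
have H1 n : exists (lam : 'I_(N n) -> young_diagram) (h : forall a, Mor (schur (lam a) V) (T n)),
    forall Y (g : Mor (T n) Y), (forall a, g \c h a = 0) -> g = 0.
  by rewrite /N; case: cid.
pose lam n := projT1 (cid (H1 n)).
have H2 n : exists h : forall a, Mor (schur (lam n a) V) (T n),
    forall Y (g : Mor (T n) Y), (forall a, g \c h a = 0) -> g = 0.
  by rewrite /lam; case: cid.
pose h n := projT1 (cid (H2 n)).
have hP n : forall Y (g : Mor (T n) Y), (forall a, g \c h n a = 0) -> g = 0.
  by rewrite /h; case: cid.
pose jt (t : j.-tuple 'I_M.+1) := map val t.
(* The finite index set: the lengths of the j words, each at most [M], together with a component of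
   the Schur cover in the total degree. *)
apply: (@fsum_epi {t : j.-tuple 'I_M.+1 & 'I_(N (sumn (jt t)))}
   (fun x => lam _ (tagged x)) _
   (fun x => F (jt (tag x)) \c (h _ (tagged x) \oxm 1_(omega_even V)))).
move=> Y g g0; apply: (MP F) => [js sj _|js sj alljs]; first exact: FP.
have [t et] : exists t, jt t = js.
  have st : size (map (inord : nat -> 'I_M.+1) js) == j by rewrite size_map sj.
  exists (Tuple st); rewrite /jt /= -map_comp -[RHS]map_id; apply/eq_in_map => x xin.
  by rewrite /= inordK // ltnS (allP alljs).
subst js; apply: (cover_tens (hP _)) => a.
by rewrite -compA; apply: (g0 (existT _ t a)).
Qed.

End Assembly.

Theorem proposition1p8 (k : fieldType) (char0 : [pchar k] =i pred0)
    (C : symTensorCategory k) (D : sum_extension C) (V : C)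
    (i : nat) (hi : (2 <= i)%N) :
  let VD := ext_emb D V in
  exists (n : nat) (lam : 'I_n -> young_diagram)
    (f : Mor (fsum (fun a => schur_omega (lam a) VD))
             (lcs_quot (tens_alg_mul VD) i)),
    epi f.
Proof.
(* B_{j+2} consists of classes of brackets of j + 2 arguments, that is with j + 1 > 0
   commutators. *)
by case: i hi => [|[|j]] // _; apply: lcs_quot_epi.
Qed.
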